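(* Let $(R,\mathfrak m)$ be a Cohen-Macaulay local ring of dimension two with infinite residue field and let $I,J$ be $\mathfrak m$-primary ideals of $R$. Assume that $\operatorname{depth}G(I)\ge1$ and $\operatorname{depth}G(J)\ge1$. Then the following statements are equivalent: (a) $r(I|J)=0$; (b) $e_{(1,0)}=e_1(I)$, $e_{(0,1)}=e_1(J)$ and $e_2(IJ)=e_2(I)+e_2(J)$; (c) for every joint reduction $(a,b)$ of $I$ and $J$, $[H^2_{(at_1,bt_2)}(\mathcal R')]_{(0,0)}=0$.
   Context: $\ell$ denotes length of $R$-modules. $I^n=J^n=R$ for $n\le0$. $G(I)=\bigoplus_{n\ge0}I^n/I^{n+1}$ is the associated graded ring of $I$. A pair $(a,b)$ is a joint reduction of $I$ and $J$ if $a\in I$, $b\in J$ and $I^{r+1}J^{s+1}=aI^rJ^{s+1}+bI^{r+1}J^s$ for all large $r,s$. One writes $r(I|J)=0$ (joint reduction number zero) if there is a joint reduction $(a,b)$ of $I$ and $J$ with $IJ=aJ+bI$. $\mathcal R'=\bigoplus_{r,s\in\mathbb Z}I^rJ^st_1^rt_2^s\subseteq R[t_1^{\pm1},t_2^{\pm1}]$ is the bigraded extended Rees algebra; $H^2_{(at_1,bt_2)}(\mathcal R')$ is its second local cohomology module with support in the ideal $(at_1,bt_2)$, and $[\,\cdot\,]_{(r,s)}$ is the bigraded component. Hilbert coefficients: for an $\mathfrak m$-primary ideal $K$, $\ell(R/K^n)=e_0(K)\binom{n+1}{2}-e_1(K)n+e_2(K)$ for $n\gg0$. Bigraded Hilbert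 coefficients $e_{(i,j)}$ of $\{I^rJ^s\}$: $\ell(R/I^rJ^s)=\sum_{i+j\le 2}(-1)^{i+j}e_{(i,j)}\binom{r+i-1}{i}\binom{s+j-1}{j}$ for all $r,s\gg0$. *)

(* Defs.v *)
From HB Require Import structures.
From mathcomp Require Import all_boot all_order all_algebra.
From mathcomp Require Import finmap generic_quotient ring_quotient.
From mathcomp Require Import boolp classical_sets cardinality.
From mathcomp Require Import monalg.
From mathcomp Require Import ring.

Set Implicit Arguments.
Unset Strict Implicit.
Unset Printing Implicit Defensive.

Import Order.TTheory GRing.Theory Num.Theory.
Local Open Scope ring_scope.
Local Open Scope quotient_scope.

Section Submodules.
Variables (A : pzRingType) (V : lmodType A).

Lemma submodB (N : submodClosed V) u v : u \in N -> v \in N -> u - v \in N.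
Proof.
by move=> Nu Nv; apply: rpredD => //; rewrite -scaleN1r; exact: rpredZ.
Qed.

(* [submodClosed] does not inherit from [zmodClosed], on which [Quotient.quot]
   is defined. *)
Definition submod_zmod_pred (N : submodClosed V) : {pred V} := fun v => v \in N.
Fact submod_zmod_closed N : zmod_closed (submod_zmod_pred N).
Proof. by split=> [|u v Nu Nv]; [exact: rpred0 | exact: submodB]. Qed.
HB.instance Definition _ N :=
  GRing.isZmodClosed.Build V (submod_zmod_pred N) (submod_zmod_closed N).

End Submodules.

(* The unit ideal is allowed: it is the value of the nonpositive powers. *)
Notation ideal A := (submodClosed A^o).

Section Ideals.
Variable A : comPzRingType.
Implicit Types I J : ideal A.

Definition idealT_pred : {pred A^o} := xpredT.
Fact idealT_closed : submod_closed idealT_pred. Proof. by []. Qed.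
HB.instance Definition _ :=
  GRing.isSubmodClosed.Build A A^o idealT_pred idealT_closed.
Definition idealT : ideal A := idealT_pred.

Definition idealM_pred I J : {pred A^o} := fun x =>
  `[< exists2 s : seq (A * A),
        (forall p, p \in s -> p.1 \in I /\ p.2 \in J)
      & x = \sum_(p <- s) p.1 * p.2 >].
Fact idealM_closed I J : submod_closed (idealM_pred I J).
Proof.
split; first by apply/asboolP; exists [::]; rewrite ?big_nil.
move=> a _ _ /asboolP[s hs ->] /asboolP[t ht ->]; apply/asboolP.
exists ([seq (a * p.1, p.2) | p <- s] ++ t).
  move=> p; rewrite mem_cat => /orP[/mapP[q qs ->]|/ht//] /=.
  by have [q1 q2] := hs _ qs; split=> //; exact: (rpredZ a q1).
rewrite big_cat big_map /= /GRing.scale /= mulr_sumr; congr (_ + _).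
by apply: eq_bigr => p _; rewrite mulrA.
Qed.
HB.instance Definition _ I J :=
  GRing.isSubmodClosed.Build A A^o (idealM_pred I J) (idealM_closed I J).
Definition idealM I J : ideal A := idealM_pred I J.

Fixpoint idealX I (n : nat) : ideal A :=
  if n is n'.+1 then idealM I (idealX I n') else idealT.

Definition idealXz I (n : int) : ideal A :=
  if n is Posz k then idealX I k else idealT.

Definition idgen_pred (s : seq A) : {pred A^o} := fun x =>
  `[< exists c : nat -> A, x = \sum_(i < size s) c i * s`_i >].
Fact idgen_closed s : submod_closed (idgen_pred s).
Proof.
split.
  by apply/asboolP; exists (fun=> 0); rewrite big1 // => i _; rewrite mul0r.
move=> a _ _ /asboolP[c ->] /asboolP[d ->]; apply/asboolP.
exists (fun i => a * c i + d i).
rewrite /GRing.scale /= mulr_sumr -big_split /=.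
by apply: eq_bigr => i _; rewrite mulrDl mulrA.
Qed.
HB.instance Definition _ s :=
  GRing.isSubmodClosed.Build A A^o (idgen_pred s) (idgen_closed s).
Definition idgen s : ideal A := idgen_pred s.

Lemma idealM_mem I J x y : x \in I -> y \in J -> x * y \in idealM I J.
Proof.
move=> xI yJ; apply/asboolP; exists [:: (x, y)]; last by rewrite big_seq1.
by move=> p; rewrite inE => /eqP ->.
Qed.

Lemma idealM_sub I J (K : ideal A) :
  (forall x y, x \in I -> y \in J -> x * y \in K) ->
  {subset idealM I J <= K}.
Proof.
move=> h _ /asboolP[s hs ->]; rewrite big_seq.
by apply: rpred_sum => p /hs[]; exact: h.
Qed.

Lemma ideal_mull I (a x : A) : x \in I -> a * x \in I.
Proof. exact: (@rpredZ _ _ I a). Qed.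

Lemma idealX_mulD I n p x y :
  x \in idealX I n -> y \in idealX I p -> x * y \in idealX I (n + p).
Proof.
elim: n x => [|n IHn] x /=; first by move=> _ hy; exact: ideal_mull.
move=> /asboolP[s hs ->] hy; rewrite mulr_suml big_seq.
apply: rpred_sum => q /hs[q1 q2].
by rewrite -mulrA; apply: idealM_mem => //; exact: IHn.
Qed.

Lemma idealX_le I n p x : (p <= n)%N -> x \in idealX I n -> x \in idealX I p.
Proof.
move=> /subnK <-; elim: (n - p)%N x => [x|k IHk x]; first by rewrite add0n.
by apply: (@idealM_sub I _ (idealX I p)) => u v _ /IHk; exact: ideal_mull.
Qed.

Lemma idealXz_mulD I (n p : int) x y :
  x \in idealXz I n -> y \in idealXz I p -> x * y \in idealXz I (n + p).
Proof.
case: n p => n [] p /=.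
- exact: idealX_mulD.
- move=> hx _; rewrite mulrC; apply: ideal_mull.
  case E: (_ + _) => [k|//] /=; apply: idealX_le hx.
  by rewrite -lez_nat -E gerDl.
- move=> _ hy; apply: ideal_mull.
  case E: (_ + _) => [k|//] /=; apply: idealX_le hy.
  by rewrite -lez_nat -E gerDr.
- by [].
Qed.

Definition maximal_ideal I :=
  1 \notin I /\
  forall J, 1 \notin J -> {subset I <= J} -> {subset J <= I}.

Definition noetherian_ring :=
  forall I, exists s : seq A, I =i idgen s.

Definition local_ring (m : ideal A) :=
  maximal_ideal m /\ forall n : ideal A, maximal_ideal n -> n =i m.

Definition primary_to (m I : ideal A) :=
  [/\ 1 \notin I,
      forall x y, x * y \in I -> x \in I \/ exists n, y ^+ n \in I
    & forall x, x \in m <-> exists n, x ^+ n \in I].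

End Ideals.
Arguments idealT {A}.

Section QuotientModule.
Variables (A : comPzRingType) (V : lmodType A) (N : submodClosed V).

Definition quot_mod : Type := Quotient.quot (submod_zmod_pred N).
HB.instance Definition _ := GRing.Zmodule.on quot_mod.
HB.instance Definition _ := EqQuotient.on quot_mod.

Definition qmod_pi (v : V) : quot_mod := \pi_(Quotient.quot (submod_zmod_pred N)) v.

Lemma qmod_piP u v : qmod_pi u = qmod_pi v <-> u - v \in N.
Proof.
rewrite -[u - v \in N]/(u - v \in submod_zmod_pred N) Quotient.idealrBE.
by split=> [/eqP|/eqP].
Qed.

Lemma qmod_repr (q : quot_mod) : qmod_pi (repr q) = q.
Proof. exact: reprK. Qed.

Lemma qmod_piD u v : qmod_pi (u + v) = qmod_pi u + qmod_pi v.
Proof. by rewrite /qmod_pi piE. Qed.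

Definition qmod_scale (a : A) (q : quot_mod) : quot_mod :=
  qmod_pi (a *: repr q).

Lemma qmod_piZ a v : qmod_pi (a *: v) = qmod_scale a (qmod_pi v).
Proof.
apply/qmod_piP; rewrite -scalerBr; apply: rpredZ.
by apply/qmod_piP; rewrite qmod_repr.
Qed.

Fact qmod_scaleA a b q : qmod_scale a (qmod_scale b q) = qmod_scale (a * b) q.
Proof. by rewrite -(qmod_repr q) -!qmod_piZ scalerA. Qed.
Fact qmod_scale1 : left_id 1 qmod_scale.
Proof. by move=> q; rewrite -{2}(qmod_repr q) /qmod_scale scale1r. Qed.
Fact qmod_scaleDr : right_distributive qmod_scale +%R.
Proof.
move=> a q r; rewrite -(qmod_repr q) -(qmod_repr r).
by rewrite -qmod_piD -!qmod_piZ scalerDr qmod_piD.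
Qed.
Fact qmod_scaleDl q : {morph qmod_scale^~ q : a b / a + b}.
Proof. by move=> a b; rewrite -(qmod_repr q) -!qmod_piZ scalerDl qmod_piD. Qed.

HB.instance Definition _ := GRing.Zmodule_isLmodule.Build A quot_mod
  qmod_scaleA qmod_scale1 qmod_scaleDr qmod_scaleDl.

End QuotientModule.

Section QuotientRing.
Variables (A : comPzRingType) (I : ideal A).

Definition quot_ring : Type := quot_mod I.
HB.instance Definition _ := GRing.Zmodule.on quot_ring.

Definition qring_pi (x : A) : quot_ring := qmod_pi I x.
Definition qring_one : quot_ring := qring_pi 1.
Definition qring_mul (p q : quot_ring) : quot_ring :=
  qring_pi ((repr (p : quot_mod I) : A) * (repr (q : quot_mod I) : A)).

Lemma qring_piP x y : qring_pi x = qring_pi y <-> x - y \in I.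
Proof. exact: (qmod_piP I x y). Qed.

Lemma qring_surj (q : quot_ring) : exists x, q = qring_pi x.
Proof. by exists (repr (q : quot_mod I)); rewrite /qring_pi qmod_repr. Qed.

Lemma qring_piD x y : qring_pi (x + y) = qring_pi x + qring_pi y.
Proof. exact: (qmod_piD I x y). Qed.

Lemma qring_piM x y : qring_pi (x * y) = qring_mul (qring_pi x) (qring_pi y).
Proof.
apply/qring_piP; set x' := repr _; set y' := repr _.
have hx : x - x' \in I by apply/qmod_piP; rewrite qmod_repr.
have hy : y - y' \in I by apply/qmod_piP; rewrite qmod_repr.
have -> : x * y - (x' : A) * (y' : A) = y * (x - x') + x' * (y - y') by ring.
by apply: rpredD; exact: ideal_mull.
Qed.

Fact qring_mulA : associative qring_mul.
Proof.
move=> p q r; have [[x ->] [y ->] [z ->]] :=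
  And3 (qring_surj p) (qring_surj q) (qring_surj r).
by rewrite -!qring_piM mulrA.
Qed.
Fact qring_mulC : commutative qring_mul.
Proof.
move=> p q; have [[x ->] [y ->]] := conj (qring_surj p) (qring_surj q).
by rewrite -!qring_piM mulrC.
Qed.
Fact qring_mul1 : left_id qring_one qring_mul.
Proof. by move=> p; have [x ->] := qring_surj p; rewrite -qring_piM mul1r. Qed.
Fact qring_mulDl : left_distributive qring_mul +%R.
Proof.
move=> p q r; have [[x ->] [y ->] [z ->]] :=
  And3 (qring_surj p) (qring_surj q) (qring_surj r).
by rewrite -qring_piD -!qring_piM mulrDl qring_piD.
Qed.
Fact qring_mul0 : left_zero 0 qring_mul.
Proof.
move=> q; have [x ->] := qring_surj q.
have -> : 0 = qring_pi 0 by rewrite /qring_pi /qmod_pi piE.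
by rewrite -qring_piM mul0r.
Qed.
HB.instance Definition _ := GRing.Zmodule_isComPzRing.Build quot_ring
  qring_mulA qring_mulC qring_mul1 qring_mulDl.

End QuotientRing.

Definition strict_chain T (N : nat -> {pred T}) (n : nat) :=
  forall i, (i < n)%N ->
    {subset N i <= N i.+1} /\ ~ {subset N i.+1 <= N i}.

Section Length.
Variables (A : comPzRingType) (V : lmodType A).

Definition length_ge (n : nat) :=
  exists N : nat -> submodClosed V, strict_chain N n.

(* ℓ(V) is finite and equal to l *)
Definition has_length (l : nat) :=
  length_ge l /\ forall n, length_ge n -> (n <= l)%N.

End Length.

Definition krull_dim_ge (A : comNzRingType) (n : nat) :=
  exists P : nat -> prime_idealr A, strict_chain P n.

Definition krull_dim (A : comNzRingType) (d : nat) :=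
  krull_dim_ge A d /\ forall n, krull_dim_ge A n -> (n <= d)%N.

Section Depth.
Variable A : comPzRingType.

Definition regular_seq (s : seq A) :=
  (forall i, (i < size s)%N -> forall v : A,
     s`_i * v \in idgen (take i s) -> v \in idgen (take i s))
  /\ 1 \notin idgen s.

(* depth of the ring [A] in the ideal [Q], i.e. grade(Q, A) *)
Definition depth_ge (Q : ideal A) (n : nat) :=
  exists s : seq A, [/\ size s = n, {subset s <= Q} & regular_seq s].

Definition depth (Q : ideal A) (d : nat) :=
  depth_ge Q d /\ forall n, depth_ge Q n -> (n <= d)%N.

End Depth.

(* [A] is meant to be a noetherian local ring with maximal ideal [m]. *)
Definition cohen_macaulay (A : comNzRingType) (m : ideal A) :=
  exists2 d, krull_dim A d & depth m d.

Section AssociatedGraded.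
Variable A : comNzRingType.
Variables (m I : ideal A).

(* the Rees algebra ⨁ I^n t^n as a subring of A[t] *)
Definition rees_pred : {pred {poly A}} := fun p =>
  `[< forall n, p`_n \in idealX I n >].
Fact rees_closed : subring_closed rees_pred.
Proof.
split.
- apply/asboolP => n; rewrite coef1.
  by case: n => [//|n]; exact: rpred0.
- move=> p q /asboolP hp /asboolP hq; apply/asboolP => n.
  by rewrite coefB; exact: (@submodB _ A^o).
- move=> p q /asboolP hp /asboolP hq; apply/asboolP => n.
  rewrite coefM; apply: rpred_sum => i _.
  by have := idealX_mulD (hp i) (hq (n - i)%N); rewrite subnKC ?leq_ord.
Qed.
HB.instance Definition _ :=
  GRing.isSubringClosed.Build {poly A} rees_pred rees_closed.

Record rees := Rees { rees_val :> {poly A}; rees_valP : rees_val \in rees_pred }.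
HB.instance Definition _ := [isSub for rees_val].
HB.instance Definition _ := [Choice of rees by <:].
HB.instance Definition _ := [SubChoice_isSubComNzRing of rees by <:].

Lemma rees_coef (p : rees) n : p`_n \in idealX I n.
Proof. by have /asboolP := rees_valP p. Qed.

(* the ideal ⨁ I^(n+1) t^n *)
Definition reesS_pred : {pred rees^o} := fun p =>
  `[< forall n, (rees_val p)`_n \in idealX I n.+1 >].
Fact reesS_closed : submod_closed reesS_pred.
Proof.
split; first by apply/asboolP => n; rewrite coef0; exact: rpred0.
move=> a p q /asboolP hp /asboolP hq; apply/asboolP => n.
rewrite coefD; apply: rpredD => //; rewrite coefM.
apply: rpred_sum => i _.
by have := idealX_mulD (rees_coef a i) (hp (n - i)%N);
  rewrite addnS subnKC ?leq_ord.
Qed.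
HB.instance Definition _ :=
  GRing.isSubmodClosed.Build rees rees^o reesS_pred reesS_closed.
Definition reesS : ideal rees := reesS_pred.

(* G(I) = ⨁ I^n / I^(n+1), obtained as (⨁ I^n t^n) / (⨁ I^(n+1) t^n) *)
Definition gr : comPzRingType := quot_ring reesS.

(* the homogeneous ideal m/I ⊕ ⨁_(n > 0) I^n / I^(n+1) of G(I), which is its
   homogeneous maximal ideal when A is local with maximal ideal m ⊇ I *)
Definition gr_max_pred : {pred gr^o} := fun z =>
  `[< exists2 p : rees, (rees_val p)`_0 \in m & z = qring_pi reesS p >].
Fact gr_max_closed : submod_closed gr_max_pred.
Proof.
split.
  apply/asboolP; exists 0; first by rewrite coef0; exact: rpred0.
  by rewrite /qring_pi /qmod_pi piE.
move=> a _ _ /asboolP[p hp ->] /asboolP[q hq ->]; apply/asboolP.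
have [r ->] := qring_surj a.
exists (r * p + q); last by rewrite qring_piD qring_piM.
by rewrite coefD coef0M; apply: rpredD => //; exact: ideal_mull.
Qed.
HB.instance Definition _ :=
  GRing.isSubmodClosed.Build gr gr^o gr_max_pred gr_max_closed.
Definition gr_max : ideal gr := gr_max_pred.

End AssociatedGraded.

(* depth G(I) >= n for (A, m) local: the depth is taken in the homogeneous
   maximal ideal of G(I). *)
Definition gr_depth_ge (A : comNzRingType) (m I : ideal A) (n : nat) :=
  depth_ge (gr_max m I) n.

Section Localization.
Variables (S : comPzRingType) (x : S).

(* (s, n) stands for s / x^n *)
Definition loc_rel (u v : S * nat) : bool :=
  `[< exists k, x ^+ k * (x ^+ v.2 * u.1) = x ^+ k * (x ^+ u.2 * v.1) >].

Fact loc_rel_equiv : equiv_class_of loc_rel.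
Proof.
split=> [u|u v|v u w].
- by apply/asboolP; exists 0%N.
- by apply/asboolP/asboolP => -[k hk]; exists k; rewrite hk.
- move=> /asboolP[k hk] /asboolP[l hl]; apply/asboolP.
  exists (k + l + v.2)%N.
  transitivity (x ^+ l * x ^+ w.2 * (x ^+ k * (x ^+ v.2 * u.1))); first by rewrite ?exprD; ring.
  rewrite hk.
  transitivity (x ^+ k * x ^+ u.2 * (x ^+ l * (x ^+ w.2 * v.1))); first by rewrite ?exprD; ring.
  by rewrite hl ?exprD; ring.
Qed.
Canonical loc_equiv := EquivRelPack loc_rel_equiv.
Canonical loc_encModRel := defaultEncModRel loc_rel.

Definition loc : Type := {eq_quot loc_rel}.
HB.instance Definition _ := Choice.on loc.
HB.instance Definition _ := EqQuotient.on loc.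

Definition frac (s : S) (n : nat) : loc := \pi_({eq_quot loc_rel}) (s, n).
Definition loc_num (z : loc) : S := (repr z).1.
Definition loc_exp (z : loc) : nat := (repr z).2.

Lemma fracP s n t p :
  frac s n = frac t p <-> exists k, x ^+ k * (x ^+ p * s) = x ^+ k * (x ^+ n * t).
Proof.
split=> [/eqP|h]; first by rewrite eqmodE => /asboolP.
by apply/eqP; rewrite eqmodE; apply/asboolP.
Qed.

Lemma loc_numK z : frac (loc_num z) (loc_exp z) = z.
Proof. by rewrite /frac -surjective_pairing reprK. Qed.

Lemma loc_surj z : exists s n, z = frac s n.
Proof. by exists (loc_num z), (loc_exp z); rewrite loc_numK. Qed.

Definition loc_add (y z : loc) : loc :=
  frac (x ^+ loc_exp z * loc_num y + x ^+ loc_exp y * loc_num z)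
       (loc_exp y + loc_exp z).
Definition loc_opp (z : loc) : loc := frac (- loc_num z) (loc_exp z).
Definition loc_mul (y z : loc) : loc :=
  frac (loc_num y * loc_num z) (loc_exp y + loc_exp z).

Lemma loc_addE s n t p :
  loc_add (frac s n) (frac t p) = frac (x ^+ p * s + x ^+ n * t) (n + p).
Proof.
have /fracP[k hk] := loc_numK (frac s n).
have /fracP[l hl] := loc_numK (frac t p).
rewrite /loc_add; move: (loc_num _) (loc_exp _) hk => s' n' hk.
move: (loc_num _) (loc_exp _) hl => t' p' hl.
apply/fracP; exists (k + l)%N.
transitivity (x ^+ (l + p + p') * (x ^+ k * (x ^+ n * s'))
  + x ^+ (k + n + n') * (x ^+ l * (x ^+ p * t'))); first by rewrite ?exprD; ring.
by rewrite hk hl ?exprD; ring.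
Qed.

Lemma loc_oppE s n : loc_opp (frac s n) = frac (- s) n.
Proof.
have /fracP[k hk] := loc_numK (frac s n).
by apply/fracP; exists k; rewrite !mulrN hk.
Qed.

Lemma loc_mulE s n t p :
  loc_mul (frac s n) (frac t p) = frac (s * t) (n + p).
Proof.
have /fracP[k hk] := loc_numK (frac s n).
have /fracP[l hl] := loc_numK (frac t p).
rewrite /loc_mul; move: (loc_num _) (loc_exp _) hk => s' n' hk.
move: (loc_num _) (loc_exp _) hl => t' p' hl.
apply/fracP; exists (k + l)%N.
transitivity ((x ^+ k * (x ^+ n * s')) * (x ^+ l * (x ^+ p * t')));
  first by rewrite ?exprD; ring.
by rewrite hk hl ?exprD; ring.
Qed.

Fact loc_addA : associative loc_add.
Proof.
move=> a b c; have [s [n ->]] := loc_surj a.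
have [t [p ->]] := loc_surj b; have [u [q ->]] := loc_surj c.
by rewrite !loc_addE; apply/fracP; exists 0%N; rewrite ?exprD; ring.
Qed.
Fact loc_addC : commutative loc_add.
Proof.
move=> a b; have [s [n ->]] := loc_surj a; have [t [p ->]] := loc_surj b.
by rewrite !loc_addE; apply/fracP; exists 0%N; rewrite ?exprD; ring.
Qed.
Fact loc_add0 : left_id (frac 0 0) loc_add.
Proof.
move=> a; have [s [n ->]] := loc_surj a.
by rewrite !loc_addE; apply/fracP; exists 0%N; rewrite ?exprD; ring.
Qed.
Fact loc_addN : left_inverse (frac 0 0) loc_opp loc_add.
Proof.
move=> a; have [s [n ->]] := loc_surj a.
by rewrite loc_oppE loc_addE; apply/fracP; exists 0%N; rewrite ?exprD; ring.
Qed.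
HB.instance Definition _ :=
  GRing.isZmodule.Build loc loc_addA loc_addC loc_add0 loc_addN.

Fact loc_mulA : associative loc_mul.
Proof.
move=> a b c; have [s [n ->]] := loc_surj a.
have [t [p ->]] := loc_surj b; have [u [q ->]] := loc_surj c.
by rewrite !loc_mulE mulrA addnA.
Qed.
Fact loc_mulC : commutative loc_mul.
Proof.
move=> a b; have [s [n ->]] := loc_surj a; have [t [p ->]] := loc_surj b.
by rewrite !loc_mulE mulrC addnC.
Qed.
Fact loc_mul1 : left_id (frac 1 0) loc_mul.
Proof. by move=> a; have [s [n ->]] := loc_surj a; rewrite loc_mulE mul1r. Qed.
Fact loc_mulDl : left_distributive loc_mul +%R.
Proof.
move=> a b c; have [s [n ->]] := loc_surj a.
have [t [p ->]] := loc_surj b; have [u [q ->]] := loc_surj c.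
rewrite -[_ + _ in LHS]/(loc_add _ _) -[RHS]/(loc_add _ _).
by rewrite !(loc_addE, loc_mulE); apply/fracP; exists 0%N; rewrite ?exprD; ring.
Qed.
HB.instance Definition _ := GRing.Zmodule_isComPzRing.Build loc
  loc_mulA loc_mulC loc_mul1 loc_mulDl.

Definition loc_scale (a : S) (z : loc) : loc := frac a 0 * z.

Lemma fracD s n t p :
  frac s n + frac t p = frac (x ^+ p * s + x ^+ n * t) (n + p).
Proof. exact: loc_addE. Qed.
Lemma fracN s n : - frac s n = frac (- s) n.
Proof. exact: loc_oppE. Qed.
Lemma fracM s n t p : frac s n * frac t p = frac (s * t) (n + p).
Proof. exact: loc_mulE. Qed.

Fact loc_scaleA a b z : loc_scale a (loc_scale b z) = loc_scale (a * b) z.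
Proof. by rewrite /loc_scale mulrA fracM. Qed.
Fact loc_scale1 : left_id 1 loc_scale.
Proof. by move=> z; rewrite /loc_scale mul1r. Qed.
Fact loc_scaleDr : right_distributive loc_scale +%R.
Proof. by move=> a y z; rewrite /loc_scale mulrDr. Qed.
Fact loc_scaleDl z : {morph loc_scale^~ z : a b / a + b}.
Proof. by move=> a b; rewrite /loc_scale -mulrDl fracD !mul1r. Qed.
HB.instance Definition _ := GRing.Zmodule_isLmodule.Build S loc
  loc_scaleA loc_scale1 loc_scaleDr loc_scaleDl.

Lemma fracZ a s n : a *: frac s n = frac (a * s) n.
Proof. exact: fracM. Qed.

End Localization.

(* For z = x * w, the canonical map S_x -> S_z, s / x^n |-> s w^n / z^n *)
Definition loc_map (S : comPzRingType) (x w z : S) (f : loc x) : loc z :=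
  frac z (w ^+ loc_exp f * loc_num f) (loc_exp f).

Lemma loc_mapE (S : comPzRingType) (x w z : S) s n : z = x * w ->
  loc_map w z (frac x s n) = frac z (w ^+ n * s) n.
Proof.
move=> ->; have /fracP[k hk] := loc_numK (frac x s n).
rewrite /loc_map; move: (loc_num _) (loc_exp _) hk => s' n' hk.
apply/fracP; exists k; rewrite !exprMn.
transitivity (w ^+ (k + n + n') * (x ^+ k * (x ^+ n * s'))); first by rewrite ?exprD; ring.
by rewrite hk ?exprD; ring.
Qed.

Lemma loc_map_lin (S : comPzRingType) (x w z : S) (a : S) f g : z = x * w ->
  loc_map w z (a *: f + g : loc x) = a *: loc_map w z f + loc_map w z g.
Proof.
move=> zE; have [s [n ->]] := loc_surj f; have [t [p ->]] := loc_surj g.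
rewrite fracZ fracD !(loc_mapE _ _ zE) fracZ fracD zE.
by apply/fracP; exists 0%N; rewrite !exprMn ?exprD; ring.
Qed.

(* The Čech complex of (x, y) on S is 0 -> S -> S_x × S_y -> S_xy -> 0, where
   the last arrow is (f, g) |-> g - f; its cohomology is H^i_(x,y)(S). *)
Section LocalCohomology.
Variables (S : comPzRingType) (x y : S).

Definition cech_d1 (f : loc x) (g : loc y) : loc (x * y) :=
  loc_map x (x * y) g - loc_map y (x * y) f.

Definition cech_B2_pred : {pred loc (x * y)} := fun h =>
  `[< exists f g, h = cech_d1 f g >].
Fact cech_B2_closed : submod_closed cech_B2_pred.
Proof.
have e1 : x * y = x * y by []; have e2 : x * y = y * x by rewrite mulrC.
split.
  apply/asboolP; exists 0, 0; rewrite /cech_d1.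
  rewrite -[0 in LHS](subrr (loc_map x (x * y) (0 : loc y))).
  rewrite -[0 : loc y]/(frac y 0 0) -[0 : loc x]/(frac x 0 0).
  by rewrite (loc_mapE _ _ e1) (loc_mapE _ _ e2) !mulr0.
move=> a _ _ /asboolP[f [g ->]] /asboolP[f' [g' ->]]; apply/asboolP.
exists (a *: f + f'), (a *: g + g').
rewrite /cech_d1 (loc_map_lin _ _ _ e1) (loc_map_lin _ _ _ e2).
by rewrite scalerBr opprD addrACA.
Qed.
HB.instance Definition _ := GRing.isSubmodClosed.Build S (loc (x * y))
  cech_B2_pred cech_B2_closed.
Definition cech_B2 : submodClosed (loc (x * y)) := cech_B2_pred.

Definition H2 : lmodType S := quot_mod cech_B2.

End LocalCohomology.

(* finitely supported functions Z^2 -> A, with convolution; <<c *g (r, s)>> is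
   c t1^r t2^s and f@_(r, s) is its coefficient. *)
Definition laurent2 (A : comNzRingType) : Type := {malg A[(int * int)%type]}.

Section Laurent.
Variable A : comNzRingType.
Implicit Types f g h : laurent2 A.

HB.instance Definition _ := GRing.Lmodule.on (laurent2 A).

Definition laur_one : laurent2 A := << 1 *g (0, 0) >>.
Definition laur_mul f g : laurent2 A :=
  \sum_(k <- msupp f) \sum_(l <- msupp g)
    << f@_k * g@_l *g (k.1 + l.1, k.2 + l.2) >>.

Local Notation "k +2 l" := (k.1 + l.1, k.2 + l.2) (at level 50).
Local Open Scope fset_scope.
Local Open Scope ring_scope.

Lemma laur_mulw (d1 d2 : {fset (int * int)%type}) f g :
  msupp f `<=` d1 -> msupp g `<=` d2 ->
  laur_mul f g = \sum_(k <- d1) \sum_(l <- d2) << f@_k * g@_l *g k +2 l >>.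
Proof.
move=> le_d1 le_d2; rewrite /laur_mul (big_fset_incl _ le_d1) /=.
  apply/eq_bigr=> k1 _; apply/big_fset_incl => // k _ /mcoeff_outdom ->.
  by rewrite mulr0 monalgU0.
move=> k _ /mcoeff_outdom g1k.
by rewrite big1 // => k' _; rewrite g1k mul0r monalgU0.
Qed.

Fact laur_mulC : commutative laur_mul.
Proof.
move=> f g; rewrite /laur_mul exchange_big /=; apply: eq_bigr => k _.
by apply: eq_bigr => l _; rewrite mulrC (addrC l.1) (addrC l.2).
Qed.

Fact laur_mulDl : left_distributive laur_mul +%R.
Proof.
move=> g1 g2 g.
rewrite [in RHS](laur_mulw (fsubsetUl _ (msupp g2)) (fsubset_refl _)).
rewrite [in RHS](laur_mulw (fsubsetUr (msupp g1) _) (fsubset_refl _)).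
rewrite (laur_mulw (msuppD_le _ _) (fsubset_refl _)).
rewrite -big_split /=; apply/eq_bigr=> k1 _.
rewrite -big_split /=; apply/eq_bigr=> k2 _.
by rewrite mcoeffD mulrDl monalgUD.
Qed.

Fact laur_mulDr : right_distributive laur_mul +%R.
Proof. by move=> f g h; rewrite !(laur_mulC f) laur_mulDl. Qed.

Fact laur_mul0 : left_zero 0 laur_mul.
Proof. by move=> g; rewrite /laur_mul msupp0 big_seq_fset0. Qed.

Fact laur_mul0r : right_zero 0 laur_mul.
Proof. by move=> g; rewrite laur_mulC laur_mul0. Qed.

Lemma laur_mulUU c d k l :
  laur_mul << c *g k >> << d *g l >> = << c * d *g k +2 l >>.
Proof. by rewrite (laur_mulw msuppU_le msuppU_le) !big_seq_fset1 !mcoeffUU. Qed.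

Lemma laur_mulE f g :
  laur_mul f g = \sum_(k <- msupp f) \sum_(l <- msupp g)
    laur_mul << f@_k *g k >> << g@_l *g l >>.
Proof.
by apply: eq_bigr => k _; apply: eq_bigr => l _; rewrite laur_mulUU.
Qed.

Fact laur_mul1 : left_id laur_one laur_mul.
Proof.
move=> g; rewrite (laur_mulw msuppU_le (fsubset_refl _)) big_seq_fset1.
rewrite [RHS]monalgE; apply: eq_bigr => k _.
by rewrite mcoeffUU mul1r !add0r -surjective_pairing.
Qed.

Fact laur_mulA : associative laur_mul.
Proof.
have suml (I : Type) (r : seq I) F g :
    laur_mul (\sum_(i <- r) F i) g = \sum_(i <- r) laur_mul (F i) g.
  exact: (big_morph (laur_mul^~ g) (fun _ _ => laur_mulDl _ _ _) (laur_mul0 _)).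
have sumr (I : Type) (r : seq I) F g :
    laur_mul g (\sum_(i <- r) F i) = \sum_(i <- r) laur_mul g (F i).
  exact: (big_morph (laur_mul g) (fun _ _ => laur_mulDr _ _ _) (laur_mul0r _)).
have mulUU := laur_mulUU.
move=> f g h; rewrite (monalgE f) (monalgE g) (monalgE h).
move: laur_mul suml sumr mulUU => mul suml sumr mulUU.
rewrite !suml; apply: eq_bigr => k _.
rewrite !(sumr _ (msupp g)) suml; apply: eq_bigr => l _.
rewrite !sumr; apply: eq_bigr => n _.
by rewrite !mulUU /= mulrA !addrA.
Qed.

Fact laur_oner_neq0 : laur_one != 0.
Proof. by apply/eqP/malgP => /(_ (0, 0)) /eqP; rewrite !mcoeffsE oner_eq0. Qed.

HB.instance Definition _ := GRing.Zmodule_isComNzRing.Build (laurent2 A)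
  laur_mulA laur_mulC laur_mul1 laur_mulDl laur_oner_neq0.

Lemma laurM f g : f * g = laur_mul f g. Proof. by []. Qed.

End Laurent.

Section ExtendedRees.
Variable A : comNzRingType.
Variables I J : ideal A.

(* I^r J^s, with I^n = J^n = A for n <= 0 *)
Definition idealXX (r s : int) : ideal A := idealM (idealXz I r) (idealXz J s).

Lemma idealXX_mulD r s r' s' a b :
  a \in idealXX r s -> b \in idealXX r' s' -> a * b \in idealXX (r + r') (s + s').
Proof.
move=> /asboolP[u hu ->] /asboolP[v hv ->].
rewrite mulr_suml big_seq; apply: rpred_sum => p /hu[p1 p2].
rewrite mulr_sumr big_seq; apply: rpred_sum => q /hv[q1 q2].
by rewrite mulrACA; apply: idealM_mem; exact: idealXz_mulD.
Qed.

Definition xrees_pred : {pred laurent2 A} := fun f =>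
  `[< forall r s, f@_(r, s) \in idealXX r s >].
Fact xrees_closed : subring_closed xrees_pred.
Proof.
split.
- apply/asboolP => r s; rewrite mcoeffU; case: eqP => [[<- <-]|_].
    by rewrite mulr1n -[1]mul1r; apply: idealM_mem.
  exact: rpred0.
- move=> f g /asboolP hf /asboolP hg; apply/asboolP => r s.
  by rewrite mcoeffB; exact: (@submodB _ A^o).
- move=> f g /asboolP hf /asboolP hg; apply/asboolP => r s.
  rewrite laurM /laur_mul raddf_sum /=; apply: rpred_sum => -[k1 k2] _.
  rewrite raddf_sum /=; apply: rpred_sum => -[l1 l2] _ /=.
  rewrite mcoeffU; case: eqP => [[<- <-]|_]; last exact: rpred0.
  by rewrite mulr1n; exact: idealXX_mulD.
Qed.
HB.instance Definition _ :=
  GRing.isSubringClosed.Build (laurent2 A) xrees_pred xrees_closed.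

(* R' = ⨁ I^r J^s t1^r t2^s *)
Record xrees :=
  XRees { xrees_val :> laurent2 A; xrees_valP : xrees_val \in xrees_pred }.
HB.instance Definition _ := [isSub for xrees_val].
HB.instance Definition _ := [Choice of xrees by <:].
HB.instance Definition _ := [SubChoice_isSubComNzRing of xrees by <:].

Fact xrees_mono_subproof r s c :
  c \in idealXX r s -> (<< c *g (r, s) >> : laurent2 A) \in xrees_pred.
Proof.
move=> hc; apply/asboolP => r' s'; rewrite mcoeffU.
by case: eqP => [[<- <-]|_]; [rewrite mulr1n | exact: rpred0].
Qed.

(* c t1^r t2^s, for c in I^r J^s *)
Definition xrees_mono r s c (hc : c \in idealXX r s) : xrees :=
  XRees (xrees_mono_subproof hc).

Fact idealXX10 a : a \in I -> a \in idealXX 1 0.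
Proof.
move=> aI; rewrite -[a]mulr1; apply: idealM_mem => //.
by rewrite -[a]mulr1; apply: idealM_mem.
Qed.
Fact idealXX01 b : b \in J -> b \in idealXX 0 1.
Proof.
move=> bJ; rewrite -[b]mul1r; apply: idealM_mem => //.
by rewrite -[b]mulr1; apply: idealM_mem.
Qed.

Definition at1 a (aI : a \in I) : xrees := xrees_mono (idealXX10 aI).
Definition bt2 b (bJ : b \in J) : xrees := xrees_mono (idealXX01 bJ).

Definition xrees_homog (r s : int) (f : xrees) :=
  forall k, k != (r, s) -> (xrees_val f)@_k = 0.

(* [H^2_(x,y)(R')]_(r,s) for x of degree (1,0) and y of degree (0,1): in the
   localization of R' at xy, f / (xy)^n has degree (r, s) when f has degree
   (r + n, s + n); H^2 carries the quotient grading. *)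
Definition H2_comp (x y : xrees) (r s : int) : set (H2 x y) :=
  [set h | exists n f, xrees_homog (r + n%:Z) (s + n%:Z) f
     /\ h = qmod_pi (cech_B2 x y) (frac (x * y) f n)].

End ExtendedRees.
Arguments at1 {A I} J {a} aI.
Arguments bt2 {A} I {J b} bJ.
Arguments H2_comp {A I J} x y r s.

Section JointReductions.
Variable A : comPzRingType.
Implicit Types (I J K L : ideal A) (a b : A).

(* M = a K + b L *)
Definition eq_pencil (M : ideal A) a K b L :=
  forall x, x \in M <-> exists u v, [/\ u \in K, v \in L & x = a * u + b * v].

Definition joint_reduction I J a b :=
  [/\ a \in I, b \in J &
      exists n0 : nat, forall r s : nat, (n0 <= r)%N -> (n0 <= s)%N ->
        eq_pencil (idealM (idealX I r.+1) (idealX J s.+1))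
                  a (idealM (idealX I r) (idealX J s.+1))
                  b (idealM (idealX I r.+1) (idealX J s))].

(* r(I|J) = 0 *)
Definition joint_reduction_number0 I J :=
  exists a b, joint_reduction I J a b /\ eq_pencil (idealM I J) a J b I.

(* ℓ(A/K) is finite and equal to z *)
Definition colength_eq K (z : int) :=
  exists2 l : nat, has_length (quot_mod K) l & l%:Z = z.

Definition hilbert_coefs K (e : nat -> int) :=
  exists n0 : nat, forall n : nat, (n0 <= n)%N ->
    colength_eq (idealX K n) (e 0 * 'C(n.+1, 2)%:Z - e 1 * n%:Z + e 2).

(* e_i(K), for i <= 2 *)
Definition hilbert_coef K : nat -> int := xget (fun=> 0) (hilbert_coefs K).

Definition bihilbert_coefs I J (e : nat -> nat -> int) :=
  exists n0 : nat, forall r s : nat, (n0 <= r)%N -> (n0 <= s)%N ->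
    colength_eq (idealM (idealX I r) (idealX J s))
      (\sum_(i < 3) \sum_(j < 3 | (i + j <= 2)%N)
         (-1) ^+ (i + j) * e i j
         * 'C(r + i - 1, i)%:Z * 'C(s + j - 1, j)%:Z).

(* e_(i,j) of the filtration {I^r J^s}, for i + j <= 2 *)
Definition bihilbert_coef I J : nat -> nat -> int :=
  xget (fun _ _ => 0) (bihilbert_coefs I J).

End JointReductions.

(* Main.v *)
(* For a regular pair (a, b) in I x J, comparing Koszul complexes gives
   l(I^r J^s / (a^r J^s + b^s I^r))
     = r s l(R/(a, b)) - l(R/I^r J^s) + l(R/I^r) + l(R/J^s).
   When (a, b) is a joint reduction, the left side grows at most linearly along
   r = s, hence e_(1,1) = l(R/(a, b)) and for n large
   l(I^n J^n / (a^n J^n + b^n I^n))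
     = (e_(1,0) - e_1(I) + e_(0,1) - e_1(J)) n + e_2(I) + e_2(J) - e_2(IJ).
   The component [H^2(R')]_(0,0) is the direct limit of these modules along
   multiplication by ab.
   (a) => (b): IJ = aJ + bI makes them all vanish, also off the diagonal, so the
   displayed identity determines the coefficients.
   (b) => (c): they vanish for n large, hence so does the limit.
   (c) => (a): since the residue field is infinite and the depths are positive,
   some joint reduction has (I^(n+1) : a) = I^n and (J^(n+1) : b) = J^n; then
   IJ/(aJ + bI) embeds into the limit. *)

From HB Require Import structures.
Require Import Defs.
From mathcomp Require Import all_boot all_order all_algebra.
From mathcomp Require Import finmap ring_quotient boolp classical_sets cardinality.
From mathcomp Require Import monalg ring lra zify.

Set Implicit Arguments.
Unset Strict Implicit.
Unset Printing Implicit Defensive.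

Import Order.TTheory GRing.Theory Num.Theory.

Local Open Scope ring_scope.

(** * Ideals *)

(** Every bigraded module that occurs is a subquotient of the Rees algebra. It is carried as two
    families of ideals of [R], lengths are maximal lengths of chains of ideals in an interval, and
    exact sequences reduce to the isomorphism of [L/((M : x) ∩ L)] with [(xL + M)/M]. The chain
    condition for such families is pulled back from an iterated polynomial ring that maps onto the
    Rees algebra. Hilbert functions become quadratic in two moves: Hilbert-Serre makes some iterated
    difference vanish, and comparison with [(x^n, y^n)], of colength [n^2 l(R/(x, y))], lowers the
    degree to two. The threshold in [r] must be uniform in [s], and conversely, or the polynomials
    in one variable would not assemble into one in two variables; this shapes the statements on
    finite generation and on differences. In (c) => (a), one pair must be a joint reduction and
    satisfy both colon conditions. Each requirement is therefore phrased as avoiding finitely many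
    ideals that do not contain [I] (or [J]), so that requirements can be combined before an element
    is chosen. *)

Section IdealOperations.
Variable A : comPzRingType.
Implicit Types (I J K L : ideal A) (a x y : A).

(** Function extensionality identifies the predicates, proof irrelevance the closure proofs. With
    Leibniz equality the calculus of ideals below works by rewriting. *)
Lemma ideal_ext I J : I =i J -> I = J.
Proof.
case: I J => [I cI] [J cJ] h.
have E : I = J by apply/funext => x; exact: h.
rewrite {h}; case: J / E cJ => cJ.
congr (GRing.SubmodClosed.Pack _).
case: cI cJ => -[h1] [h2] [[h3] [h4]].
by rewrite (Prop_irrelevance h1 h3) (Prop_irrelevance h2 h4).
Qed.

Lemma ideal_anti I J : {subset I <= J} -> {subset J <= I} -> I = J.
Proof. by move=> h k; apply: ideal_ext => x; apply/idP/idP => [/h|/k]. Qed.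

Lemma ideal0 I : 0 \in I. Proof. exact: rpred0. Qed.
Lemma idealDm I x y : x \in I -> y \in I -> x + y \in I.
Proof. exact: (@rpredD _ I). Qed.
Lemma idealNm I x : x \in I -> - x \in I.
Proof. by rewrite -mulN1r; exact: ideal_mull. Qed.
Lemma idealBm I x y : x \in I -> y \in I -> x - y \in I.
Proof. by move=> ? /idealNm; exact: idealDm. Qed.
Lemma ideal_mulr I x a : x \in I -> x * a \in I.
Proof. by rewrite mulrC; exact: ideal_mull. Qed.
Lemma ideal_sum I (T : Type) (r : seq T) (P : pred T) (F : T -> A) :
  (forall i, P i -> F i \in I) -> \sum_(i <- r | P i) F i \in I.
Proof. exact: (@rpred_sum _ I). Qed.

Definition ideal_axiom (P : A -> Prop) :=
  [/\ P 0, forall x y, P x -> P y -> P (x + y) & forall a x, P x -> P (a * x)].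

(** The closure proof is carried as an argument so that the canonical instance can be inferred from
    the predicate alone. *)
Definition mkid_pred P of ideal_axiom P : {pred A^o} := fun x => `[< P x >].
Fact mkid_closed P (h : ideal_axiom P) : submod_closed (mkid_pred h).
Proof.
case: (h) => h0 hD hM; split; first exact/asboolP.
move=> a x y /asboolP Px /asboolP Py; apply/asboolP.
by apply: hD => //; exact: hM.
Qed.
HB.instance Definition _ P (h : ideal_axiom P) :=
  GRing.isSubmodClosed.Build A A^o (mkid_pred h) (mkid_closed h).
Definition mkid P (h : ideal_axiom P) : ideal A := mkid_pred h.

Lemma mkidP P (h : ideal_axiom P) x : x \in mkid h <-> P x.
Proof. by split=> [/asboolP|?]; last exact/asboolP. Qed.

Fact idealD_axiom I J :
  ideal_axiom (fun x => exists u v, [/\ u \in I, v \in J & x = u + v]).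
Proof.
split=> [|_ _ [u [v [? ? ->]]] [u' [v' [? ? ->]]]|a _ [u [v [? ? ->]]]].
- by exists 0, 0; rewrite addr0; split=> //; exact: ideal0.
- by exists (u + u'), (v + v'); rewrite addrACA; split=> //; exact: idealDm.
- by exists (a * u), (a * v); rewrite mulrDr; split=> //; exact: ideal_mull.
Qed.
Definition idealD I J := mkid (idealD_axiom I J).

Lemma idealDP I J x :
  x \in idealD I J <-> exists u v, [/\ u \in I, v \in J & x = u + v].
Proof. exact: mkidP. Qed.

Fact idealI_axiom I J : ideal_axiom (fun x => x \in I /\ x \in J).
Proof.
split=> [|x y [? ?] [? ?]|a x [? ?]]; split;
  by [exact: ideal0 | exact: idealDm | exact: ideal_mull].
Qed.
Definition idealI I J := mkid (idealI_axiom I J).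

Lemma idealIP I J x : x \in idealI I J <-> x \in I /\ x \in J.
Proof. exact: mkidP. Qed.

Fact colon_axiom K a : ideal_axiom (fun x => a * x \in K).
Proof.
split=> [|x y|b x]; first by rewrite mulr0 ideal0.
  by rewrite mulrDr; exact: idealDm.
by rewrite mulrCA; exact: ideal_mull.
Qed.
Definition colon K a := mkid (colon_axiom K a).

Lemma colonP K a x : x \in colon K a <-> a * x \in K.
Proof. exact: mkidP. Qed.

Fact scale_axiom a K : ideal_axiom (fun x => exists2 u, u \in K & x = a * u).
Proof.
split=> [|_ _ [u ? ->] [v ? ->]|b _ [u ? ->]].
- by exists 0; rewrite ?mulr0 ?ideal0.
- by exists (u + v); rewrite ?mulrDr //; exact: idealDm.
- by exists (b * u); [exact: ideal_mull | rewrite mulrCA].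
Qed.
Definition scale a K := mkid (scale_axiom a K).

Lemma scaleP a K x : x \in scale a K <-> exists2 u, u \in K & x = a * u.
Proof. exact: mkidP. Qed.

Lemma mem_scale a K x : x \in K -> a * x \in scale a K.
Proof. by move=> ?; apply/scaleP; exists x. Qed.

Lemma scaleS a K L : {subset K <= L} -> {subset scale a K <= scale a L}.
Proof. by move=> h _ /scaleP[u /h ? ->]; exact: mem_scale. Qed.

Lemma idealD_l I J : {subset I <= idealD I J}.
Proof. by move=> x ?; apply/idealDP; exists x, 0; rewrite addr0 ideal0. Qed.
Lemma idealD_r I J : {subset J <= idealD I J}.
Proof. by move=> x ?; apply/idealDP; exists 0, x; rewrite add0r ideal0. Qed.
Lemma idealD_min I J K :
  {subset I <= K} -> {subset J <= K} -> {subset idealD I J <= K}.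
Proof.
by move=> h k _ /idealDP[u [v [/h ? /k ? ->]]]; exact: idealDm.
Qed.
Lemma idealD_mem I J x y : x \in I -> y \in J -> x + y \in idealD I J.
Proof. by move=> ? ?; apply/idealDP; exists x, y. Qed.
Lemma idealDS I I' J J' : {subset I <= I'} -> {subset J <= J'} ->
  {subset idealD I J <= idealD I' J'}.
Proof.
move=> h k; apply: idealD_min => x xI; [apply: idealD_l | apply: idealD_r].
  exact: h.
exact: k.
Qed.

Lemma mem_idealT x : x \in (idealT : ideal A). Proof. by []. Qed.
Lemma ideal1_all I : 1 \in I -> I = idealT.
Proof.
move=> h; apply: ideal_anti => // x _.
by rewrite -[x]mulr1; exact: ideal_mull.
Qed.

Lemma idealMC I J : idealM I J = idealM J I.
Proof.
by apply: ideal_anti; apply: idealM_sub => x y ? ?; rewrite mulrC; exact: idealM_mem.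
Qed.
Lemma idealM_l I J : {subset idealM I J <= I}.
Proof. by apply: idealM_sub => x y ? _; exact: ideal_mulr. Qed.
Lemma idealM_r I J : {subset idealM I J <= J}.
Proof. by apply: idealM_sub => x y _ ?; exact: ideal_mull. Qed.
Lemma idealMS I I' J J' : {subset I <= I'} -> {subset J <= J'} ->
  {subset idealM I J <= idealM I' J'}.
Proof.
by move=> h k; apply: idealM_sub => x y /h ? /k ?; exact: idealM_mem.
Qed.
Lemma idealMA I J K : idealM I (idealM J K) = idealM (idealM I J) K.
Proof.
apply: ideal_anti.
  apply: idealM_sub => x z xI zJK; suff : z \in colon (idealM (idealM I J) K) x
    by move/colonP.
  move: z zJK; apply: idealM_sub => y z yJ zK; apply/colonP.
  by rewrite mulrA; do 2?apply: idealM_mem.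
apply: idealM_sub => z x zIJ xK; suff : z \in colon (idealM I (idealM J K)) x
  by move/colonP; rewrite mulrC.
move: z zIJ; apply: idealM_sub => y z yI zJ; apply/colonP.
by rewrite mulrC -mulrA; do 2?apply: idealM_mem.
Qed.
Lemma idealMCA I J K : idealM I (idealM J K) = idealM J (idealM I K).
Proof. by rewrite idealMA (idealMC I) -idealMA. Qed.
Lemma idealMACA I J K L :
  idealM (idealM I J) (idealM K L) = idealM (idealM I K) (idealM J L).
Proof. by rewrite -!idealMA (idealMCA J). Qed.
Lemma idealM1 I : idealM idealT I = I.
Proof.
apply: ideal_anti; first exact: idealM_r.
by move=> x xI; rewrite -[x]mul1r; exact: idealM_mem.
Qed.
Lemma idealMT I : idealM I idealT = I. Proof. by rewrite idealMC idealM1. Qed.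

Lemma idealXS I n : idealX I n.+1 = idealM I (idealX I n). Proof. by []. Qed.
Lemma idealX1 I : idealX I 1 = I. Proof. by rewrite /= idealMT. Qed.
Lemma idealXD I n p : idealX I (n + p) = idealM (idealX I n) (idealX I p).
Proof. by elim: n => [|n IH]; rewrite ?idealM1 //= IH idealMA. Qed.
Lemma idealXMn I J n : idealX (idealM I J) n = idealM (idealX I n) (idealX J n).
Proof. by elim: n => [|n IH]; rewrite /= ?idealM1 // IH idealMACA. Qed.
Lemma idealX_mul I n p : idealX (idealX I n) p = idealX I (n * p).
Proof. by elim: p => [|p IH]; rewrite ?muln0 // mulnS idealXD -IH. Qed.
Lemma idealXSub I J n : {subset I <= J} -> {subset idealX I n <= idealX J n}.
Proof. by move=> h; elim: n => [//|n IH] /=; exact: idealMS. Qed.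
Lemma idealXT n : idealX (idealT : ideal A) n = idealT.
Proof. by elim: n => //= n ->; rewrite idealMT. Qed.
Lemma mem_idealX I n x : x \in I -> x ^+ n \in idealX I n.
Proof. by move=> h; elim: n => // n IH; rewrite exprS; exact: idealM_mem. Qed.

Lemma idealMD I J K : idealM I (idealD J K) = idealD (idealM I J) (idealM I K).
Proof.
apply: ideal_anti.
  apply: idealM_sub => x _ xI /idealDP[u [v [? ? ->]]].
  by rewrite mulrDr; apply: idealD_mem; exact: idealM_mem.
apply: idealD_min; apply: idealMS => //; [exact: idealD_l|exact: idealD_r].
Qed.
Lemma idealM_scale a I J : idealM I (scale a J) = scale a (idealM I J).
Proof.
apply: ideal_anti.
  apply: idealM_sub => x _ xI /scaleP[u ? ->].
  by rewrite mulrCA; apply: mem_scale; exact: idealM_mem.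
move=> _ /scaleP[x hx ->]; suff : x \in colon (idealM I (scale a J)) a
  by move/colonP.
move: x hx; apply: idealM_sub => x y xI yJ; apply/colonP.
by rewrite mulrCA; apply: idealM_mem => //; exact: mem_scale.
Qed.

Lemma idgenP (s : seq A) x :
  x \in idgen s <-> exists c : nat -> A, x = \sum_(i < size s) c i * s`_i.
Proof. by split=> /asboolP. Qed.

Lemma idgen0P x : x \in idgen (A:=A) [::] <-> x = 0.
Proof.
rewrite idgenP; split=> [[c ->]|->]; first by rewrite big_ord0.
by exists (fun=> 0); rewrite big_ord0.
Qed.

Lemma idgen_consP a (s : seq A) x :
  x \in idgen (a :: s) <-> exists c y, y \in idgen s /\ x = c * a + y.
Proof.
rewrite idgenP; split=> [[c ->]|[c [y [/idgenP[d ->] ->]]]].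
  rewrite big_ord_recl /=; exists (c 0), (\sum_(i < size s) c i.+1 * s`_i).
  by split=> //; apply/idgenP; exists (fun i => c i.+1).
by exists (fun i => if i is j.+1 then d j else c); rewrite big_ord_recl.
Qed.

Lemma mem_idgen (s : seq A) x : x \in s -> x \in idgen s.
Proof.
elim: s => // a s IH; rewrite inE => /orP[/eqP->|/IH h]; apply/idgen_consP.
  by exists 1, 0; rewrite ideal0 mul1r addr0.
by exists 0, x; rewrite mul0r add0r.
Qed.

Lemma idgen_sub (s : seq A) K :
  (forall x, x \in s -> x \in K) -> {subset idgen s <= K}.
Proof.
elim: s => [_ x /idgen0P ->|a s IH h x]; first exact: ideal0.
move=> /idgen_consP[c [y [hy ->]]]; apply: idealDm.
  by apply/ideal_mull/h; rewrite inE eqxx.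
by apply: IH hy => z zs; apply: h; rewrite inE zs orbT.
Qed.

Lemma idgen1P a x : x \in idgen [:: a] <-> exists c, x = a * c.
Proof.
rewrite idgen_consP; split=> [[c [y [/idgen0P -> ->]]]|[c ->]].
  by exists c; rewrite addr0 mulrC.
by exists c, 0; rewrite addr0 mulrC; split=> //; exact: ideal0.
Qed.

Lemma idgen_cons a (s : seq A) : idgen (a :: s) = idealD (scale a idealT) (idgen s).
Proof.
apply: ideal_ext => x; apply/idP/idP.
  move=> /idgen_consP[c [y [hy ->]]]; apply: idealD_mem => //.
  by apply/scaleP; exists c; rewrite // mulrC.
move=> /idealDP[_ [v [/scaleP[u _ ->] hv ->]]].
by apply/idgen_consP; exists u, v; rewrite mulrC.
Qed.

Lemma scaleM a b K : scale (a * b) K = scale a (scale b K).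
Proof.
apply: ideal_anti => _ /scaleP[u hu ->].
  by rewrite -mulrA; do 2?apply: mem_scale.
by move: hu => /scaleP[v hv ->]; rewrite mulrA; exact: mem_scale.
Qed.

Lemma idealX_scale a n : idealX (scale a idealT) n = scale (a ^+ n) idealT.
Proof.
elim: n => [|n IH] /=.
  by apply: ideal_anti => // x _; apply/scaleP; exists x; rewrite ?mul1r.
by rewrite IH idealM_scale idealMC idealM_scale idealM1 -scaleM -exprSr.
Qed.

(** Pigeonhole: among [n + p] factors, at least [n] come from [I] or at least [p] from [J]. The
    double induction splits off one factor at a time. *)
Lemma idealX_idealD I J n p :
  {subset idealX (idealD I J) (n + p) <= idealD (idealX I n) (idealX J p)}.
Proof.
elim: n p => [p x _|n IHn p]; first exact: idealD_l.
elim: p => [x _|p IHp]; first exact: idealD_r.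
rewrite addSn idealXS idealMC idealMD; apply: idealD_min => x; rewrite idealMC.
  move=> /(idealMS (fun _ h => h) (IHn _)); rewrite idealMD; move: x.
  by apply: idealDS => //; exact: idealM_r.
rewrite addnS -addSn => /(idealMS (fun _ h => h) IHp); rewrite idealMD; move: x.
by apply: idealDS => //; exact: idealM_r.
Qed.

Lemma idgen_power_sub (s : seq A) K :
  (forall x, x \in s -> exists n, x ^+ n \in K) ->
  exists n, {subset idealX (idgen s) n <= K}.
Proof.
elim: s => [_|a s IH h].
  by exists 1%N => x; rewrite idealX1 => /idgen0P ->; exact: ideal0.
have [n hn] := IH (fun x xs => h x (@mem_behead _ (a :: s) _ xs)).
have [p hp] := h a (mem_head _ _).
exists (p + n)%N => x; rewrite idgen_cons => /idealX_idealD.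
move: x; apply: idealD_min => //.
by rewrite idealX_scale => _ /scaleP[u _ ->]; exact: ideal_mulr.
Qed.

Lemma idealX_leq I n p : (p <= n)%N -> {subset idealX I n <= idealX I p}.
Proof. by move=> le x; exact: idealX_le. Qed.

End IdealOperations.

Section Noetherian.
Variable A : comPzRingType.
Hypothesis noeth : noetherian_ring A.
Implicit Types (I J K L : ideal A) (a x y : A).

Lemma noeth_fg I : exists s : seq A, I = idgen s.
Proof. by have [s hs] := noeth I; exists s; exact: ideal_ext. Qed.

Fact chain_axiom (K : nat -> ideal A) :
  (forall n, {subset K n <= K n.+1}) ->
  ideal_axiom (fun x => exists n, x \in K n).
Proof.
move=> hK; have le n p : (n <= p)%N -> {subset K n <= K p}.
  move=> /subnK <-; elim: (p - n)%N => [//|k IH] x /IH; exact: hK.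
split=> [|x y [n hn] [p hp]|a x [n hn]]; first by exists 0%N; exact: ideal0.
  exists (maxn n p); apply: idealDm.
    exact: (le _ _ (leq_maxl _ _) _ hn).
  exact: (le _ _ (leq_maxr _ _) _ hp).
by exists n; exact: ideal_mull.
Qed.

Lemma noeth_acc (K : nat -> ideal A) : (forall n, {subset K n <= K n.+1}) ->
  exists n, {subset K n.+1 <= K n}.
Proof.
move=> hK; have le n p : (n <= p)%N -> {subset K n <= K p}.
  move=> /subnK <-; elim: (p - n)%N => [//|k IH] x /IH; exact: hK.
have [s hs] := noeth_fg (mkid (chain_axiom hK)).
have [n hn] : exists n, forall x, x \in s -> x \in K n.
  have : forall x, x \in s -> exists n, x \in K n.
    by move=> x /mem_idgen; rewrite -hs => /mkidP.
  elim: s {hs} => [_|a s IH h]; first by exists 0%N.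
  have [n hn] := IH (fun x xs => h x (@mem_behead _ (a :: s) _ xs)).
  have [p hp] := h a (mem_head _ _).
  exists (maxn n p) => x; rewrite inE => /orP[/eqP->|/hn hx].
    exact: (le _ _ (leq_maxr _ _) _ hp).
  exact: (le _ _ (leq_maxl _ _) _ hx).
exists n => x hx; apply: (idgen_sub hn); rewrite -hs; apply/(mkidP (chain_axiom hK)).
by exists n.+1.
Qed.

(** Without a maximal element, dependent choice would enlarge strictly forever, against
    [noeth_acc]. *)
Lemma noeth_max (P : ideal A -> Prop) : (exists K, P K) ->
  exists2 K, P K & forall K', P K' -> {subset K <= K'} -> {subset K' <= K}.
Proof.
move=> [K0 PK0]; apply: contrapT => hno.
have step (c : {K | P K}) :
    {d : {K | P K} | {subset sval c <= sval d} /\ ~ {subset sval d <= sval c}}.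
  apply: cid; case: c => K PK /=; apply: contrapT => hn; apply: hno.
  exists K => // K' PK' sKK'; apply: contrapT => hK'; apply: hn.
  by exists (exist _ K' PK').
pose c := nat_rect (fun=> {K | P K}) (exist _ K0 PK0) (fun _ c => sval (step c)).
have [|n] := @noeth_acc (fun n => sval (c n)).
  by move=> n; case: (svalP (step (c n))).
by case: (svalP (step (c n))).
Qed.

End Noetherian.

(** * Local rings and Nakayama's lemma *)

Section Local.
Variables (A : comPzRingType) (m : ideal A).
Hypotheses (noeth : noetherian_ring A) (loc : local_ring m).
Implicit Types (I J K L : ideal A) (a x y : A).

Lemma one_notin_m : 1 \notin m. Proof. by case: loc => -[]. Qed.

Lemma proper_sub_m K : 1 \notin K -> {subset K <= m}.
Proof.
move=> hK; case: (noeth_max noeth (P := fun L => 1 \notin L /\ {subset K <= L})).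
  by exists K; split.
move=> L [L1 KL] hL; have : maximal_ideal L.
  split=> // J J1 LJ; apply: hL => //; split=> // x /KL; exact: LJ.
by case: loc => _ h /h e x /KL; rewrite e.
Qed.

Lemma unit_notin_m x : x \notin m -> exists y, x * y = 1.
Proof.
move=> xm; apply: contrapT => h.
suff : {subset idgen [:: x] <= m} by move/(_ x (mem_idgen (mem_head _ _))); rewrite (negPf xm).
by apply: proper_sub_m; apply/negP => /idgen1P[y e]; apply: h; exists y.
Qed.

Lemma unit_1B x : x \in m -> exists y, (1 - x) * y = 1.
Proof.
move=> xm; apply: unit_notin_m; apply/negP => h.
have := idealDm h xm; rewrite subrK; apply/negP; exact: one_notin_m.
Qed.

Lemma m_prime x y : x * y \in m -> x \in m \/ y \in m.
Proof.
move=> h; case: (boolP (x \in m)) => [|/unit_notin_m[z xz]]; [by left|right].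
by rewrite -[y]mul1r -xz mulrAC; exact: ideal_mulr.
Qed.

Lemma max_between K : {subset m <= K} -> K = m \/ K = idealT.
Proof.
move=> h; case: (boolP (1 \in K)) => [/ideal1_all|/proper_sub_m]; [by right|left].
exact: ideal_anti.
Qed.

(** Induction on generators of [K]. The first one satisfies [a = c a + y + l] with [c] in [m] and
    [y] in [m] times the other generators, so [a = (1 - c)^-1 (y + l)]; substituting this passes the
    hypothesis on to the ideal of the other generators. *)
Lemma nakayama K L : {subset K <= idealD (idealM m K) L} -> {subset K <= L}.
Proof.
have [s ->] := noeth_fg noeth K.
elim: s => [_ x /idgen0P ->|a s IH h]; first exact: ideal0.
have : a \in idealD (idealM m (idgen (a :: s))) L by exact/h/mem_idgen/mem_head.
have mE x : x \in idealM m (idgen (a :: s)) ->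
    exists2 c, c \in m & exists2 y, y \in idealM m (idgen s) & x = c * a + y.
  suff k : ideal_axiom (fun x => exists2 c, c \in m &
      exists2 y, y \in idealM m (idgen s) & x = c * a + y).
    move=> hx; apply/(mkidP k); move: x hx; apply: idealM_sub => u v um.
    move=> /idgen_consP[c [y [hy ->]]]; apply/(mkidP k).
    exists (u * c); first exact: ideal_mulr.
    by exists (u * y); [exact: idealM_mem | rewrite mulrDr mulrA].
  split=> [|_ _ [c cm [y ym ->]] [d dm [z zm ->]]|b _ [c cm [y ym ->]]].
  - by exists 0; [exact: ideal0|exists 0; [exact: ideal0 | rewrite mul0r addr0]].
  - exists (c + d); first exact: idealDm.
    by exists (y + z); [exact: idealDm | rewrite mulrDl addrACA].
  - exists (b * c); first exact: ideal_mull.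
    by exists (b * y); [exact: ideal_mull | rewrite mulrDr mulrA].
move=> /idealDP[_ [l [/mE[c cm [y ym ->]] lL e]]].
have [d hd] := unit_1B cm.
have ae : a = d * (y + l).
  have e' : (1 - c) * a = y + l by rewrite mulrBl mul1r {1}e; ring.
  by rewrite -e' mulrA (mulrC d) hd mul1r.
have sL : {subset idgen s <= L}.
  apply: IH => x xs; have : x \in idealD (idealM m (idgen (a :: s))) L.
    by apply: h; apply/idgen_consP; exists 0, x; rewrite mul0r add0r.
  move=> /idealDP[_ [l' [/mE[c' cm' [y' ym' ->]] lL' ->]]].
  rewrite ae; have -> : c' * (d * (y + l)) + y' + l' =
    (c' * d * y + y') + (c' * d * l + l') by ring.
  apply: idealD_mem; apply: idealDm => //; exact: ideal_mull.
apply: idgen_sub => x; rewrite inE => /orP[/eqP->|/mem_idgen/sL//].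
rewrite ae; apply: ideal_mull; apply: idealDm => //; apply: sL.
exact: (idealM_r ym).
Qed.

Lemma nakayama0 K : {subset K <= idealM m K} -> forall x, x \in K -> x = 0.
Proof.
move=> h x xK; apply/idgen0P; move: x xK; apply: nakayama => x /h.
exact: idealD_l.
Qed.

End Local.

(** * Lengths of intervals of ideals *)

Section Length.
Variable A : comPzRingType.
Implicit Types (I J K L M N : ideal A) (a x y : A).

Definition chain_between K L n := exists2 N : nat -> ideal A,
  strict_chain N n & {subset K <= N 0} /\ {subset N n <= L}.

(** Vacuously true unless [K] lies in [L] ([chain_between_sub]), so finiteness above [K] can be
    stated for an arbitrary upper ideal. *)
Definition finlen K L := exists l, forall n, chain_between K L n -> (n <= l)%N.

Definition len K L : nat :=
  xget 0%N [set l | chain_between K L l /\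
                    forall n, chain_between K L n -> (n <= l)%N].

Lemma strict_chain_le (N : nat -> ideal A) n i j :
  strict_chain N n -> (i <= j <= n)%N -> {subset N i <= N j}.
Proof.
move=> hN /andP[/subnK <-]; elim: (j - i)%N => [|k IH] lk x hx //.
have [h _] := hN _ lk; apply: h; apply: IH => //; exact: ltnW.
Qed.

Lemma chain_between0 K L : {subset K <= L} -> chain_between K L 0.
Proof. by move=> h; exists (fun=> K) => [i //|]; split. Qed.

Lemma chain_between_sub K L n : chain_between K L n -> {subset K <= L}.
Proof.
move=> [N hN [h0 h1]] x /h0 hx; apply: h1.
by apply: strict_chain_le hN _ _ hx; rewrite /= leqnn.
Qed.

Lemma chain_betweenS K K' L L' n : {subset K' <= K} -> {subset L <= L'} ->
  chain_between K L n -> chain_between K' L' n.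
Proof.
move=> hK hL [N hN [h0 h1]]; exists N => //.
by split=> x => [/hK/h0|/h1/hL].
Qed.

Lemma lenP K L : {subset K <= L} -> finlen K L ->
  chain_between K L (len K L) /\
  forall n, chain_between K L n -> (n <= len K L)%N.
Proof.
move=> h [l hl]; rewrite /len; case: xgetP => [n _ //|hno]; exfalso.
have hex : exists n, `[< chain_between K L n >].
  by exists 0%N; apply/asboolP; exact: chain_between0.
have hub n : `[< chain_between K L n >] -> (n <= l)%N by move/asboolP; exact: hl.
case: (ex_maxnP hex hub) => i /asboolP hi hmax; apply: (hno i); split=> // n hn.
by apply: hmax; apply/asboolP.
Qed.

Lemma len_unique K L l : chain_between K L l ->
  (forall n, chain_between K L n -> (n <= l)%N) -> len K L = l.
Proof.
move=> hl h; have hs := chain_between_sub hl.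
have [h1 h2] := lenP hs (ex_intro _ l h).
by apply/eqP; rewrite eqn_leq (h _ h1) (h2 _ hl).
Qed.

Lemma finlenS K K' L L' : {subset K <= K'} -> {subset L' <= L} ->
  finlen K L -> finlen K' L'.
Proof. by move=> hK hL [l hl]; exists l => n /(chain_betweenS hK hL)/hl. Qed.

Lemma lenS K K' L L' : {subset K <= K'} -> {subset L' <= L} ->
  {subset K' <= L'} -> finlen K L -> (len K' L' <= len K L)%N.
Proof.
move=> hK hL hKL' hf; have [h _] := lenP hKL' (finlenS hK hL hf).
have hKL : {subset K <= L} by move=> x /hK/hKL'/hL.
by have [_] := lenP hKL hf; apply; exact: chain_betweenS h.
Qed.

Lemma lenn K : finlen K K /\ len K K = 0%N.
Proof.
have h n : chain_between K K n -> (n <= 0)%N.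
  case: n => // n [N hN [h0 h1]]; have [hs []] := hN _ (ltnSn n).
  move=> x /h1/h0 hx; apply: strict_chain_le hN _ _ hx.
  by rewrite /= leqnSn.
by split; [exists 0%N | apply: len_unique => //; exact: chain_between0].
Qed.

Lemma len_eq0 K L : {subset K <= L} -> finlen K L -> len K L = 0%N ->
  {subset L <= K}.
Proof.
move=> hs hf h0; apply: contrapT => hn; have [_ h] := lenP hs hf.
suff : chain_between K L 1 by move/h; rewrite h0.
by exists (fun i => if i is 0 then K else L) => [[|i] //|]; split.
Qed.

Lemma chain_between_cat K L M n p : chain_between K L n ->
  chain_between L M p -> chain_between K M (n + p).
Proof.
move=> [N hN [h0 h1]] [N' hN' [h0' h1']].
case: (posnP p) => [p0|pp].
  rewrite {}p0 in hN' h1' *; rewrite addn0; exists N => //.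
  by split=> // x /h1/h0'/h1'.
exists (fun i => if (i < n)%N then N i else
                 if i == n then N n else N' (i - n)%N) => [i lt|]; last first.
  split=> [x /h0|x]; first by case: (posnP n) => [->|].
  by rewrite ltnNge leq_addr /= addKn -{2}[n]addn0 eqn_add2l gtn_eqF // => /h1'.
case: (ltngtP i n) => [lin|lni|ein] /=.
- rewrite ltn_neqAle lin andbT; case: eqP => [<-|_] /=; exact: hN.
- rewrite ltnNge (ltnW (leqW lni)) /= gtn_eqF ?(leqW lni) // subSn ?(ltnW lni) //.
  by apply: hN'; lia.
- rewrite {}ein in lt *; rewrite ltnNge leqnSn /= gtn_eqF // subSnn.
  have [h2 h3] := hN' _ pp; split=> [x /h1/h0'/h2//|h4]; apply: h3 => x /h4.
  by move=> /h1/h0'.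
Qed.

(** Schreier's argument: intersect the chain with [L] and add [L] to it. By the modular law the two
    derived chains cannot both stand still where the given one is strict, so each step is charged to
    one of them. *)
Lemma chain_between_split K L M n : chain_between K M n ->
  {subset K <= L} -> {subset L <= M} ->
  exists p q, [/\ chain_between K L p, chain_between L M q & (n <= p + q)%N].
Proof.
move=> [N hN [h0 h1]] hKL hLM.
suff H j : (j <= n)%N -> exists p q, [/\ chain_between K (idealI (N j) L) p,
    chain_between L (idealD (N j) L) q & (j <= p + q)%N].
  have [p [q [hp hq le]]] := H n (leqnn n); exists p, q; split=> //.
    by apply: chain_betweenS hp => // x /idealIP[].
  apply: chain_betweenS hq => //; exact: idealD_min.
elim: j => [_|j IH lj].
  exists 0%N, 0%N; split=> //; apply: chain_between0; last exact: idealD_r.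
  by move=> x xK; apply/idealIP; split; [exact: h0 | exact: hKL].
have [p [q [hp hq le]]] := IH (ltnW lj); have [sN nN] := hN _ lj.
have sI : {subset idealI (N j) L <= idealI (N j.+1) L}.
  by move=> x /idealIP[/sN ? ?]; apply/idealIP.
have sD : {subset idealD (N j) L <= idealD (N j.+1) L} by exact: idealDS.
case: (pselect {subset idealI (N j.+1) L <= idealI (N j) L}) => hI; last first.
  exists p.+1, q; split; [|exact: chain_betweenS hq|by []].
  rewrite -(addn1 p); apply: (chain_between_cat hp).
  by exists (fun i => if i is 0 then idealI (N j) L else idealI (N j.+1) L) => [[|i] //|]; split.
case: (pselect {subset idealD (N j.+1) L <= idealD (N j) L}) => hD; last first.
  exists p, q.+1; split; [exact: chain_betweenS hp| |by rewrite addnS].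
  rewrite -(addn1 q); apply: (chain_between_cat hq).
  by exists (fun i => if i is 0 then idealD (N j) L else idealD (N j.+1) L) => [[|i] //|]; split.
case: nN => x xN; have /hD/idealDP[u [v [uN vL e]]] := idealD_l L xN.
have /hI/idealIP[vN _] : v \in idealI (N j.+1) L.
  apply/idealIP; split=> //; have -> : v = x - u by rewrite e addrC addKr.
  by apply: idealBm => //; exact: sN.
by rewrite e; exact: idealDm.
Qed.

Lemma lenD K L M : {subset K <= L} -> {subset L <= M} ->
  finlen K L -> finlen L M ->
  finlen K M /\ len K M = (len K L + len L M)%N.
Proof.
move=> hKL hLM f1 f2; have [c1 m1] := lenP hKL f1; have [c2 m2] := lenP hLM f2.
have h n : chain_between K M n -> (n <= len K L + len L M)%N.
  move=> /chain_between_split/(_ hKL hLM)[p [q [/m1 ? /m2 ? le]]].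
  by apply: leq_trans le _; exact: leq_add.
by split; [eexists; exact: h | apply: len_unique => //; exact: (chain_between_cat c1 c2)].
Qed.

(** Strictness survives [f] because [g] undoes [f] on the interval: an inclusion of [f (N i.+1)] in
    [f (N i)] would return through [g]. *)
Lemma chain_between_map (f g : ideal A -> ideal A) K L K' L' n :
  {homo f : M N / {subset M <= N}} -> {homo g : M N / {subset M <= N}} ->
  (forall M, {subset K <= M} -> {subset M <= L} ->
     [/\ {subset K' <= f M}, {subset f M <= L'} & {subset M <= g (f M)} /\ {subset g (f M) <= M}]) ->
  chain_between K L n -> chain_between K' L' n.
Proof.
move=> hf hg hfg [N hN [h0 h1]].
have hi i : (i <= n)%N -> {subset K <= N i} /\ {subset N i <= L}.
  move=> le; split=> x hx.
    by apply: strict_chain_le hN _ _ (h0 _ hx); rewrite /= le.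
  by apply: h1; apply: strict_chain_le hN _ _ hx; rewrite le leqnn.
exists (f \o N) => [i lin /=|].
  have [s1 s2] := hN _ lin; split; first exact: hf.
  move=> h; apply: s2 => x.
  have [a1 b1] := hi _ lin; have [a2 b2] := hi _ (ltnW lin).
  have [_ _ [c _]] := hfg _ a1 b1; have [_ _ [_ d]] := hfg _ a2 b2.
  by move=> /c/(hg _ _ h)/d.
have [a1 b1] := hi _ (leq0n n); have [a2 b2] := hi _ (leqnn n).
by have [? _ _] := hfg _ a1 b1; have [_ ? _] := hfg _ a2 b2.
Qed.

(* Multiplication by [x] maps [L] onto [(xL + M)/M], with kernel [(M : x)]. *)
Lemma len_image L M x :
  let K := idealI (colon M x) L in let L' := idealD (scale x L) M in
  (finlen K L <-> finlen M L') /\ len K L = len M L'.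
Proof.
move=> K L'.
suff h n : chain_between K L n <-> chain_between M L' n.
  split; first by split=> -[l hl]; exists l => n /h/hl.
  by rewrite /len; congr xget; apply/funext => l; apply/propext; split=> -[/h ? hn];
    split=> // n /h; exact: hn.
split.
  apply: (@chain_between_map (fun N => idealD (scale x N) M) (fun N => idealI (colon N x) L)).
  - by move=> N N' hN; apply: idealDS => //; exact: scaleS.
  - by move=> N N' hN u /idealIP[/colonP /hN ? ?]; apply/idealIP; split=> //; apply/colonP.
  - move=> N hKN hNL; split; [exact: idealD_r|by apply: idealDS => //; exact: scaleS|split].
      move=> u hu; apply/idealIP; split; last exact: hNL.
      by apply/colonP; apply: idealD_l; exact: mem_scale.
    move=> u /idealIP[/colonP/idealDP[_ [v [/scaleP[w wN ->] vM e]]] uL].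
    have : u - w \in N.
      apply: hKN; apply/idealIP; split; last by apply: idealBm => //; exact: hNL.
      by apply/colonP; rewrite mulrBr e addrC addKr.
    by move=> /idealDm/(_ wN); rewrite subrK.
apply: (@chain_between_map (fun N => idealI (colon N x) L) (fun N => idealD (scale x N) M)).
- by move=> N N' hN u /idealIP[/colonP /hN ? ?]; apply/idealIP; split=> //; apply/colonP.
- by move=> N N' hN; apply: idealDS => //; exact: scaleS.
- move=> N hMN hNL; split.
  + by move=> u /idealIP[/colonP/hMN ? ?]; apply/idealIP; split=> //; apply/colonP.
  + by move=> u /idealIP[].
  split.
    move=> u uN; have /idealDP[_ [v [/scaleP[w wL ->] vM e]]] := hNL _ uN.
    rewrite e; apply: idealD_mem => //; apply: mem_scale; apply/idealIP; split=> //.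
    apply/colonP; have -> : x * w = u - v by rewrite e addrK.
    by apply: idealBm => //; exact: hMN.
  apply: idealD_min => // _ /scaleP[w /idealIP[/colonP ? _] ->] //.
Qed.

(** * Finite length over a noetherian local ring *)

Section LocalLength.
Variable m : ideal A.
Hypotheses (noeth : noetherian_ring A) (loc : local_ring m).

Lemma finlen_over_max K : {subset m <= K} -> finlen K idealT.
Proof.
move=> hm; exists 1%N => -[//|[//|k]] [N hN [h0 _]].
have [s1 n1] := hN 0%N isT; have [s2 n2] := hN 1%N isT.
have m0 : {subset m <= N 0} by move=> x /hm/h0.
have m1 : {subset m <= N 1} by move=> x /m0/s1.
case: (max_between noeth loc m1) => e; last by case: n2 => x _; rewrite e.
by case: n1; rewrite e.
Qed.

(** Each further generator adds a cyclic module killed by [m], of length at most one; [len_image]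
    turns it into an interval above an ideal containing [m]. *)
Lemma finlen_gen (s : seq A) K : (forall x y, x \in m -> y \in s -> x * y \in K) ->
  finlen K (idealD (idgen s) K).
Proof.
elim: s => [_|a s IH hs].
  have [f _] := lenn K; apply: finlenS f => //.
  by apply: idealD_min => // x /idgen0P ->; exact: ideal0.
set L := idealD (idgen s) K.
have sub : {subset L <= idealD (idgen (a :: s)) K}.
  by apply: idealDS => // x; rewrite idgen_cons; exact: idealD_r.
have f1 : finlen K L.
  by apply: IH => x y xm ys; apply: hs => //; rewrite inE ys orbT.
suff f2 : finlen L (idealD (idgen (a :: s)) K).
  by have [] := lenD (@idealD_r _ _ _) sub f1 f2.
have [[H _] _] := len_image idealT L a.
apply: finlenS (H _) => //.
  apply: idealD_min; last by move=> x hx; do 2!apply: idealD_r.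
  rewrite idgen_cons => x /idealDP[u [v [? ? ->]]]; apply: idealD_mem => //.
  exact: idealD_l.
apply: finlen_over_max => x xm; apply/idealIP; split=> //; apply/colonP.
by rewrite mulrC; apply: idealD_r; apply: hs => //; exact: mem_head.
Qed.

(** Split at [mL]: the quotient [L/mL] is finitely generated and killed by [m], and induction
    handles [mL] over its intersection with [K]. *)
Lemma finlen_powers K L n : {subset idealM (idealX m n) L <= K} -> finlen K L.
Proof.
elim: n K L => [|n IH] K L h.
  have [f _] := lenn K; apply: finlenS f => //.
  by move=> x xL; apply: h; rewrite idealM1.
have f1 : finlen (idealI K (idealM m L)) (idealM m L).
  apply: IH => x hx; apply/idealIP; split; last exact: (idealM_r hx).
  by apply: h; rewrite idealXS (idealMC m) -idealMA.
have f2 : finlen (idealM m L) L.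
  have [s hs] := noeth_fg noeth L.
  have := @finlen_gen s (idealM m L); rewrite -hs => H; apply: finlenS (H _) => //.
    exact: idealD_l.
  by move=> x y xm ys; apply: idealM_mem => //; rewrite hs; exact: mem_idgen.
have s1 : {subset idealI K (idealM m L) <= idealM m L} by move=> x /idealIP[].
have [f _] := lenD s1 (@idealM_r _ _ _) f1 f2.
by apply: finlenS f => // x /idealIP[].
Qed.

End LocalLength.

Definition quot_sub_pred K N of {subset K <= N} : {pred quot_mod K} :=
  fun q => (repr q : A) \in N.
Fact quot_subE K N (h : {subset K <= N}) x :
  (qmod_pi K x \in quot_sub_pred h) = (x \in N).
Proof.
have e : (repr (qmod_pi K x) : A) - x \in N.
  by apply: h; apply/qmod_piP; rewrite qmod_repr.
rewrite unfold_in; apply/idP/idP => hx.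
  by have := idealBm hx e; rewrite opprB addrCA subrr addr0.
by have := idealDm e hx; rewrite subrK.
Qed.
Fact quot_sub_closed K N (h : {subset K <= N}) : submod_closed (quot_sub_pred h).
Proof.
split=> [|a q r].
  have -> : 0 = qmod_pi K 0 by rewrite /qmod_pi piE.
  by rewrite quot_subE ideal0.
rewrite -(qmod_repr q) -(qmod_repr r) -[a *: _](qmod_piZ K a) -qmod_piD !quot_subE.
by move=> hq; apply: idealDm; exact: ideal_mull.
Qed.
HB.instance Definition _ K N (h : {subset K <= N}) :=
  GRing.isSubmodClosed.Build A (quot_mod K) (quot_sub_pred h) (quot_sub_closed h).
Definition quot_sub K N (h : {subset K <= N}) : submodClosed (quot_mod K) :=
  quot_sub_pred h.

Lemma length_ge_quot K n : length_ge (quot_mod K) n <-> chain_between K idealT n.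
Proof.
split=> [[N hN]|[N hN [h0 _]]].
  have ax i : ideal_axiom (fun x => qmod_pi K x \in N i).
    split=> [|x y hx hy|a x hx].
    - have -> : qmod_pi K 0 = 0 by rewrite /qmod_pi piE.
      exact: rpred0.
    - by rewrite qmod_piD; exact: rpredD.
    - by rewrite (qmod_piZ K a x); exact: (rpredZ a).
  exists (fun i => mkid (ax i)).
    move=> i /hN[s1 n1]; split=> [x hx|h].
      by apply: (iffRL (mkidP (ax i.+1) x)); apply: s1; exact: (iffLR (mkidP (ax i) x) hx).
    apply: n1 => q; rewrite -(qmod_repr q) => hq.
    apply: (iffLR (mkidP (ax i) (repr q))); apply: h.
    exact: (iffRL (mkidP (ax i.+1) (repr q)) hq).
  split=> // x xK; apply/(mkidP (ax 0%N)).
  have -> : qmod_pi K x = 0.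
    have -> : 0 = qmod_pi K 0 by rewrite /qmod_pi piE.
    by apply/qmod_piP; rewrite subr0.
  exact: rpred0.
(* Beyond index [n] the chain is arbitrary and may fail to contain [K]; capping the index makes
   every member define a submodule of the quotient. *)
have h i : {subset K <= N (minn i n)}.
  move=> x /h0 hx; apply: strict_chain_le hN _ _ hx.
  by rewrite /= geq_minr.
exists (fun i => quot_sub (h i)) => i lin.
have [s1 n1] := hN _ lin; split=> [q|hs].
  by rewrite -(qmod_repr q) !quot_subE (minn_idPl lin) (minn_idPl (ltnW lin)); exact: s1.
apply: n1 => x hx; have := hs (qmod_pi K x).
by rewrite !quot_subE (minn_idPl lin) (minn_idPl (ltnW lin)); exact.
Qed.

Lemma colength_eqP K : finlen K idealT -> colength_eq K (len K idealT)%:Z.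
Proof.
move=> f; exists (len K idealT) => //; have [h1 h2] := @lenP K idealT (fun _ _ => isT) f.
by split=> [|n]; [exact/length_ge_quot | move=> /length_ge_quot/h2].
Qed.

Lemma colength_eq_len K z : colength_eq K z -> z = (len K idealT)%:Z.
Proof.
move=> [l [h1 h2] <-]; congr Posz; apply/esym/len_unique.
  exact/length_ge_quot.
by move=> n /length_ge_quot/h2.
Qed.

End Length.

(** * Regular pairs *)

Section Primes.
Variable A : comNzRingType.
Implicit Types (I J K L P Q : ideal A) (a x y : A).

Definition prime_ideal P :=
  1 \notin P /\ forall x y, x * y \in P -> x \in P \/ y \in P.

Section PrimeIdealr.
Variables (P : ideal A) (primeP : prime_ideal P).
Definition prime_pred : A -> bool := fun x => x \in P.
Fact prime_pred_zmod : zmod_closed prime_pred.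
Proof. by split=> [|x y]; [exact: ideal0 | exact: idealBm]. Qed.
Fact prime_pred_proper :
  1 \notin prime_pred /\ forall a, {in prime_pred, forall u, a * u \in prime_pred}.
Proof. by split=> [|x y]; [exact: primeP.1 | exact: ideal_mull]. Qed.
Fact prime_pred_prime : @prime_idealr_closed A prime_pred.
Proof. by move=> x y /primeP.2[] h; apply/orP; [left|right]. Qed.
HB.instance Definition _ := GRing.isZmodClosed.Build A prime_pred prime_pred_zmod.
HB.instance Definition _ := isProperIdeal.Build A prime_pred prime_pred_proper.
HB.instance Definition _ := isPrimeIdealrClosed.Build A prime_pred prime_pred_prime.
Definition prime_idealr_of : prime_idealr A := prime_pred.
End PrimeIdealr.

Lemma krull_chain n (P : nat -> ideal A) : (forall i, prime_ideal (P i)) ->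
  strict_chain P n -> krull_dim_ge A n.
Proof. by move=> h hP; exists (fun i => prime_idealr_of (h i)). Qed.

Hypothesis noeth : noetherian_ring A.

(** Krull's construction: take an ideal [L] maximal among those containing [K] and missing [S]. Two
    elements outside [L] each generate with [L] an element of [S]; the product of these shows that
    the product of the two is not in [L]. *)
Lemma prime_avoiding K (S : A -> Prop) : S 1 ->
  (forall x y, S x -> S y -> S (x * y)) -> (forall x, S x -> x \notin K) ->
  exists Q, [/\ prime_ideal Q, {subset K <= Q} & forall x, S x -> x \notin Q].
Proof.
move=> S1 SM SK.
case: (noeth_max noeth (P := fun L => {subset K <= L} /\ forall x, S x -> x \notin L)).
  by exists K; split.
move=> L [KL SL] hmax; exists L; split=> //; split=> [|x y hxy]; first exact: SL.
have ext z : z \notin L -> exists s l c, [/\ S s, l \in L & s = z * c + l].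
  move=> zL; apply: contrapT => hno.
  suff : {subset idealD (scale z idealT) L <= L}.
    move/(_ z) => h; case/negP: zL; apply: h; apply: idealD_l.
    by apply/scaleP; exists 1; rewrite ?mulr1.
  apply: hmax; last exact: idealD_r.
  split=> [w /KL|s Ss]; first exact: idealD_r.
  apply/negP => /idealDP[_ [l [/scaleP[c _ ->] lL e]]].
  by apply: hno; exists s, l, c.
case: (boolP (x \in L)) => [|/ext[s [l [c [Ss lL es]]]]]; [by left|].
case: (boolP (y \in L)) => [|/ext[t [k [d [St kL et]]]]]; [by right|].
have /negP[] := SL _ (SM _ _ Ss St).
have -> : s * t = x * y * (c * d) + (l * t + x * c * k) by rewrite es et; ring.
by apply: idealDm; [exact: ideal_mulr | apply: idealDm; [exact: ideal_mulr | exact: ideal_mull]].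
Qed.

(* A non-zero-divisor modulo [K] lies in no minimal prime of [K]. *)
Lemma prime_below K P f : prime_ideal P -> {subset K <= P} -> f \in P ->
  (forall w, f * w \in K -> w \in K) ->
  exists Q, [/\ prime_ideal Q, {subset K <= Q}, {subset Q <= P} & f \notin Q].
Proof.
move=> [P1 PM] KP fP hf.
have hfn n w : f ^+ n * w \in K -> w \in K.
  by elim: n => [|n IH]; rewrite ?mul1r // exprS -mulrA => /hf.
(* The products [f^n s] with [s] outside [P] miss [K], as [f] cancels modulo [K]. A prime avoiding
   them lies in [P] (take [n = 0]) and misses [f] (take [s = 1], [n = 1]). *)
case: (@prime_avoiding K (fun x => exists s n, s \notin P /\ x = f ^+ n * s)).
- by exists 1, 0%N; rewrite mulr1.
- move=> _ _ [s [n [hs ->]]] [t [p [ht ->]]]; exists (s * t), (n + p)%N.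
  split; last by rewrite exprD; ring.
  by apply/negP => /PM[]; apply/negP.
- by move=> _ [s [n [hs ->]]]; apply: contra hs => /hfn/KP.
- move=> Q [primeQ KQ hQ]; exists Q; split=> //.
    move=> x xQ; apply: contrapT => /negP xP.
    by have /negP[] : x \notin Q by apply: hQ; exists x, 0%N; rewrite mul1r.
  by apply: hQ; exists 1, 1%N; rewrite mulr1.
Qed.

End Primes.

Section RegularPairs.
Variable A : comNzRingType.
Implicit Types (I J K L P Q : ideal A) (a b u v w x y z : A).

Definition nzd a := forall w, a * w = 0 -> w = 0.
(** The properness clause of [regular_seq] is left out: a pair may generate the unit ideal, so
    exponent 0 is covered by [regular_pairX]. *)
Definition regular_pair a b :=
  nzd a /\ forall u w, b * w = a * u -> exists t, w = a * t.

Lemma nzdI a u v : nzd a -> a * u = a * v -> u = v.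
Proof.
move=> h e; apply/eqP; rewrite -subr_eq0; apply/eqP/h.
by rewrite mulrBr e subrr.
Qed.

Lemma nzdX a n : nzd a -> nzd (a ^+ n).
Proof.
move=> h; elim: n => [|n IH] w; first by rewrite mul1r.
by rewrite exprS -mulrA => /h/IH.
Qed.

Lemma regular_pairX a b n p : regular_pair a b -> regular_pair (a ^+ n) (b ^+ p).
Proof.
move=> [ha hb]; split; first exact: nzdX.
have hbp q u w : b ^+ q * w = a * u -> exists t, w = a * t.
  elim: q u w => [|q IH] u w; first by rewrite mul1r => ->; exists u.
  by rewrite exprS -mulrA => /hb[t /IH].
elim: n => [|n IH] u w; first by exists w; rewrite mul1r.
rewrite exprS -mulrA => /[dup] e /hbp[w' ew].
have [|t et] := IH u w'; first by apply: (nzdI ha); rewrite -e ew mulrCA.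
by exists t; rewrite -mulrA -et.
Qed.

Definition pair_ideal a b := idealD (scale a idealT) (scale b idealT).

Lemma pair_idealP a b x : x \in pair_ideal a b <-> exists u v, x = a * u + b * v.
Proof.
rewrite idealDP; split=> [[_ [_ [/scaleP[u _ ->] /scaleP[v _ ->] ->]]]|[u [v ->]]].
  by exists u, v.
by exists (a * u), (b * v); split=> //; exact: mem_scale.
Qed.

Lemma pair_idealC a b : pair_ideal a b = pair_ideal b a.
Proof.
by apply: ideal_ext => x; apply/idP/idP => /pair_idealP[u [v ->]];
  apply/pair_idealP; exists v, u; rewrite addrC.
Qed.

Lemma pair_ideal_l a b : a \in pair_ideal a b.
Proof. by apply/pair_idealP; exists 1, 0; rewrite mulr1 mulr0 addr0. Qed.
Lemma pair_ideal_r a b : b \in pair_ideal a b.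
Proof. by rewrite pair_idealC; exact: pair_ideal_l. Qed.

Lemma pair_ideal_sub a b K : a \in K -> b \in K -> {subset pair_ideal a b <= K}.
Proof.
move=> aK bK x /pair_idealP[u [v ->]].
by apply: idealDm; exact: ideal_mulr.
Qed.

(** * Systems of parameters in dimension two *)

Section SystemsOfParameters.
Variable m : ideal A.
Hypotheses (noeth : noetherian_ring A) (loc : local_ring m).

Section RegularParameters.
Variables x y a b : A.
Hypotheses (xm : x \in m) (ym : y \in m) (xy_reg : regular_pair x y).
Variable N : nat.
Hypotheses (bm : b \in m) (abN : {subset idealX m N <= pair_ideal a b}).

Let xN := mem_idealX N xm.
Let yN := mem_idealX N ym.
Let xyN := regular_pairX N N xy_reg.

(* On [(0 : a)] both [x^N = b c] and [y^N = b d], so [y^N c = x^N d] and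
   regularity gives [c (0 : a) <= x^N (0 : a) = b c (0 : a)]. *)
Lemma parameter_nzd : nzd a.
Proof.
have /pair_idealP[c' [c ex]] := abN xN; have /pair_idealP[d' [d ey]] := abN yN.
have [hx hy] := xyN.
pose Z := colon (scale 0 idealT) a.
have ZP w : w \in Z <-> a * w = 0.
  split=> [/colonP/scaleP[u _]|e]; first by rewrite mul0r.
  by apply/colonP/scaleP; exists 0; rewrite // mulr0.
have xZ w : a * w = 0 -> x ^+ N * w = b * (c * w).
  by move=> e; rewrite ex mulrDl mulrAC e mul0r add0r mulrA.
have yZ w : a * w = 0 -> y ^+ N * w = b * (d * w).
  by move=> e; rewrite ey mulrDl mulrAC e mul0r add0r mulrA.
have sub : {subset scale c Z <= idealM m (scale c Z)}.
  move=> _ /scaleP[w /ZP aw ->].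
  have [t ct] : exists t, c * w = x ^+ N * t.
    by apply: (hy (d * w)); rewrite mulrCA yZ // [RHS]mulrCA xZ //; ring.
  have at0 : a * t = 0 by apply: hx; rewrite mulrCA -ct mulrCA aw mulr0.
  rewrite ct xZ //; apply: idealM_mem => //.
  by apply: mem_scale; apply/ZP.
move=> w aw; apply: hx; rewrite xZ //.
have -> : c * w = 0; last by rewrite mulr0.
by apply: (nakayama0 noeth loc sub); apply: mem_scale; apply/ZP.
Qed.

(** The Cohen-Macaulay property spreads from [(x, y)] to all parameters. If [b w = a u], then [a]
    divides both [x^N w] and [y^N w]; comparing the two quotients, regularity of [(x^N, y^N)] makes
    the first one divisible by [x^N], which then cancels. *)
Lemma parameter_regular : regular_pair a b.
Proof.
have ha := parameter_nzd; split=> // u w e.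
have /pair_idealP[p [q ex]] := abN xN; have /pair_idealP[p' [q' ey]] := abN yN.
have [hx hy] := xyN.
have xw : x ^+ N * w = a * (p * w + q * u).
  rewrite ex; transitivity (a * p * w + q * (b * w)); [ring|rewrite e; ring].
have yw : y ^+ N * w = a * (p' * w + q' * u).
  rewrite ey; transitivity (a * p' * w + q' * (b * w)); [ring|rewrite e; ring].
have [t et] : exists t, p * w + q * u = x ^+ N * t.
  apply: (hy (p' * w + q' * u)); apply: (nzdI ha).
  by rewrite mulrCA -xw [RHS]mulrCA -yw mulrCA.
by exists t; apply: (nzdI hx); rewrite xw et mulrCA.
Qed.

End RegularParameters.

Lemma cohen_macaulay2 : krull_dim A 2 -> cohen_macaulay m ->
  exists x y, [/\ x \in m, y \in m & regular_pair x y].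
Proof.
move=> [h2 m2] [d [hd md] [dd _]].
have {hd md} ed : d = 2 by apply/eqP; rewrite eqn_leq (m2 _ hd) (md _ h2).
case: dd => [[|x [|y [|z s]]] []]; rewrite {}ed //= => _ sm [hreg _].
exists x, y; split; [by apply: sm; rewrite !inE eqxx|by apply: sm; rewrite !inE eqxx orbT|].
split=> [w e|u w e].
  by apply/idgen0P; apply: (hreg 0%N isT w); rewrite /= e; apply/idgen0P.
by apply/idgen1P; apply: (hreg 1%N isT w); apply/idgen1P; exists u.
Qed.

(** Otherwise some prime [L] over [(x, y)] misses an element of [m]. Applying [prime_below] to [y]
    modulo [x] and then to [x] modulo 0 puts two more primes below it, and with [m] on top the chain
    has length three. *)
Lemma dim2_parameters x y : krull_dim A 2 -> x \in m -> y \in m ->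
  regular_pair x y -> exists N, {subset idealX m N <= pair_ideal x y}.
Proof.
move=> [_ dim2] xm ym [hx hy].
have [s hs] := noeth_fg noeth m; rewrite hs; apply: idgen_power_sub => z.
move=> zs; have zm : z \in m by rewrite hs; exact: mem_idgen.
apply: contrapT => hno.
have [L [primeL xyL zL]] : exists L, [/\ prime_ideal L,
    {subset pair_ideal x y <= L} & z \notin L].
  case: (@prime_avoiding A noeth (pair_ideal x y) (fun u => exists n, u = z ^+ n)).
  - by exists 0%N.
  - by move=> _ _ [n ->] [p ->]; exists (n + p)%N; rewrite exprD.
  - by move=> _ [n ->]; apply/negP => h; apply: hno; exists n.
  - by move=> L [? ? hL]; exists L; split=> //; apply: hL; exists 1%N.
have Lm : {subset L <= m} by apply: proper_sub_m => //; case: primeL.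
have [Q1 [pQ1 xQ1 Q1L yQ1]] : exists Q, [/\ prime_ideal Q,
    {subset scale x idealT <= Q}, {subset Q <= L} & y \notin Q].
  apply: prime_below => //.
  - by move=> _ /scaleP[u _ ->]; apply: xyL; apply/ideal_mulr/pair_ideal_l.
  - exact/xyL/pair_ideal_r.
  - by move=> w /scaleP[u _ /hy[t ->]]; exact: mem_scale.
have xx : x \in Q1 by apply: xQ1; apply/scaleP; exists 1; rewrite ?mulr1.
have [Q0 [pQ0 _ Q01 xQ0]] : exists Q, [/\ prime_ideal Q,
    {subset scale 0 idealT <= Q}, {subset Q <= Q1} & x \notin Q].
  apply: prime_below => //.
  - by move=> _ /scaleP[u _ ->]; rewrite mul0r ideal0.
  - move=> w /scaleP[u _]; rewrite mul0r => /hx ->; exact: ideal0.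
suff /dim2 : krull_dim_ge A 3 by [].
apply: (@krull_chain A 3 (fun i => match i with 0 => Q0 | 1 => Q1 | 2 => L | _ => m end)).
  case=> [|[|[|i]]] //; split; [exact: one_notin_m|exact: m_prime].
case=> [|[|[|i]]] // _; split=> //.
- by move=> /(_ x xx); rewrite (negPf xQ0).
- by move=> /(_ y (xyL _ (pair_ideal_r _ _))); rewrite (negPf yQ1).
- by move=> /(_ z zm); rewrite (negPf zL).
Qed.

End SystemsOfParameters.

Lemma pair_ideal1 b : pair_ideal 1 b = idealT.
Proof. by apply: ideal1_all; exact: pair_ideal_l. Qed.

(** Multiplication by [a], a non-zero-divisor modulo [b], identifies [A/(a', b)] with
    [(a, b)/(a a', b)]. *)
Lemma len_pair_mul a a' b : regular_pair b a ->
  finlen (pair_ideal a b) idealT -> finlen (pair_ideal a' b) idealT ->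
  finlen (pair_ideal (a * a') b) idealT /\
  len (pair_ideal (a * a') b) idealT =
    (len (pair_ideal a b) idealT + len (pair_ideal a' b) idealT)%N.
Proof.
move=> [hb hba] f1 f2; set K := pair_ideal (a * a') b.
have [i1 i2] := len_image idealT K a.
have e1 : idealI (colon K a) idealT = pair_ideal a' b.
  apply: ideal_anti => [x /idealIP[/colonP/pair_idealP[u [v e]] _]|x /pair_idealP[u [v ->]]].
    have [|t et] := hba v (x - a' * u); first by rewrite mulrBr e; ring.
    by apply/pair_idealP; exists u, t; rewrite -et; ring.
  apply/idealIP; split=> //; apply/colonP/pair_idealP.
  by exists u, (a * v); ring.
have e2 : idealD (scale a idealT) K = pair_ideal a b.
  apply: ideal_anti.
    apply: idealD_min; first exact: idealD_l.
    apply: pair_ideal_sub; last exact: pair_ideal_r.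
    by apply: ideal_mulr; exact: pair_ideal_l.
  apply: pair_ideal_sub; last exact/idealD_r/pair_ideal_r.
  by apply/idealD_l/scaleP; exists 1; rewrite ?mulr1.
rewrite e1 e2 in i1 i2.
have [|//|f e] := lenD _ _ (i1.1 f2) f1; first by rewrite -e2; exact: idealD_r.
by split=> //; rewrite e -i2 addnC.
Qed.

Lemma len_pairX a b n p : regular_pair a b -> regular_pair b a ->
  finlen (pair_ideal a b) idealT ->
  finlen (pair_ideal (a ^+ n) (b ^+ p)) idealT /\
  len (pair_ideal (a ^+ n) (b ^+ p)) idealT = (n * p * len (pair_ideal a b) idealT)%N.
Proof.
move=> hab hba f.
have H a' b' k : regular_pair b' a' -> finlen (pair_ideal a' b') idealT ->
    finlen (pair_ideal (a' ^+ k) b') idealT /\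
    len (pair_ideal (a' ^+ k) b') idealT = (k * len (pair_ideal a' b') idealT)%N.
  move=> reg fin; elim: k => [|k [f1 e1]]; first by rewrite expr0 pair_ideal1; exact: lenn.
  by have [? e2] := len_pair_mul reg fin f1; rewrite exprS; split=> //; rewrite e2 e1 mulSn.
have [f1 e1] := H _ _ n hba f; rewrite pair_idealC in f1 e1.
have [f2 e2] := H _ _ p (regular_pairX n 1 hab) f1.
by rewrite pair_idealC; split=> //; rewrite e2 e1 pair_idealC; lia.
Qed.

(** This count stands in for the Koszul complexes. In the chain [aQ + bP], [aA + bP], [(a, b)], [A]
    the first quotient is [A/Q] via [a] and the second is [A/P] via [b]; the colon ideals are
    exactly [Q] and [P] because [b] is in [Q] and [a] in [P]. *)
Lemma len_mixed a b P Q : regular_pair a b -> regular_pair b a ->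
  a \in P -> b \in Q -> finlen (pair_ideal a b) idealT ->
  finlen P idealT -> finlen Q idealT ->
  let D := idealD (scale a Q) (scale b P) in
  finlen D idealT /\
  len D idealT = (len (pair_ideal a b) idealT + len P idealT + len Q idealT)%N.
Proof.
move=> hab hba aP bQ fin fP fQ D.
set E := idealD (scale a idealT) (scale b P).
have [i1 i2] := len_image idealT D a.
have e1 : idealI (colon D a) idealT = Q.
  apply: ideal_anti => x.
    move=> /idealIP[/colonP/idealDP[_ [_ [/scaleP[q hq ->] /scaleP[p hp ->] e]]] _].
    have [|t et] := hba.2 p (x - q); first by rewrite mulrBr e; ring.
    have -> : x = q + b * t by rewrite -et; ring.
    by apply: idealDm => //; exact: ideal_mulr.
  move=> xQ; apply/idealIP; split=> //; apply/colonP.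
  by apply: idealD_l; exact: mem_scale.
have e2 : idealD (scale a idealT) D = E.
  apply: ideal_anti; last by apply: idealDS => //; exact: idealD_r.
  apply: idealD_min; first exact: idealD_l.
  by apply: idealDS => //; exact: scaleS.
have [j1 j2] := len_image idealT E b.
have e3 : idealI (colon E b) idealT = P.
  apply: ideal_anti => x.
    move=> /idealIP[/colonP/idealDP[_ [_ [/scaleP[q hq ->] /scaleP[p hp ->] e]]] _].
    have [|t et] := hab.2 q (x - p); first by rewrite mulrBr e; ring.
    have -> : x = p + a * t by rewrite -et; ring.
    by apply: idealDm => //; exact: ideal_mulr.
  move=> xQ; apply/idealIP; split=> //; apply/colonP.
  by apply: idealD_r; exact: mem_scale.
have e4 : idealD (scale b idealT) E = pair_ideal a b.
  apply: ideal_anti.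
    apply: idealD_min; first exact: idealD_r.
    by apply: idealDS => //; exact: scaleS.
  apply: idealD_min; last exact: idealD_l.
  by move=> x hx; apply: idealD_r; exact: idealD_l.
rewrite e1 e2 in i1 i2; rewrite e3 e4 in j1 j2.
have [||f1 l1] := lenD _ _ (i1.1 fQ) (j1.1 fP).
- by apply: idealDS => //; exact: scaleS.
- by apply: idealDS => //; exact: scaleS.
have [||f2 l2] := lenD _ _ f1 fin => //.
  by apply: idealDS; exact: scaleS.
by split=> //; rewrite l2 l1 -i2 -j2; lia.
Qed.

End RegularPairs.

(** * Noetherian families of ideals *)

Section HilbertBasis.
Variable A : comNzRingType.
Hypothesis noeth : noetherian_ring A.
Implicit Types (f g h : {poly A}) (s : seq {poly A}).

Lemma idgen_lead s n c : (forall g, g \in s -> (size g <= n.+1)%N) ->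
  c \in idgen (map lead_coef s) ->
  exists h, [/\ h \in idgen s, (size h <= n.+1)%N & h`_n = c].
Proof.
elim: s c => [|g s IH] c hs.
  change (c \in idgen [::] -> exists h : {poly A},
    [/\ h \in idgen [::], (size h <= n.+1)%N & h`_n = c]).
  move=> /idgen0P ->; exists 0; rewrite size_poly0 coef0; split=> //; exact: ideal0.
rewrite map_cons => /idgen_consP[a [y [hy ->]]].
have [|h [hin hsz hn]] := IH y _ hy.
  by move=> k ks; apply: hs; rewrite inE ks orbT.
have gn := hs g (mem_head _ _).
(* This power of ['X] lifts the leading coefficient of [g] to degree [n]. *)
exists (a%:P * 'X^(n.+1 - size g) * g + h); split.
- by apply/idgen_consP; exists (a%:P * 'X^(n.+1 - size g)), h.
- apply: leq_trans (size_polyD _ _) _; rewrite geq_max hsz andbT.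
  rewrite -mulrA mul_polyC; apply: leq_trans (size_scale_leq _ _) _.
  rewrite mulrC; apply: leq_trans (size_polyMleq _ _) _.
  by rewrite size_polyXn; lia.
- rewrite coefD hn -mulrA coefCM coefXnM lead_coefE; congr (_ * _ + _).
  case: (posnP (size g)) => [/eqP g0|g0].
    by move: g0; rewrite size_poly_eq0 => /eqP ->; rewrite !coef0 if_same.
  by rewrite ifF; [congr (_`_ _)|]; lia.
Qed.

Theorem hilbert_basis : noetherian_ring {poly A}.
Proof.
move=> I; apply: contrapT => hno.
have step s : (forall g, g \in s -> g \in I) -> exists f, [/\ f \in I, f \notin idgen s
    & forall g, g \in I -> g \notin idgen s -> (size f <= size g)%N].
  move=> sI.
  have [f fI fs] : exists2 f, f \in I & f \notin idgen s.
    apply: contrapT => h; apply: hno; exists s => x.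
    apply/idP/idP; last exact: (@idgen_sub _ s I).
    by move=> xI; apply: contrapT => /negP xs; apply: h; exists x.
  have hex : exists n, `[< exists f, [/\ f \in I, f \notin idgen s & size f = n] >].
    by exists (size f); apply/asboolP; exists f.
  case: (ex_minnP hex) => n /asboolP[f' [f'I f's <-]] hmin.
  exists f'; split=> // g gI gs; apply: hmin; apply/asboolP; by exists g.
have nxt (c : {s | forall g, g \in s -> g \in I}) : {f | [/\ f \in I, f \notin idgen (sval c)
    & forall g, g \in I -> g \notin idgen (sval c) -> (size f <= size g)%N]}.
  by apply: cid; apply: step; exact: (svalP c).
have cons_in (c : {s | forall g, g \in s -> g \in I}) g : g \in sval (nxt c) :: sval c -> g \in I.
  by rewrite inE => /orP[/eqP->|]; [case: (svalP (nxt c)) | exact: (svalP c)].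
have nil_in g : g \in [::] -> g \in I by [].
pose S := nat_rect (fun=> {s | forall g, g \in s -> g \in I}) (exist _ [::] nil_in)
  (fun _ c => exist _ _ (cons_in c)).
pose f n := sval (nxt (S n)).
have SS n : sval (S n.+1) = f n :: sval (S n) by [].
have SSub n x : x \in idgen (sval (S n)) -> x \in idgen (sval (S n.+1)).
  by rewrite SS => hx; apply/idgen_consP; exists 0, x; rewrite mul0r add0r.
have fsz n g : g \in sval (S n) -> (size g <= size (f n))%N.
  elim: n g => [//|n IH] g; have mono : (size (f n) <= size (f n.+1))%N.
    have [_ _] := svalP (nxt (S n)); apply.
      by have [] := svalP (nxt (S n.+1)).
    have [_ h _] := svalP (nxt (S n.+1)); apply: contra h; exact: SSub.
  by rewrite SS inE => /orP[/eqP->//|/IH h]; exact: leq_trans mono.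
(* The ideals of leading coefficients repeat at some [n], so an [h] in the span of the earlier
   elements has the leading term of [f n]. Then [f n - h] is still outside the span but smaller,
   against the minimal choice of [f n]. *)
have [n hn] : exists n, {subset idgen (map lead_coef (sval (S n.+1))) <=
                          idgen (map lead_coef (sval (S n)))}.
  apply: (noeth_acc noeth) => n x; rewrite SS /= => hx.
  by apply/idgen_consP; exists 0, x; rewrite mul0r add0r.
have [fI fs fmin] := svalP (nxt (S n)); rewrite -/(f n) in fI fs fmin.
have f0 : (0 < size (f n))%N.
  by rewrite lt0n size_poly_eq0; apply: contra fs => /eqP ->; exact: ideal0.
have [||h [hin hsz hc]] := @idgen_lead (sval (S n)) (size (f n)).-1 (lead_coef (f n)).
- by move=> g /fsz; rewrite prednK.
- by apply: hn; rewrite SS; apply: mem_idgen; exact: mem_head.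
rewrite prednK // in hsz.
have : (size (f n) <= size (f n - h)%R)%N.
  apply: fmin; first by apply: idealBm => //; exact: (@idgen_sub _ _ I (svalP (S n)) _ hin).
  by apply: contra fs => k; have := idealDm k hin; rewrite subrK.
apply/negP; rewrite -ltnNge -(prednK f0) ltnS; apply/leq_sizeP => j le.
rewrite coefB; move: le; rewrite leq_eqVlt => /orP[/eqP <-|lt].
  by rewrite hc lead_coefE subrr.
rewrite prednK // in lt.
by rewrite !nth_default ?subr0 // (leq_trans hsz).
Qed.

End HilbertBasis.

(** The algebra generated by [l] is presented by an iterated polynomial ring instead of being built
    as a subring. The last clause is the induction principle for its elements. *)
Lemma noetherian_adjoin (R B : comNzRingType) (phi0 : {rmorphism R -> B})
    (l : seq B) : noetherian_ring R ->
  exists (S : comNzRingType) (phi : {rmorphism S -> B}),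
  [/\ noetherian_ring S, forall x, x \in l -> exists s, phi s = x,
      forall c, exists s, phi s = phi0 c
    & forall W : B -> Prop, (forall x y, W x -> W y -> W (x + y)) ->
        (forall x y, W x -> W y -> W (x * y)) -> W 0 -> W 1 ->
        (forall c, W (phi0 c)) -> (forall x, x \in l -> W x) -> forall s, W (phi s)].
Proof.
move=> noeth; elim: l => [|b l [S [phi [nS hl h0 hW]]]].
  by exists R, phi0; split=> // c; exists c.
have cb : commr_rmorph phi b by move=> x; exact: mulrC.
exists {poly S}, (horner_morph cb); split.
- exact: hilbert_basis.
- move=> x; rewrite inE => /orP[/eqP->|/hl[s <-]].
    by exists 'X; exact: horner_morphX.
  by exists s%:P; exact: horner_morphC.
- by move=> c; have [s <-] := h0 c; exists s%:P; exact: horner_morphC.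
- move=> W WD WM W0 W1 Wc Wl p; rewrite /= /horner_morph horner_coef.
  have Wphi := hW W WD WM W0 W1 Wc (fun x xl => Wl x (@mem_behead _ (b :: l) _ xl)).
  apply: (big_ind W) => [//|//|i _].
  rewrite coef_map /=; apply: (WM) => //.
  elim: (nat_of_ord i) => [|n IH]; rewrite ?expr0 // exprS; apply: (WM) => //.
  by apply: Wl; exact: mem_head.
Qed.

Section Families.
Variable R : comNzRingType.
Hypothesis noeth : noetherian_ring R.
Implicit Types (a c u v w x y : R).

(* A family [N] encodes the bigraded submodule [⨁ N r s t1^r t2^s] of [R[t1, t2]]. *)
Definition fam := nat -> nat -> ideal R.

Definition fam_le (M N : fam) := forall r s, {subset M r s <= N r s}.

Section IdealPair.
Variables I J : ideal R.

Definition rees_fam : fam := fun r s => idealM (idealX I r) (idealX J s).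

Definition stable (N : fam) :=
  (forall r s x w, x \in I -> w \in N r s -> x * w \in N r.+1 s) /\
  (forall r s x w, x \in J -> w \in N r s -> x * w \in N r s.+1).

Lemma stable_mul N p q r s c w : stable N -> c \in rees_fam p q -> w \in N r s ->
  c * w \in N (p + r)%N (q + s)%N.
Proof.
move=> [hI hJ] + hw; move: c.
suff hsub : {subset rees_fam p q <= colon (N (p + r)%N (q + s)%N) w}.
  by move=> c /hsub/colonP; rewrite mulrC.
apply: idealM_sub => x y xI yJ; apply/colonP; rewrite mulrC -mulrA.
have hy : y * w \in N r (q + s)%N.
  elim: q y yJ => [|q IH] y yJ; first exact: ideal_mull.
  suff : {subset idealX J q.+1 <= colon (N r (q.+1 + s)%N) w}.
    by move=> /(_ _ yJ)/colonP; rewrite mulrC.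
  apply: idealM_sub => u v uJ /IH hv; apply/colonP.
  by rewrite mulrC -mulrA addSn; exact: hJ.
elim: p x xI => [|p IH] x xI; first exact: ideal_mull.
suff : {subset idealX I p.+1 <= colon (N (p.+1 + r)%N (q + s)%N) (y * w)}.
  by move=> /(_ _ xI)/colonP; rewrite mulrC.
apply: idealM_sub => u v uI /IH hv; apply/colonP.
by rewrite mulrC -mulrA addSn; exact: hI.
Qed.

Lemma rees_fam_stable : stable rees_fam.
Proof.
split=> r s x w hx hw; rewrite /rees_fam idealXS.
  by rewrite -idealMA; exact: idealM_mem.
by rewrite idealMCA; exact: idealM_mem.
Qed.

Let B := {poly {poly R}}.
Let mono r s c : B := (c%:P * 'X^s)%:P * 'X^r.
Let coef2 (f : B) r s : R := f`_r`_s.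

Let coef2_mono r s c r' s' : coef2 (mono r s c) r' s' = c *+ ((r' == r) && (s' == s)).
Proof.
rewrite /coef2 /mono coefCM coefXn; case: (r' == r); last by rewrite mulr0 coef0.
by rewrite mulr1 coefCM coefXn; case: (s' == s); rewrite ?mulr1 ?mulr0.
Qed.

Let monoM r s c r' s' c' :
  mono r s c * mono r' s' c' = mono (r + r')%N (s + s')%N (c * c').
Proof. by rewrite /mono !exprD !rmorphM /=; ring. Qed.

Let monoD r s c c' : mono r s (c + c') = mono r s c + mono r s c'.
Proof. by rewrite /mono rmorphD /= mulrDl rmorphD /= mulrDl. Qed.

(** [B] is [R[t2][t1]], the outer variable being [t1]. The image of [phi] is the algebra generated
    by [I t1] and [J t2], so the Hilbert basis theorem becomes available for the Rees algebra. *)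
Lemma rees_presentation : exists (S : comNzRingType) (phi : {rmorphism S -> B}),
  [/\ noetherian_ring S,
     forall f r s, coef2 (phi f) r s \in rees_fam r s
   & forall r s c, c \in rees_fam r s -> exists f, phi f = mono r s c].
Proof.
have [gI hgI] := noeth_fg noeth I; have [gJ hgJ] := noeth_fg noeth J.
pose phi0 : {rmorphism R -> B} := polyC \o polyC.
pose l : seq B := map (mono 1 0) gI ++ map (mono 0 1) gJ.
have [S [phi [nS hl h0 hW]]] := noetherian_adjoin phi0 l noeth.
exists S, phi; split=> //.
  have mI x : x \in rees_fam 0 0 by rewrite /rees_fam idealM1.
  apply: (hW (fun f => forall r s, coef2 f r s \in rees_fam r s)).
  - by move=> f g hf hg r s; rewrite /coef2 !coefD; exact: (idealDm (hf r s) (hg r s)).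
  - move=> f g hf hg r s; rewrite /coef2 coefM coef_sum.
    apply: ideal_sum => i _; rewrite coefM; apply: ideal_sum => j _.
    have := stable_mul rees_fam_stable (hf i j) (hg (r - i)%N (s - j)%N).
    by rewrite !subnKC // -ltnS.
  - by move=> r s; rewrite /coef2 !coef0; exact: ideal0.
  - move=> r s; rewrite /coef2 coef1; case: r => [|r]; rewrite ?coef0 ?ideal0 //=.
    by rewrite coef1; case: s => [|s]; rewrite ?ideal0 // mI.
  - move=> c r s; rewrite /coef2 coefC; case: r => [|r]; rewrite ?coef0 ?ideal0 //=.
    by rewrite coefC; case: s => [|s]; rewrite ?ideal0 // mI.
  - move=> f; rewrite mem_cat => /orP[] /mapP[x xg ->] r s; rewrite coef2_mono.
      case: (altP (r =P _)) => [->|_]; last exact: ideal0.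
      case: (altP (s =P _)) => [->|_]; last exact: ideal0.
      by rewrite /rees_fam idealX1 idealMT hgI mulr1n; exact: mem_idgen.
    case: (altP (r =P _)) => [->|_]; last exact: ideal0.
    case: (altP (s =P _)) => [->|_]; last exact: ideal0.
    by rewrite /rees_fam idealX1 idealM1 hgJ mulr1n; exact: mem_idgen.
(* The coefficients whose monomial lies in the image form an ideal in each bidegree, and these
   ideals multiply. They contain [I] in bidegree [(1, 0)] and [J] in [(0, 1)], hence every
   [I^r J^s]. *)
have ax r s : ideal_axiom (fun c => exists f, phi f = mono r s c).
  split=> [|x y [f ef] [g eg]|c x [f ef]].
  - by exists 0; rewrite rmorph0 /mono !(polyC0, mul0r).
  - by exists (f + g); rewrite rmorphD ef eg monoD.
  - have [g eg] := h0 c; exists (g * f); rewrite rmorphM ef eg.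
    have -> : phi0 c = mono 0 0 c by rewrite /mono !expr0 !mulr1.
    by rewrite monoM.
have gI' : {subset I <= mkid (ax 1%N 0%N)}.
  rewrite hgI; apply: idgen_sub => x xg; apply/(mkidP (ax 1%N 0%N)).
  by apply: hl; rewrite mem_cat map_f.
have gJ' : {subset J <= mkid (ax 0%N 1%N)}.
  rewrite hgJ; apply: idgen_sub => x xg; apply/(mkidP (ax 0%N 1%N)).
  by apply: hl; rewrite mem_cat orbC map_f.
have mM p q r s (K L : ideal R) : {subset K <= mkid (ax p q)} ->
    {subset L <= mkid (ax r s)} -> {subset idealM K L <= mkid (ax (p + r) (q + s))%N}.
  move=> hK hL; apply: idealM_sub => x y /hK/mkidP[f ef] /hL/mkidP[g eg].
  by apply/(mkidP (ax _ _)); exists (f * g); rewrite rmorphM ef eg monoM.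
have m00 : {subset idealT <= mkid (ax 0%N 0%N)}.
  move=> c _; apply/(mkidP (ax _ _)); have [f ef] := h0 c; exists f.
  by rewrite ef /mono !expr0 !mulr1.
have mI r : {subset idealX I r <= mkid (ax r 0%N)}.
  elim: r => [|r IH] //; exact: (mM 1%N 0%N r 0%N _ _ gI' IH).
have mJ s : {subset idealX J s <= mkid (ax 0%N s)}.
  elim: s => [|s IH] //; exact: (mM 0%N 1%N 0%N s _ _ gJ' IH).
move=> r s c hc; apply/(mkidP (ax r s)).
by have := mM r 0%N 0%N s _ _ (mI r) (mJ s) _ hc; rewrite addn0.
Qed.

Let fam_ideal_axiom (S : comNzRingType) (phi : {rmorphism S -> B}) (N : fam) :
  (forall f r s, coef2 (phi f) r s \in rees_fam r s) -> stable N ->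
  ideal_axiom (fun f => forall r s, coef2 (phi f) r s \in N r s).
Proof.
move=> hphi hN; split=> [r s|f g hf hg r s|f g hg r s].
- by rewrite rmorph0 /coef2 !coef0; exact: ideal0.
- by rewrite rmorphD /coef2 !coefD; exact: (idealDm (hf r s) (hg r s)).
- rewrite rmorphM /coef2 coefM coef_sum.
  apply: ideal_sum => i _; rewrite coefM; apply: ideal_sum => j _.
  have := stable_mul hN (hphi f i j) (hg (r - i)%N (s - j)%N).
  by rewrite !subnKC // -ltnS.
Qed.

(** Families are compared through their inverse images, ideals of the noetherian ring [S];
    inclusions are reflected because every monomial of the Rees algebra comes from [S]. *)
Lemma fam_max (P : fam -> Prop) :
  (forall N, P N -> stable N /\ fam_le N rees_fam) -> (exists N, P N) ->
  exists2 N, P N & forall N', P N' -> fam_le N N' -> fam_le N' N.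
Proof.
have [S [phi [nS hphi hmono]]] := rees_presentation.
move=> hP [N0 PN0].
pose inK (N : fam) f := forall r s, coef2 (phi f) r s \in N r s.
case: (noeth_max nS (P := fun K => exists2 N, P N & forall f, f \in K <-> inK N f)).
  exists (mkid (fam_ideal_axiom hphi (hP _ PN0).1)); exists N0 => // f.
  exact: mkidP.
move=> K [N PN hKN] hmax; exists N => // N' PN' NN' r s c hc.
have [f ef] := hmono _ _ _ ((hP _ PN').2 _ _ _ hc).
suff : inK N f by move/(_ r s); rewrite ef coef2_mono !eqxx mulr1n.
apply/hKN/(hmax (mkid (fam_ideal_axiom hphi (hP _ PN').1))).
- by exists N' => // g; exact: mkidP.
- by move=> g /hKN hg; apply/mkidP => r' s'; exact: NN'.
- apply/mkidP => r' s'; rewrite ef coef2_mono.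
  case: eqP => [->|_]; last exact: ideal0.
  case: eqP => [->|_]; last exact: ideal0.
  by rewrite mulr1n.
Qed.

(** Finitely many generators have components only in degrees up to [n0]. Beyond that, the multiplier
    of a generator has positive degree in the growing direction, and a factor from [I] (or [J])
    splits off. The bound is independent of the other degree. *)
Lemma fam_fg N : stable N -> fam_le N rees_fam ->
  exists n0, (forall r s, (n0 <= r)%N -> {subset N r.+1 s <= idealM I (N r s)}) /\
             (forall r s, (n0 <= s)%N -> {subset N r s.+1 <= idealM J (N r s)}).
Proof.
have [S [phi [nS hphi hmono]]] := rees_presentation.
move=> stN leN.
have [gs hgs] := noeth_fg nS (mkid (fam_ideal_axiom hphi stN)).
have gsN g r s : g \in gs -> coef2 (phi g) r s \in N r s.
  by move=> /mem_idgen; rewrite -hgs => /mkidP; apply.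
have [n0 hn0] : exists n0, forall g r s, g \in gs -> (n0 < r)%N || (n0 < s)%N ->
    coef2 (phi g) r s = 0.
  elim: gs {hgs gsN} => [|g gs [n0 IH]]; first by exists 0%N.
  exists (maxn n0 (maxn (size (phi g)) (\max_(i < size (phi g)) size ((phi g)`_i)%R))).
  move=> h r s; rewrite inE => /orP[/eqP ->|/IH hh] lt; last by apply: hh;
    case/orP: lt; rewrite !gtn_max => /and3P[-> _ _]; rewrite ?orbT.
  rewrite /coef2; case: (ltnP r (size (phi g))) => [rlt|rge].
    rewrite [_`_s]nth_default //.
    have h1 : (size ((phi g)`_r)%R <= \max_(i < size (phi g)) size ((phi g)`_i)%R)%N.
      exact: (@leq_bigmax _ (fun i : 'I_(size (phi g)) => size ((phi g)`_i)%R) (Ordinal rlt)).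
    move: lt; rewrite !gtn_max => /orP[/and3P[_ lr _]|/and3P[_ _ ls]].
      by have := ltn_trans lr rlt; rewrite ltnn.
    exact: leq_trans h1 (ltnW ls).
  by rewrite (nth_default _ rge) coef0.
have expand r s c : c \in N r s -> exists fs : nat -> S,
    c = \sum_(k < size gs) coef2 (phi (fs k * gs`_k)) r s.
  move=> hc; have [f ef] := hmono _ _ _ (leN _ _ _ hc).
  have : f \in idgen gs.
    rewrite -hgs; apply/mkidP => r' s'; rewrite ef coef2_mono.
    case: eqP => [->|_]; last exact: ideal0.
    case: eqP => [->|_]; last exact: ideal0.
    by rewrite mulr1n.
  move=> /idgenP[fs efs]; exists fs.
  have -> : c = coef2 (phi f) r s by rewrite ef coef2_mono !eqxx mulr1n.
  by rewrite efs rmorph_sum /coef2 !coef_sum.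
have bound r s c (K : ideal R) : c \in N r s ->
    (forall i j u v, (i <= r)%N -> (j <= s)%N -> (i <= n0)%N -> (j <= n0)%N ->
       u \in rees_fam (r - i)%N (s - j)%N -> v \in N i j -> u * v \in K) -> c \in K.
  move=> /expand[fs ->] hK; apply: ideal_sum => k _.
  have gk : gs`_k \in gs by exact: mem_nth.
  rewrite mulrC rmorphM /coef2 coefM coef_sum; apply: ideal_sum => i _.
  rewrite coefM; apply: ideal_sum => j _; rewrite mulrC.
  have ir : (i <= r)%N by rewrite -ltnS.
  have js : (j <= s)%N by rewrite -ltnS.
  case: (boolP ((n0 < i) || (n0 < j)))%N => [h|].
    by rewrite -[(phi gs`_k)`_i`_j]/(coef2 _ i j) (hn0 _ _ _ gk h) mulr0 ideal0.
  rewrite negb_or -!leqNgt => /andP[ni nj].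
  apply: (hK i j) => //; [exact: hphi | exact: gsN].
exists n0; split=> r s le c hc; apply: (bound _ _ _ _ hc) => i j u v ir js ni nj hu hv.
  have ir' : (i <= r)%N by exact: leq_trans le.
  move: hu; rewrite /rees_fam subSn // idealXS -idealMA => hu.
  suff : {subset idealM I (idealM (idealX I (r - i)) (idealX J (s - j))) <=
          colon (idealM I (N r s)) v}.
    by move=> /(_ _ hu)/colonP; rewrite mulrC.
  apply: idealM_sub => x y xI hy; apply/colonP; rewrite mulrC -mulrA.
  apply: idealM_mem => //; have := stable_mul stN hy hv.
  by rewrite !subnK.
have js' : (j <= s)%N by exact: leq_trans le.
move: hu; rewrite /rees_fam subSn // idealXS idealMCA => hu.
suff : {subset idealM J (idealM (idealX I (r - i)) (idealX J (s - j))) <=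
        colon (idealM J (N r s)) v}.
  by move=> /(_ _ hu)/colonP; rewrite mulrC.
apply: idealM_sub => x y xI hy; apply/colonP; rewrite mulrC -mulrA.
apply: idealM_mem => //; have := stable_mul stN hy hv.
by rewrite !subnK.
Qed.

End IdealPair.
End Families.

(** * Finite differences *)

Section Differences.
Implicit Types (f g : nat -> int) (n k : nat).

Definition dif f n : int := f n.+1 - f n.

Lemma eq_iter_dif k f g n0 : (forall n, (n0 <= n)%N -> f n = g n) ->
  forall n, (n0 <= n)%N -> iter k dif f n = iter k dif g n.
Proof.
move=> h; elim: k => [|k IH] n le /=; first exact: h.
by rewrite /dif !IH // leqW.
Qed.

Lemma iter_difB k f g n :
  iter k dif (fun n => f n - g n) n = iter k dif f n - iter k dif g n.
Proof. by elim: k n => [|k IH] n //=; rewrite /dif !IH; ring. Qed.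

Lemma iter_difZ k (c : int) f n :
  iter k dif (fun n => c * f n) n = c * iter k dif f n.
Proof. by elim: k n => [|k IH] n //=; rewrite /dif !IH; ring. Qed.

Lemma iter_dif_shift k f c n : iter k dif (fun n => f (n + c)%N) n = iter k dif f (n + c)%N.
Proof. by elim: k n => [|k IH] n //=; rewrite /dif !IH. Qed.

Lemma iter_dif_le k k' f n0 : (k <= k')%N ->
  (forall n, (n0 <= n)%N -> iter k dif f n = 0) ->
  forall n, (n0 <= n)%N -> iter k' dif f n = 0.
Proof.
move=> /subnK <-; elim: (k' - k)%N => [//|d IH] h n le.
by rewrite addSn /= /dif !IH ?subrr // leqW.
Qed.

Lemma dif_const f n0 : (forall n, (n0 <= n)%N -> dif f n = 0) ->
  forall n, (n0 <= n)%N -> f n = f n0.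
Proof.
move=> h n /subnK <-; elim: (n - n0)%N => [//|k IH].
by rewrite -IH addSn; apply/eqP; rewrite -subr_eq0 -/(dif f _) h ?leq_addl.
Qed.

Lemma iter_dif_eventually_pos k f n0 :
  (forall n, (n0 <= n)%N -> 1 <= iter k dif f n) ->
  exists n1, (n0 <= n1)%N /\ forall n, (n1 <= n)%N -> 1 <= f n.
Proof.
elim: k f n0 => [|k IH] f n0 h; first by exists n0.
have {IH h} [n1 [le h]] : exists n1, (n0 <= n1)%N /\ forall n, (n1 <= n)%N -> 1 <= dif f n.
  by apply: IH => n /h; rewrite iterSr.
have grow j : f n1 + j%:Z <= f (j + n1)%N.
  elim: j => [|j IH]; first by rewrite addr0.
  by have := h (j + n1)%N (leq_addl _ _); rewrite /dif -addSn; lia.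
exists (`|f n1|.+1 + n1)%N; split=> [|n hn]; first by lia.
have e : n = (n - n1 + n1)%N by lia.
have := grow (n - n1)%N; rewrite -e; lia.
Qed.

(** If [c] were positive, [f - P] would have [k]-th difference at least one and eventually be
    positive, against [f n <= P n]; a negative [c] is excluded by [Q - f]. *)
Lemma iter_dif_squeeze k f P Q c n0 :
  (forall n, (n0 <= n)%N -> iter k dif f n = c) ->
  (forall n, (n0 <= n)%N -> iter k dif P n = 0) ->
  (forall n, (n0 <= n)%N -> iter k dif Q n = 0) ->
  (forall n, (n0 <= n)%N -> Q n <= f n <= P n) -> c = 0.
Proof.
move=> hf hP hQ hle; apply/eqP; rewrite eq_le; apply/andP; split.
  rewrite leNgt; apply/negP => cp.
  have [|n1 [le h]] := @iter_dif_eventually_pos k (fun n => f n - P n) n0.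
    by move=> n le; rewrite iter_difB hf // hP //; lia.
  by have := h _ (leqnn n1); have /andP[_] := hle _ le; lia.
rewrite leNgt; apply/negP => cn.
have [|n1 [le h]] := @iter_dif_eventually_pos k (fun n => Q n - f n) n0.
  by move=> n le; rewrite iter_difB hf // hQ //; lia.
by have := h _ (leqnn n1); have /andP[] := hle _ le; lia.
Qed.

(** Descent on the order: the next lower difference is constant, and the quadratic bound squeezes
    that constant to 0. The threshold [n0] is preserved, which keeps it uniform when [f] depends on
    a parameter. *)
Lemma quadratic_growth k f n0 (C : int) :
  (forall n, (n0 <= n)%N -> iter k dif f n = 0) ->
  (forall n, 0 <= f n <= C * (n.+1 ^ 2)%:Z) ->
  forall n, (n0 <= n)%N -> iter 3 dif f n = 0.
Proof.
move=> h hf; case: (leqP k 3) => [le3|]; first exact: iter_dif_le h.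
move=> lt; have ek : k = (k - 3 + 3)%N by lia.
rewrite {}ek {lt} in h.
elim: (k - 3)%N h => [//|d IH] h; apply: IH.
pose c := iter (d + 3) dif f n0.
have hc n : (n0 <= n)%N -> iter (d + 3) dif f n = c.
  by move=> le; apply: (dif_const _ le) => n' le'; have := h _ le'; rewrite addSn.
suff c0 : c = 0 by move=> n /hc ->.
apply: (@iter_dif_squeeze (d + 3) f (fun n => C * (n.+1 ^ 2)%:Z) (fun=> 0) c n0) => //.
  apply: (iter_dif_le (leq_addl d 3)) => n _ /=.
  by rewrite /dif; lia.
by apply: (iter_dif_le (leq_addl d 3)) => n _ /=; rewrite /dif.
Qed.

Lemma dif_bin2 n : dif (fun n => 'C(n.+1, 2)%:Z) n = n.+1%:Z.
Proof. by rewrite /dif binS bin1; lia. Qed.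

Lemma dif2_affine f n0 : (forall n, (n0 <= n)%N -> iter 2 dif f n = 0) ->
  forall n, (n0 <= n)%N -> f n = dif f n0 * (n%:Z - n0%:Z) + f n0.
Proof.
move=> h n le.
have hd p : (n0 <= p)%N -> dif f p = dif f n0 by apply: dif_const => q /h.
rewrite -{1}(subnK le); have -> : n%:Z - n0%:Z = (n - n0)%N%:Z by lia.
elim: (n - n0)%N => [|k IH]; first by rewrite mulr0 add0r.
have := hd (k + n0)%N (leq_addl _ _); rewrite addSn {1}/dif IH => e.
by move/eqP: e; rewrite subr_eq => /eqP ->; rewrite -addn1 PoszD; ring.
Qed.

Lemma dif3_quadratic f n0 : (forall n, (n0 <= n)%N -> iter 3 dif f n = 0) ->
  exists e : nat -> int, (forall n, (n0 <= n)%N ->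
    f n = e 0 * 'C(n.+1, 2)%:Z - e 1 * n%:Z + e 2) /\
    forall n, (n0 <= n)%N -> iter 2 dif f n = e 0.
Proof.
move=> h; pose E := iter 2 dif f n0.
have hE n : (n0 <= n)%N -> iter 2 dif f n = E by apply: dif_const => q /h.
pose g n := f n - E * 'C(n.+1, 2)%:Z.
have hg n : (n0 <= n)%N -> iter 2 dif g n = 0.
  move=> le; rewrite iter_difB iter_difZ hE //=.
  by rewrite {1}/dif !dif_bin2; lia.
exists (fun i => if i == 0%N then E else if i == 1%N then - dif g n0 else g n0 - dif g n0 * n0%:Z).
split=> [n le|] //=.
have := dif2_affine hg le; rewrite {1}/g => e.
by move/eqP: e; rewrite subr_eq => /eqP ->; ring.
Qed.

(** Once the pure quadratic parts are subtracted, the rest is affine in each variable separately and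
    is determined by its values at the four points with coordinates [n0] and [n0.+1]. *)
Lemma bidif_quadratic (H : nat -> nat -> int) (E F : int) n0 :
  (forall r s, (n0 <= r)%N -> (n0 <= s)%N -> iter 2 dif (fun r => H r s) r = E) ->
  (forall r s, (n0 <= r)%N -> (n0 <= s)%N -> iter 2 dif (H r) s = F) ->
  exists c d e z : int, forall r s, (n0 <= r)%N -> (n0 <= s)%N ->
    H r s = E * 'C(r.+1, 2)%:Z + F * 'C(s.+1, 2)%:Z + c * r%:Z * s%:Z
            - d * r%:Z - e * s%:Z + z.
Proof.
move=> hE hF.
pose G r s := H r s - (E * 'C(r.+1, 2)%:Z + F * 'C(s.+1, 2)%:Z).
have hG1 r s : (n0 <= r)%N -> (n0 <= s)%N -> iter 2 dif (G^~ s) r = 0.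
  move=> hr hs; have := hE _ _ hr hs; rewrite /= /dif /G.
  by rewrite (binS r.+2) (binS r.+1) !bin1; lia.
have hG2 r s : (n0 <= r)%N -> (n0 <= s)%N -> iter 2 dif (G r) s = 0.
  move=> hr hs; have := hF _ _ hr hs; rewrite /= /dif /G.
  by rewrite (binS s.+2) (binS s.+1) !bin1; lia.
pose n0' := n0%:Z.
have e1 r s (hr : (n0 <= r)%N) (hs : (n0 <= s)%N) :
    G r s = (G n0.+1 s - G n0 s) * (r%:Z - n0') + G n0 s.
  exact: (dif2_affine (f := G^~ s) (fun i hi => hG1 i s hi hs) hr).
have e2 s (hs : (n0 <= s)%N) : G n0 s = (G n0 n0.+1 - G n0 n0) * (s%:Z - n0') + G n0 n0.
  exact: (dif2_affine (fun i hi => hG2 n0 i (leqnn _) hi) hs).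
have e3 s (hs : (n0 <= s)%N) :
    G n0.+1 s = (G n0.+1 n0.+1 - G n0.+1 n0) * (s%:Z - n0') + G n0.+1 n0.
  exact: (dif2_affine (fun i hi => hG2 n0.+1 i (leqnSn _) hi) hs).
pose p := G n0 n0.+1 - G n0 n0; pose q := G n0.+1 n0.+1 - G n0.+1 n0.
pose t := G n0.+1 n0 - G n0 n0.
exists (q - p), ((q - p) * n0' - t), ((q - p) * n0' - p),
  ((q - p) * n0' * n0' - t * n0' - p * n0' + G n0 n0).
move=> r s hr hs.
have -> : H r s = G r s + (E * 'C(r.+1, 2)%:Z + F * 'C(s.+1, 2)%:Z) by rewrite /G subrK.
by rewrite e1 // e3 // e2 // -/p -/q /t; ring.
Qed.

End Differences.

(** * Hilbert functions *)

Section HilbertSerre.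
Variable R : comNzRingType.
Hypothesis noeth : noetherian_ring R.
Variables I J : ideal R.

(* [A/B] is a finitely generated bigraded module over the Rees algebra. *)
Definition subquotient (A B : fam R) :=
  [/\ stable I J A, stable I J B, fam_le B A & fam_le A (rees_fam I J)].

(** Kernel and cokernel of [x t1] on [A/B]: the kernel is a numerator over [B], the cokernel a
    denominator under [A]. Nothing maps into first degree 0, hence the case distinction in the
    cokernel. *)
Definition ker_fam (x : R) (A B : fam R) : fam R :=
  fun r s => idealI (colon (B r.+1 s) x) (A r s).
Definition coker_fam (x : R) (A B : fam R) : fam R :=
  fun r s => if r is r'.+1 then idealD (scale x (A r' s)) (B r s) else B r s.

Lemma ker_subquotient x A B : x \in I -> subquotient A B ->
  subquotient (ker_fam x A B) B.
Proof.
move=> xI [[AI AJ] [BI BJ] BA AR]; split=> //.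
- split=> r s c w cI /idealIP[/colonP hw wA]; apply/idealIP; split.
  + by apply/colonP; rewrite mulrCA; exact: BI.
  + exact: AI.
  + by apply/colonP; rewrite mulrCA; exact: BJ.
  + exact: AJ.
- move=> r s w wB; apply/idealIP; split; last exact: BA.
  by apply/colonP; exact: BI.
- by move=> r s w /idealIP[_ /AR].
Qed.

Lemma coker_subquotient x A B : x \in I -> subquotient A B ->
  subquotient A (coker_fam x A B).
Proof.
move=> xI [[AI AJ] [BI BJ] BA AR]; split=> //.
  split=> -[|r] s c w cI /=.
  - by move=> /(BI _ _ _ _ cI) h; exact: idealD_r.
  - move=> /idealDP[_ [v [/scaleP[u uA ->] vB ->]]]; rewrite mulrDr mulrCA.
    by apply: idealD_mem; [apply: mem_scale; exact: AI | exact: BI].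
  - exact: BJ.
  - move=> /idealDP[_ [v [/scaleP[u uA ->] vB ->]]]; rewrite mulrDr mulrCA.
    by apply: idealD_mem; [apply: mem_scale; exact: AJ | exact: BJ].
move=> [|r] s w /=; first exact: BA.
move=> /idealDP[_ [v [/scaleP[u uA ->] vB ->]]]; apply: idealDm; last exact: BA.
exact: AI.
Qed.

Lemma len_ker_coker x A B r s : x \in I -> subquotient A B ->
  (forall r s, finlen (B r s) (A r s)) ->
  (len (B r.+1 s) (A r.+1 s) + len (B r s) (ker_fam x A B r s) =
   len (B r s) (A r s) + len (coker_fam x A B r.+1 s) (A r.+1 s))%N.
Proof.
move=> xI hAB fin.
have [_ _ BK _] := ker_subquotient xI hAB; have [_ _ CA _] := coker_subquotient xI hAB.
have KA : {subset ker_fam x A B r s <= A r s} by move=> w /idealIP[].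
have BC : {subset B r.+1 s <= coker_fam x A B r.+1 s} by exact: idealD_r.
have [_ e1] := lenD (BK r s) KA (finlenS (fun _ h => h) KA (fin r s))
  (finlenS (BK r s) (fun _ h => h) (fin r s)).
have [_ e2] := lenD BC (CA r.+1 s) (finlenS (fun _ h => h) (CA r.+1 s) (fin r.+1 s))
  (finlenS BC (fun _ h => h) (fin r.+1 s)).
have [_ e3] := len_image (A r s) (B r.+1 s) x.
by rewrite e1 e2 -e3 /ker_fam; lia.
Qed.

(** Induction on [l], where [K t1] annihilates [A/B]. Kernel and cokernel of [x t1] are annihilated
    by [x t1] as well, so [x] moves from [l] to [K]. When [l] is empty, [I t1] annihilates
    everything, and [fam_fg] leaves nothing in high first degree. One pair [k], [n0] serves all
    [s]. *)
Lemma hilbert_serre (l : seq R) (K : ideal R) A B : subquotient A B ->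
  (forall r s, finlen (B r s) (A r s)) ->
  {subset l <= I} -> {subset I <= idealD (idgen l) K} ->
  (forall r s, {subset idealM K (A r s) <= B r.+1 s}) ->
  exists k n0, forall s r, (n0 <= r)%N ->
    iter k dif (fun r => (len (B r s) (A r s))%:Z) r = 0.
Proof.
elim: l K A B => [|x l IH] K A B hAB fin lI IK KAB.
  have [stA _ BA AR] := hAB.
  have [n0 [h _]] := fam_fg noeth stA AR.
  exists 0%N, n0.+1 => s [//|r] le /=; suff -> : A r.+1 s = B r.+1 s by rewrite (lenn _).2.
  apply: ideal_anti => [w /(h r s le) hw|]; last exact: BA.
  apply: KAB; move: hw; apply: idealMS => // y /IK; apply: idealD_min => // z /idgen0P ->.
  exact: ideal0.
have xI : x \in I by apply: lI; exact: mem_head.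
have hker := ker_subquotient xI hAB; have hcoker := coker_subquotient xI hAB.
have [[_ _ BK _] [_ _ CA _]] := conj hker hcoker.
have [[AI AJ] [BI BJ] BA AR] := hAB.
have KA r s : {subset ker_fam x A B r s <= A r s} by move=> w /idealIP[].
have BC r s : {subset B r s <= coker_fam x A B r s}.
  by case: r => [|r] w //= h; exact: idealD_r.
pose K' := idealD (scale x idealT) K.
have lI' : {subset l <= I} by move=> y yl; apply: lI; rewrite inE yl orbT.
have IK' : {subset I <= idealD (idgen l) K'}.
  move=> y /IK; rewrite idgen_cons; move: y; apply: idealD_min.
    apply: idealD_min; last exact: idealD_l.
    by move=> y hy; apply/idealD_r/idealD_l.
  by move=> y hy; apply/idealD_r/idealD_r.
have [k1 [n1 h1]] : exists k n0, forall s r, (n0 <= r)%N ->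
    iter k dif (fun r => (len (B r s) (ker_fam x A B r s))%:Z) r = 0.
  apply: (IH K') => // [r s|r s].
    exact: finlenS (fun _ h => h) (KA r s) (fin r s).
  apply: idealM_sub => y w /idealDP[_ [z [/scaleP[u _ ->] zK ->]]].
  move=> /idealIP[/colonP hw wA]; rewrite mulrDl; apply: idealDm.
    by rewrite mulrAC; exact: ideal_mulr.
  by apply: KAB; exact: idealM_mem.
have [k2 [n2 h2]] : exists k n0, forall s r, (n0 <= r)%N ->
    iter k dif (fun r => (len (coker_fam x A B r s) (A r s))%:Z) r = 0.
  apply: (IH K') => // [r s|r s].
    exact: finlenS (@BC r s) (fun _ h => h) (fin r s).
  apply: idealM_sub => y w /idealDP[_ [z [/scaleP[u _ ->] zK ->]]] hw.
  rewrite mulrDl; apply: idealD_mem; last by apply: KAB; exact: idealM_mem.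
  by rewrite -mulrA; apply: mem_scale; exact: ideal_mull.
exists (maxn k1 k2).+1, (maxn n1 n2) => s r le; rewrite iterSr.
rewrite (@eq_iter_dif _ _ (fun r => (len (coker_fam x A B (r + 1)%N s) (A (r + 1)%N s))%:Z -
    (len (B r s) (ker_fam x A B r s))%:Z) 0%N) //; last first.
  move=> n _; have := len_ker_coker n s xI hAB fin.
  by rewrite /dif !addn1; lia.
rewrite iter_difB (iter_dif_shift _ (fun r => (len (coker_fam x A B r s) (A r s))%:Z)).
rewrite (iter_dif_le (leq_maxr k1 k2) (h2 s)); last by lia.
by rewrite (iter_dif_le (leq_maxl k1 k2) (h1 s)) ?subrr //; lia.
Qed.

End HilbertSerre.

(** * Colengths of the ideals [I^r J^s] *)

Section HilbertFunction.
Variables (R : comNzRingType) (m : ideal R).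
Hypotheses (noeth : noetherian_ring R) (loc : local_ring m).
Implicit Types (I J K L : ideal R) (a b x y : R).

(** Openness in the [m]-adic topology also holds for the unit ideal, so exponent 0 is no special
    case. *)
Definition open_ideal K := exists c, {subset idealX m c <= K}.

Lemma primary_open I : primary_to m I -> {subset I <= m} /\ open_ideal I.
Proof.
move=> [I1 _ hm]; split; first exact: proper_sub_m.
have [s hs] := noeth_fg noeth m; rewrite /open_ideal hs; apply: idgen_power_sub.
by move=> x xs; apply/hm; rewrite hs; exact: mem_idgen.
Qed.

Lemma open_fin K : open_ideal K -> finlen K idealT.
Proof. by move=> [c h]; apply: (finlen_powers noeth loc (n := c)); rewrite idealMT. Qed.

Lemma openX K n : open_ideal K -> open_ideal (idealX K n).
Proof. by move=> [c h]; exists (c * n)%N; rewrite -idealX_mul; exact: idealXSub. Qed.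

Lemma openM K L : open_ideal K -> open_ideal L -> open_ideal (idealM K L).
Proof.
move=> [c h] [d k]; exists (c + d)%N; rewrite idealXD; exact: idealMS.
Qed.

Lemma open_rees I J r s : open_ideal I -> open_ideal J -> open_ideal (rees_fam I J r s).
Proof. by move=> hI hJ; apply: openM; exact: openX. Qed.

Definition hilb I J r s := len (rees_fam I J r s) idealT.

Lemma rees_famC I J r s : rees_fam I J r s = rees_fam J I s r.
Proof. exact: idealMC. Qed.
Lemma hilbC I J r s : hilb I J r s = hilb J I s r.
Proof. by rewrite /hilb rees_famC. Qed.

Lemma rees_fam0 I J r : rees_fam I J r 0 = idealX I r.
Proof. exact: idealMT. Qed.
Lemma rees_fam0l I J s : rees_fam I J 0 s = idealX J s.
Proof. exact: idealM1. Qed.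

Hypothesis parameters : exists x y, [/\ x \in m, y \in m, regular_pair x y,
  regular_pair y x & finlen (pair_ideal x y) idealT].

Section Pair.
Variables I J : ideal R.
Hypotheses (Iopen : open_ideal I) (Jopen : open_ideal J).

(** For [n] a fixed multiple of [r + s], the power [m^n] lies in [I^r J^s], hence so does
    [(x^n, y^n)], whose colength is [n^2] times that of [(x, y)]. *)
Lemma hilb_growth : exists C, forall r s, (hilb I J r s <= C * (r + s) ^ 2)%N.
Proof.
have [x [y [xm ym hxy hyx fin]]] := parameters.
have [c hc] := Iopen; have [d hd] := Jopen.
exists (maxn c d ^ 2 * len (pair_ideal x y) idealT)%N => r s.
pose n := (maxn c d * (r + s))%N.
have [fn en] := len_pairX n n hxy hyx fin.
have sub : {subset pair_ideal (x ^+ n) (y ^+ n) <= rees_fam I J r s}.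
  have h : {subset idealX m n <= rees_fam I J r s}.
    move=> w; rewrite /n mulnDr idealXD; apply: idealMS => {}w hw.
      by apply: (idealXSub hc); rewrite idealX_mul; apply: idealX_leq hw; rewrite leq_mul2r leq_maxl orbT.
    by apply: (idealXSub hd); rewrite idealX_mul; apply: idealX_leq hw; rewrite leq_mul2r leq_maxr orbT.
  by apply: pair_ideal_sub; apply: h; exact: mem_idealX.
apply: leq_trans (lenS sub (fun _ h => h) (fun _ _ => mem_idealT _) fn) _.
by rewrite en /n; nia.
Qed.

(** The difference in [r] of the colength is the length of [I^r J^s/I^(r+1) J^s], to which
    [hilbert_serre] applies with [K = 0], written [scale 0 idealT]. The growth bound then lowers the
    order to three. *)
Lemma hilb_dif3 : {subset I <= m} -> exists n0, forall s r, (n0 <= r)%N ->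
  iter 3 dif (fun r => (hilb I J r s)%:Z) r = 0.
Proof.
move=> Im; pose B : fam R := fun r s => rees_fam I J r.+1 s.
have stA := rees_fam_stable I J.
have BA : fam_le B (rees_fam I J).
  by move=> r s w; apply: idealMS => // u; exact: idealM_r.
have fin r s : finlen (B r s) idealT by apply/open_fin/open_rees.
have [gI hgI] := noeth_fg noeth I.
have [|||||k [n0 h]] := @hilbert_serre R noeth I J gI (scale 0 idealT) (rees_fam I J) B.
- split; [exact: stA| |exact: BA|by move=> r s w].
  split=> r s c w hc hw; first exact: stA.1.
  exact: stA.2.
- by move=> r s; exact: finlenS (fin r s).
- by move=> x xs; rewrite hgI; exact: mem_idgen.
- by rewrite {1}hgI; exact: idealD_l.
- move=> r s; apply: idealM_sub => x y /scaleP[u _ ->] _.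
  by rewrite !mul0r ideal0.
have [C hC] := hilb_growth.
exists n0 => s; apply: (@quadratic_growth k.+1 _ n0 (C * (s.+1 ^ 2))%N%:Z).
  move=> n le; rewrite iterSr -[RHS](h s n le); apply: (@eq_iter_dif _ _ _ 0%N) => // p _.
  have [_ e] := lenD (BA p s) (fun _ _ => mem_idealT _)
    (finlenS (fun _ h => h) (fun _ _ => mem_idealT _) (fin p s))
    (finlenS (BA p s) (fun _ h => h) (fin p s)).
  by rewrite /B in e *; rewrite /dif /hilb e PoszD addrK.
move=> n; apply/andP; split=> //; rewrite lez_nat.
apply: leq_trans (hC n s) _; rewrite -mulnA leq_mul2l -expnMn leq_exp2r //.
by apply/orP; right; nia.
Qed.

(** The leading coefficient in [r] is the same for all [s]: if [m^d] lies in [J], then [I^r J^s]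
    lies between [I^(r + d s)] and [I^r], whose colengths differ by a function with vanishing second
    difference. *)
Lemma hilb_I : {subset I <= m} -> {subset J <= m} ->
  exists n0 (e : nat -> int), (forall n, (n0 <= n)%N ->
    (hilb I J n 0)%:Z = e 0 * 'C(n.+1, 2)%:Z - e 1 * n%:Z + e 2) /\
  forall s r, (n0 <= r)%N -> iter 2 dif (fun r => (hilb I J r s)%:Z) r = e 0.
Proof.
move=> Im Jm; have [n0 h] := hilb_dif3 Im; exists n0.
have [e [he he0]] := dif3_quadratic (h 0%N).
exists e; split=> // s r le.
have [e' [_ he0']] := dif3_quadratic (h s).
rewrite he0' //; apply/eqP; rewrite -subr_eq0; apply/eqP.
have [d hd] := Jopen.
pose c := (d * s)%N.
have fin r' s' : finlen (rees_fam I J r' s') idealT by apply/open_fin/open_rees.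
apply: (@iter_dif_squeeze 2 (fun r => (hilb I J r s)%:Z - (hilb I J r 0)%:Z)
   (fun r => (hilb I J (r + c)%N 0)%:Z - (hilb I J r 0)%:Z) (fun=> 0) _ n0) => //.
- by move=> n ln; rewrite iter_difB he0' // he0.
- move=> n ln; rewrite iter_difB (iter_dif_shift 2 (fun r => (hilb I J r 0)%:Z)).
  by rewrite !he0 ?subrr // (leq_trans ln) ?leq_addr.
- move=> n _; apply/andP; split.
    rewrite subr_ge0 lez_nat; apply: lenS => //.
    by apply: idealMS.
  rewrite lerD2r lez_nat; apply: lenS => //.
  rewrite rees_fam0 idealXD; apply: idealMS => // w hw.
  apply: (idealXSub hd); rewrite idealX_mul -/c; exact: (idealXSub Im).
Qed.

End Pair.

Theorem hilb_quadratic I J : open_ideal I -> open_ideal J ->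
  {subset I <= m} -> {subset J <= m} ->
  exists n0 (e f : nat -> int) (c d d' z : int),
  [/\ forall n, (n0 <= n)%N ->
        (hilb I J n 0)%:Z = e 0 * 'C(n.+1, 2)%:Z - e 1 * n%:Z + e 2,
      forall n, (n0 <= n)%N ->
        (hilb I J 0 n)%:Z = f 0 * 'C(n.+1, 2)%:Z - f 1 * n%:Z + f 2
    & forall r s, (n0 <= r)%N -> (n0 <= s)%N ->
        (hilb I J r s)%:Z = e 0 * 'C(r.+1, 2)%:Z + f 0 * 'C(s.+1, 2)%:Z
          + c * r%:Z * s%:Z - d * r%:Z - d' * s%:Z + z].
Proof.
move=> Io Jo Im Jm.
have [n1 [e [he he0]]] := hilb_I Io Jo Im Jm.
have [n2 [f [hf hf0]]] := hilb_I Jo Io Jm Im.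
pose n0 := maxn n1 n2.
have [n01 n02] : (n1 <= n0)%N /\ (n2 <= n0)%N by rewrite leq_maxl leq_maxr.
have [||c [d [d' [z h]]]] := @bidif_quadratic (fun r s => (hilb I J r s)%:Z) (e 0) (f 0) n0.
- by move=> r s hr hs; apply: he0; exact: leq_trans hr.
- move=> r s hr hs; rewrite -(hf0 r s); last exact: leq_trans hs.
  by apply: (@eq_iter_dif _ _ _ 0%N) => // p _; rewrite hilbC.
exists n0, e, f, c, d, d', z; split=> // n le.
  by apply: he; exact: leq_trans le.
by rewrite hilbC; apply: hf; exact: leq_trans le.
Qed.

End HilbertFunction.

(** * Hilbert coefficients and joint reductions *)

Section Coefficients.
Variables (R : comNzRingType).
Implicit Types (I J K : ideal R).

Lemma quadratic_unique n0 (e f : nat -> int) :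
  (forall n, (n0 <= n)%N -> e 0 * 'C(n.+1, 2)%:Z - e 1 * n%:Z + e 2 =
                            f 0 * 'C(n.+1, 2)%:Z - f 1 * n%:Z + f 2) ->
  [/\ e 0 = f 0, e 1 = f 1 & e 2 = f 2].
Proof.
move=> h; have h0 := h n0 (leqnn _); have h1 := h n0.+1 (leqnSn _).
have h2 := h n0.+2 (leqW (leqnSn _)).
rewrite (binS n0.+2 1) (binS n0.+1 1) !bin1 in h2; rewrite (binS n0.+1 1) !bin1 in h1.
have E0 : e 0 = f 0 by lia.
have E1 : e 1 = f 1 by rewrite E0 in h1 h0; lia.
by split=> //; rewrite E0 E1 in h0; lia.
Qed.

(** [hilbert_coef] is obtained by choice; uniqueness of the polynomial lets any valid expansion
    compute it. *)
Lemma hilbert_coef_eq K n0 (e : nat -> int) :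
  (forall n, finlen (idealX K n) idealT) ->
  (forall n, (n0 <= n)%N -> (len (idealX K n) idealT)%:Z =
     e 0 * 'C(n.+1, 2)%:Z - e 1 * n%:Z + e 2) ->
  hilbert_coef K 1 = e 1 /\ hilbert_coef K 2 = e 2.
Proof.
move=> fin he; have hK : hilbert_coefs K e.
  by exists n0 => n le; rewrite -he //; exact: colength_eqP.
have [n1 h1] : hilbert_coefs K (hilbert_coef K) := xgetPex (fun=> 0) (ex_intro _ e hK).
have [|? -> ->] := @quadratic_unique (maxn n0 n1) (hilbert_coef K) e; last by [].
move=> n; rewrite geq_max => /andP[le0 le1].
by rewrite (colength_eq_len (h1 _ le1)) he.
Qed.

Lemma biquadratic_sum (e : nat -> nat -> int) r s : (0 < r)%N -> (0 < s)%N ->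
  \sum_(i < 3) \sum_(j < 3 | (i + j <= 2)%N)
    (-1) ^+ (i + j) * e i j * 'C(r + i - 1, i)%:Z * 'C(s + j - 1, j)%:Z =
  e 2 0 * 'C(r.+1, 2)%:Z + e 0 2 * 'C(s.+1, 2)%:Z + e 1 1 * r%:Z * s%:Z
    - e 1 0 * r%:Z - e 0 1 * s%:Z + e 0 0.
Proof.
move=> r0 s0.
under eq_bigr => i _ do rewrite big_mkcond !big_ord_recl big_ord0 /=.
rewrite !big_ord_recl big_ord0 /=.
rewrite /bump /= !add1n !addn0 !addn1 !addn2 !subn1 /= !bin0 !bin1.
rewrite !expr0 !expr1 !sqrrN !expr1n.
by ring.
Qed.

(** Differences of the values at six bidegrees next to [(n0, n0)] recover the six coefficients. *)
Lemma biquadratic_unique n0 (e f : nat -> nat -> int) :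
  (forall r s, (n0 <= r)%N -> (n0 <= s)%N ->
    e 2 0 * 'C(r.+1, 2)%:Z + e 0 2 * 'C(s.+1, 2)%:Z + e 1 1 * r%:Z * s%:Z
    - e 1 0 * r%:Z - e 0 1 * s%:Z + e 0 0 =
    f 2 0 * 'C(r.+1, 2)%:Z + f 0 2 * 'C(s.+1, 2)%:Z + f 1 1 * r%:Z * s%:Z
    - f 1 0 * r%:Z - f 0 1 * s%:Z + f 0 0) ->
  [/\ e 1 0 = f 1 0, e 0 1 = f 0 1, e 0 0 = f 0 0 & e 1 1 = f 1 1].
Proof.
pose P (e : nat -> nat -> int) r s := e 2 0 * 'C(r.+1, 2)%:Z + e 0 2 * 'C(s.+1, 2)%:Z
  + e 1 1 * r%:Z * s%:Z - e 1 0 * r%:Z - e 0 1 * s%:Z + e 0 0.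
rewrite -/(P e _ _) -/(P f _ _) => h.
have {}h r s : (n0 <= r)%N -> (n0 <= s)%N -> P e r s = P f r s by exact: h.
have l0 := leqnn n0; have l1 := leqnSn n0; have l2 := leqW l1.
have c1 : 'C(n0.+2, 2)%:Z = 'C(n0.+1, 2)%:Z + n0%:Z + 1 by rewrite (binS n0.+1 1) bin1; lia.
have c2 : 'C(n0.+3, 2)%:Z = 'C(n0.+1, 2)%:Z + 2 * n0%:Z + 3.
  by rewrite (binS n0.+2 1) bin1 PoszD c1; lia.
have n1 : n0.+1%:Z = n0%:Z + 1 by lia.
have n2 : n0.+2%:Z = n0%:Z + 2 by lia.
have d20 g : P g n0.+2 n0 - 2 * P g n0.+1 n0 + P g n0 n0 = g 2 0.
  by rewrite /P c1 c2 n1 n2; ring.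
have d02 g : P g n0 n0.+2 - 2 * P g n0 n0.+1 + P g n0 n0 = g 0 2.
  by rewrite /P c1 c2 n1 n2; ring.
have d11 g : P g n0.+1 n0.+1 - P g n0.+1 n0 - P g n0 n0.+1 + P g n0 n0 = g 1 1.
  by rewrite /P c1 n1; ring.
have d10 g : g 2 0 * (n0%:Z + 1) + g 1 1 * n0%:Z - (P g n0.+1 n0 - P g n0 n0) = g 1 0.
  by rewrite /P c1 n1; ring.
have d01 g : g 0 2 * (n0%:Z + 1) + g 1 1 * n0%:Z - (P g n0 n0.+1 - P g n0 n0) = g 0 1.
  by rewrite /P c1 n1; ring.
have d00 g : P g n0 n0 - (g 2 0 * 'C(n0.+1, 2)%:Z + g 0 2 * 'C(n0.+1, 2)%:Z
  + g 1 1 * n0%:Z * n0%:Z - g 1 0 * n0%:Z - g 0 1 * n0%:Z) = g 0 0.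
  by rewrite /P; ring.
have E20 : e 2 0 = f 2 0 by rewrite -d20 -[RHS]d20 !h.
have E02 : e 0 2 = f 0 2 by rewrite -d02 -[RHS]d02 !h.
have E11 : e 1 1 = f 1 1 by rewrite -d11 -[RHS]d11 !h.
have E10 : e 1 0 = f 1 0 by rewrite -d10 -[RHS]d10 E20 E11 !h.
have E01 : e 0 1 = f 0 1 by rewrite -d01 -[RHS]d01 E02 E11 !h.
by split=> //; rewrite -d00 -[RHS]d00 E20 E02 E11 E10 E01 !h.
Qed.

Lemma bihilbert_coef_eq I J n0 (e : nat -> nat -> int) :
  (forall r s, finlen (rees_fam I J r s) idealT) ->
  (forall r s, (n0 <= r)%N -> (n0 <= s)%N -> (hilb I J r s)%:Z =
    e 2 0 * 'C(r.+1, 2)%:Z + e 0 2 * 'C(s.+1, 2)%:Z + e 1 1 * r%:Z * s%:Z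
    - e 1 0 * r%:Z - e 0 1 * s%:Z + e 0 0) ->
  bihilbert_coef I J 1 0 = e 1 0 /\ bihilbert_coef I J 0 1 = e 0 1.
Proof.
move=> fin he; have hK : bihilbert_coefs I J e.
  exists n0.+1 => r s hr hs.
  have r0 : (0 < r)%N by exact: leq_ltn_trans hr.
  have s0 : (0 < s)%N by exact: leq_ltn_trans hs.
  rewrite (biquadratic_sum e r0 s0) -(he _ _ (ltnW hr) (ltnW hs)).
  exact: (colength_eqP (fin r s)).
have [n1 h1] : bihilbert_coefs I J (bihilbert_coef I J) :=
  xgetPex (fun _ _ => 0) (ex_intro _ e hK).
have [|-> -> _ _] := @biquadratic_unique (maxn n0 n1).+1 (bihilbert_coef I J) e; last by [].
move=> r s hr hs.
have [hr0 hr1] : (n0 <= r)%N /\ (n1 <= r)%N by move: hr; rewrite gtn_max => /andP[/ltnW ? /ltnW].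
have [hs0 hs1] : (n0 <= s)%N /\ (n1 <= s)%N by move: hs; rewrite gtn_max => /andP[/ltnW ? /ltnW].
have r0 : (0 < r)%N by exact: leq_ltn_trans hr.
have s0 : (0 < s)%N by exact: leq_ltn_trans hs.
have := colength_eq_len (h1 _ _ hr1 hs1).
by rewrite (biquadratic_sum _ r0 s0) -(he _ _ hr0 hs0) => ->.
Qed.

End Coefficients.

(** * Joint reductions and the defect of a pair *)

Section Pencils.
Variables (R : comNzRingType) (I J : ideal R) (a b : R).
Hypotheses (aI : a \in I) (bJ : b \in J).

Definition corner r s := idealD (scale (a ^+ r) (idealX J s)) (scale (b ^+ s) (idealX I r)).

Lemma corner_sub r s : {subset corner r s <= rees_fam I J r s}.
Proof.
apply: idealD_min => _ /scaleP[u hu ->].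
  by apply: idealM_mem => //; exact: mem_idealX.
by rewrite mulrC; apply: idealM_mem => //; exact: mem_idealX.
Qed.

(* Expand along the lattice paths from [(n0 + r, n0 + s)] down to the lines
   where one coordinate is [n0]. *)
Lemma pencil_iter n0 :
  (forall r s, (n0 <= r)%N -> (n0 <= s)%N -> {subset rees_fam I J r.+1 s.+1 <=
     idealD (scale a (rees_fam I J r s.+1)) (scale b (rees_fam I J r.+1 s))}) ->
  forall r s, {subset rees_fam I J (r + n0)%N (s + n0)%N <=
     idealD (scale (a ^+ r) (rees_fam I J n0 (s + n0)%N))
            (scale (b ^+ s) (rees_fam I J (r + n0)%N n0))}.
Proof.
move=> h; elim=> [s x hx|r IHr]; first by apply/idealD_l/scaleP; exists x; rewrite ?mul1r.
elim=> [x hx|s IHs]; first by apply/idealD_r/scaleP; exists x; rewrite ?mul1r.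
move=> x; rewrite !addSn => /h; rewrite !leq_addl => /(_ isT isT).
have [stI stJ] := rees_fam_stable I J.
move: x; apply: idealD_min => _ /scaleP[u hu ->].
  have /idealDP[_ [_ [/scaleP[v hv ->] /scaleP[w hw ->] ->]]] := IHr s.+1 u hu.
  have -> : a * (a ^+ r * v + b ^+ s.+1 * w) = a ^+ r.+1 * v + b ^+ s.+1 * (a * w).
    by rewrite [a ^+ r.+1]exprS; ring.
  by apply: idealD_mem; apply: mem_scale => //; exact: stI.
have /idealDP[_ [_ [/scaleP[v hv ->] /scaleP[w hw ->] ->]]] := IHs u hu.
have -> : b * (a ^+ r.+1 * v + b ^+ s * w) = a ^+ r.+1 * (b * v) + b ^+ s.+1 * w.
  by rewrite [b ^+ s.+1]exprS; ring.
by apply: idealD_mem; apply: mem_scale => //; exact: stJ.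
Qed.

Lemma eq_pencil_sub K L M : eq_pencil K a L b M ->
  {subset K <= idealD (scale a L) (scale b M)}.
Proof.
by move=> h x /h[u [v [uL vM ->]]]; apply: idealD_mem; exact: mem_scale.
Qed.

Lemma pencil_rees K L : eq_pencil (idealM I J) a J b I ->
  {subset rees_fam I J K.+1 L.+1 <=
     idealD (scale a (rees_fam I J K L.+1)) (scale b (rees_fam I J K.+1 L))}.
Proof.
move=> /eq_pencil_sub h; rewrite /rees_fam !idealXS idealMACA.
move=> x /(idealMS h (fun _ k => k)); rewrite idealMC idealMD !idealM_scale.
by rewrite -idealMA (idealMC _ J) [idealM _ I]idealMC [idealM I _]idealMA.
Qed.

Lemma rees_corner : eq_pencil (idealM I J) a J b I ->
  forall r s, {subset rees_fam I J r s <= corner r s}.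
Proof.
move=> h r s; have := @pencil_iter 0 (fun r s _ _ => pencil_rees h) r s.
by rewrite !addn0 rees_fam0 rees_fam0l.
Qed.

End Pencils.

Section JointReductionLengths.
Variables (R : comNzRingType) (m I J : ideal R).
Hypotheses (noeth : noetherian_ring R) (loc : local_ring m).
Hypotheses (Im : {subset I <= m}) (Jm : {subset J <= m}).
Hypotheses (Iopen : open_ideal m I) (Jopen : open_ideal m J).
Variables (x y : R).
Hypotheses (xm : x \in m) (ym : y \in m) (xy_reg : regular_pair x y).
Hypotheses (xy_open : open_ideal m (pair_ideal x y)).
Implicit Types (a b : R).

Let yx_reg : regular_pair y x.
Proof.
have [N hN] := xy_open; rewrite pair_idealC in hN.
exact: (parameter_regular noeth loc xm ym xy_reg xm hN).
Qed.

Lemma system_of_parameters : exists x y, [/\ x \in m, y \in m, regular_pair x y,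
  regular_pair y x & finlen (pair_ideal x y) idealT].
Proof. by exists x, y; split=> //; exact: open_fin xy_open. Qed.

Lemma joint_reduction_open a b : joint_reduction I J a b ->
  open_ideal m (pair_ideal a b).
Proof.
move=> [aI bJ [n0 h]]; have [c hc] := open_rees n0.+1 n0.+1 Iopen Jopen.
exists c => z /hc/(h n0 n0 (leqnn _) (leqnn _))[u [v [_ _ ->]]].
by apply/pair_idealP; exists u, v.
Qed.

Section Fixed.
Variables a b : R.
Hypotheses (aI : a \in I) (bJ : b \in J) (ab_open : open_ideal m (pair_ideal a b)).

Lemma open_regular : regular_pair a b /\ regular_pair b a.
Proof.
have [N hN] := ab_open; split; first exact: (parameter_regular noeth loc xm ym xy_reg (Jm bJ) hN).
by rewrite pair_idealC in hN; exact: (parameter_regular noeth loc xm ym xy_reg (Im aI) hN).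
Qed.

Lemma fin_rees r s : finlen (rees_fam I J r s) idealT.
Proof. exact/(open_fin noeth loc)/open_rees. Qed.

Definition lam := len (pair_ideal a b) idealT.
Definition defect r s := len (corner I J a b r s) (rees_fam I J r s).

Lemma fin_corner r s : finlen (corner I J a b r s) idealT.
Proof.
have [hab hba] := open_regular; have fin := open_fin noeth loc ab_open.
have [hab' hba'] := (regular_pairX r s hab, regular_pairX s r hba).
have [f _] := len_pairX r s hab hba fin.
have := @len_mixed _ _ _ (idealX I r) (idealX J s) hab' hba' _ _ f.
case=> //; try exact: mem_idealX.
  by rewrite -(rees_fam0 I J); exact: fin_rees.
by rewrite -(rees_fam0l I J); exact: fin_rees.
Qed.

(** [len_mixed] for [a^r], [b^s], [I^r], [J^s], with the colength of [I^r J^s] moved to the left so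
    that no truncated subtraction occurs. *)
Lemma defectE r s :
  (defect r s + hilb I J r s = r * s * lam + hilb I J r 0 + hilb I J 0 s)%N.
Proof.
have [hab hba] := open_regular; have fin := open_fin noeth loc ab_open.
have [hab' hba'] := (regular_pairX r s hab, regular_pairX s r hba).
have [f e] := len_pairX r s hab hba fin.
have [||||_ e'] := @len_mixed _ _ _ (idealX I r) (idealX J s) hab' hba' _ _ f.
- exact: mem_idealX.
- exact: mem_idealX.
- by rewrite -(rees_fam0 I J); exact: fin_rees.
- by rewrite -(rees_fam0l I J); exact: fin_rees.
have fc := fin_corner r s; have sc := corner_sub aI bJ (r := r) (s := s).
have [_ e2] := lenD sc (fun _ _ => mem_idealT _)
  (finlenS (fun _ h => h) (fun _ _ => mem_idealT _) fc) (fin_rees r s).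
rewrite /defect /hilb rees_fam0 rees_fam0l /lam -e -e'.
by rewrite -[LHS]e2.
Qed.

(** Expansion along lattice paths bounds the defect at [(r + n0, s + n0)] by the sum of those at
    [(n0, s + n0)] and [(r + n0, n0)]. By [defectE] each of these is at most linear, because
    [I^n0 J^n] lies in [J^n] and [I^n J^n0] in [I^n]. *)
Lemma defect_linear : joint_reduction I J a b -> exists n0 C,
  forall n, (n0 <= n)%N -> (defect n n <= C * n + C)%N.
Proof.
move=> [_ _ [n0 h]].
have hp := @pencil_iter R I J a b aI bJ n0 (fun r s hr hs => eq_pencil_sub (h r s hr hs)).
have bound r s : (defect (r + n0)%N (s + n0)%N <= defect n0 (s + n0) + defect (r + n0)%N n0)%N.
  set D := corner I J a b (r + n0)%N (s + n0).
  pose X := idealD (scale (a ^+ r) (rees_fam I J n0 (s + n0)%N)) D.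
  pose Y := idealD (scale (b ^+ s) (rees_fam I J (r + n0)%N n0)) X.
  have finS K L : finlen K idealT -> finlen K L by exact: finlenS.
  have fD K : finlen D K by apply: finS; exact: fin_corner.
  have DX : {subset D <= X} by exact: idealD_r.
  have XY : {subset X <= Y} by exact: idealD_r.
  have fX : finlen X Y by exact: finlenS DX (fun _ k => k) (fD Y).
  have [f e] := lenD DX XY (fD X) fX.
  have le : (defect (r + n0)%N (s + n0)%N <= len D Y)%N.
    apply: lenS => //; last exact: corner_sub.
    move=> z /hp; move: z; apply: idealD_min; last exact: idealD_l.
    by move=> z hz; apply/idealD_r/idealD_l.
  apply: leq_trans le _; rewrite e.
  (* Multiplication by [a^r] carries the corner at [(n0, s + n0)] into [D], so the defect there
     dominates the length of the image; the same holds for [b^s] on the other edge. *)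
  have [_ <-] := len_image (rees_fam I J n0 (s + n0)%N) D (a ^+ r).
  have [_ <-] := len_image (rees_fam I J (r + n0)%N n0) X (b ^+ s).
  apply: leq_add; apply: lenS => //.
  - move=> z hz; apply/idealIP; split; last exact: (corner_sub aI bJ hz).
    apply/colonP; move: hz => /idealDP[_ [_ [/scaleP[u hu ->] /scaleP[v hv ->] ->]]].
    rewrite mulrDr mulrA -exprD; apply: idealD_mem; first exact: mem_scale.
    rewrite mulrCA; apply: mem_scale; rewrite idealXD; apply: idealM_mem => //.
    exact: mem_idealX.
  - by move=> z /idealIP[].
  - by apply: finS; exact: fin_corner.
  - move=> z hz; apply/idealIP; split; last exact: (corner_sub aI bJ hz).
    apply/colonP; move: hz => /idealDP[_ [_ [/scaleP[u hu ->] /scaleP[v hv ->] ->]]].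
    apply: idealD_r; rewrite mulrDr [X in _ + X]mulrA -exprD; apply: idealD_mem; last exact: mem_scale.
    rewrite mulrCA; apply: mem_scale; rewrite idealXD; apply: idealM_mem => //.
    exact: mem_idealX.
  - by move=> z /idealIP[].
  - by apply: finS; exact: fin_corner.
have mono s : (hilb I J 0 s <= hilb I J n0 s)%N /\ (hilb I J s 0 <= hilb I J s n0)%N.
  split; apply: lenS => //; try exact: fin_rees.
    by rewrite rees_fam0l; exact: idealM_r.
  by rewrite rees_fam0; exact: idealM_l.
exists n0, (2 * n0 * lam + hilb I J n0 0 + hilb I J 0 n0)%N => n le.
have := bound (n - n0)%N (n - n0)%N; rewrite subnK // => {}bound.
have e1 := defectE n0 n; have e2 := defectE n n0; have [m1 _] := mono n; have [_ m2] := mono n.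
by nia.
Qed.

End Fixed.

Definition hilbert_conditions :=
  [/\ bihilbert_coef I J 1 0 = hilbert_coef I 1,
      bihilbert_coef I J 0 1 = hilbert_coef J 1
    & hilbert_coef (idealM I J) 2 = hilbert_coef I 2 + hilbert_coef J 2].

(* The defect is a polynomial in [n = r = s] for large [n], whose coefficients
   measure the failure of the three conditions. *)
Lemma hilbert_conditionsP : exists n0 (e f : nat -> int) (c d d' z : int),
  [/\ (forall n, (n0 <= n)%N ->
        (hilb I J n 0)%:Z = e 0 * 'C(n.+1, 2)%:Z - e 1 * n%:Z + e 2),
      (forall n, (n0 <= n)%N ->
        (hilb I J 0 n)%:Z = f 0 * 'C(n.+1, 2)%:Z - f 1 * n%:Z + f 2),
      (forall r s, (n0 <= r)%N -> (n0 <= s)%N ->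
        (hilb I J r s)%:Z = e 0 * 'C(r.+1, 2)%:Z + f 0 * 'C(s.+1, 2)%:Z
          + c * r%:Z * s%:Z - d * r%:Z - d' * s%:Z + z)
    & hilbert_conditions <-> [/\ d = e 1, d' = f 1 & z = e 2 + f 2]].
Proof.
have [n0 [e [f [c [d [d' [z [he hf h]]]]]]]] :=
  hilb_quadratic noeth loc system_of_parameters Iopen Jopen Im Jm.
exists n0, e, f, c, d, d', z; split=> //; rewrite /hilbert_conditions.
have [||-> ->] := @hilbert_coef_eq R I n0 e.
- by move=> n; rewrite -(rees_fam0 I J); exact: fin_rees.
- by move=> n /he; rewrite /hilb rees_fam0.
have [||-> ->] := @hilbert_coef_eq R J n0 f.
- by move=> n; rewrite -(rees_fam0l I J); exact: fin_rees.
- by move=> n /hf; rewrite /hilb rees_fam0l.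
(* On the diagonal [n^2 = 2 C(n+1, 2) - n], so the mixed coefficient [c] enters [e_0(IJ)] and
   [e_1(IJ)], while [e_2(IJ)] is the constant term [z]. *)
pose g n := if n == 0%N then e 0 + f 0 + 2 * c else if n == 1%N then c + d + d' else z.
have [||_ ->] := @hilbert_coef_eq R (idealM I J) n0 g.
- by move=> n; rewrite idealXMn; exact: fin_rees.
- move=> n le; rewrite idealXMn -/(rees_fam I J n n) -/(hilb I J n n) h // /g /=.
  have sq : n%:Z * n%:Z = 2 * 'C(n.+1, 2)%:Z - n%:Z.
    by rewrite bin2 /=; have := odd_double_half (n.+1 * n); rewrite oddM /= andNb; nia.
  by rewrite -[c * n%:Z * n%:Z]mulrA sq; ring.
pose B i j := match i, j with
  | 2, 0 => e 0 | 0, 2 => f 0 | 1, 1 => c | 1, 0 => d | 0, 1 => d' | _, _ => z end.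
have [||-> ->] := @bihilbert_coef_eq R I J n0 B.
- exact: fin_rees.
- by move=> r s hr hs; rewrite h.
by [].
Qed.

End JointReductionLengths.

(** * Generic elements *)

Section Generic.
Variable R : comNzRingType.
Implicit Types (I J K V : ideal R).

Definition generic I (P : R -> Prop) := exists n (V : nat -> ideal R),
  (forall i, (i < n)%N -> ~ {subset I <= V i}) /\
  forall a, a \in I -> (forall i, (i < n)%N -> a \notin V i) -> P a.

Lemma generic_and I P Q : generic I P -> generic I Q -> generic I (fun a => P a /\ Q a).
Proof.
move=> [n [V [hV hP]]] [p [W [hW hQ]]].
exists (n + p)%N, (fun i => if (i < n)%N then V i else W (i - n)%N).
split=> [i lt|a aI ha].
  by case: ltnP => h; [exact: hV | apply: hW; rewrite ltn_subLR].
split.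
  by apply: hP => // i lt; have := ha i (ltn_addr _ lt); rewrite lt.
apply: hQ => // i lt; have := ha (n + i)%N; rewrite ltn_add2l lt [(n + i < n)%N]ltnNge leq_addr addKn.
exact.
Qed.

Variable m : ideal R.
Hypotheses (noeth : noetherian_ring R) (loc : local_ring m).
Hypothesis inf : infinite_set [set: quot_ring m].

Lemma distinct_residues n : exists c : 'I_n -> R,
  forall i j, i != j -> c i - c j \notin m.
Proof.
have [B _ hB] := infinite_set_fset n inf.
exists (fun i => repr ((nth 0 (enum_fset B) i) : quot_mod m) : R) => i j nij.
apply/negP => /qmod_piP; rewrite !qmod_repr => /eqP.
by rewrite nth_uniq ?fset_uniq ?(leq_trans (ltn_ord _) hB) // => /eqP/val_inj/eqP; apply/negP.
Qed.

(** The infinite residue field takes the place of prime avoidance, as for subspaces of a vector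
    space. With [a] outside the first [n] ideals and [c] outside the last, two of the [n + 1] points
    [c + l j a] would lie in a common [V i]; their difference is a unit times [a]. *)
Lemma generic_ex I P : generic I P -> exists2 a : R, a \in I & P a.
Proof.
move=> [n [V [hV hP]]].
suff [a aI ha] : exists2 a, a \in I & forall i, (i < n)%N -> a \notin V i.
  by exists a => //; exact: hP.
elim: n hV {hP} => [_|n IH hV]; first by exists 0; rewrite ?ideal0.
have [a aI ha] := IH (fun i lt => hV i (ltnW lt)).
case: (boolP (a \in V n)) => aV; last first.
  by exists a => // i; rewrite ltnS leq_eqVlt => /orP[/eqP->//|]; exact: ha.
have [c cI cV] : exists2 c, c \in I & c \notin V n.
  apply: contrapT => h; apply: (hV n (ltnSn n)) => x xI.
  by apply: contrapT => /negP xV; apply: h; exists x.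
have [l hl] := distinct_residues n.+1.
apply: contrapT => hno.
have bad (j : 'I_n.+1) : exists i : 'I_n, c + l j * a \in V i.
  apply: contrapT => h; apply: hno; exists (c + l j * a).
    by apply: idealDm => //; exact: ideal_mull.
  move=> i; rewrite ltnS leq_eqVlt => /orP[/eqP->|lt].
    apply: contra cV => hc; have := idealBm hc (ideal_mull (l j) aV).
    by rewrite addrK.
  by apply/negP => hi; apply: h; exists (Ordinal lt).
have /choice[f hf] := bad.
have [inj|] := boolP (injectiveb f).
  have := leq_card f (injectiveP _ inj); by rewrite !card_ord ltnn.
move=> /injectivePn[j [k njk ejk]].
have hfk := hf k; rewrite -ejk in hfk.
have := idealBm (hf j) hfk.
have -> : c + l j * a - (c + l k * a) = (l j - l k) * a by ring.
move=> hV'; have [u hu] := unit_notin_m noeth loc (hl _ _ njk).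
have := ideal_mull u hV'; rewrite mulrA (mulrC u) hu mul1r.
by apply/negP; exact: ha.
Qed.

End Generic.

(** * Generic non-zero-divisors on torsion-free subquotients *)

Section Avoidance.
Variables (R : comNzRingType) (I J : ideal R).
Hypothesis noeth : noetherian_ring R.
Local Notation Rees := (rees_fam I J).
Implicit Types (A B N : fam R).

(** Torsion is meant with respect to powers of [IJ t1 t2]. Its absence prevents the annihilator of a
    nonzero element from containing all of [I t1]. *)
Definition torsionfree A B := forall r s w, w \in A r s ->
  (exists n, forall c, c \in Rees n n -> c * w \in B (n + r)%N (n + s)%N) -> w \in B r s.

Section MaximalAnnihilators.
Variables A B : fam R.
Hypotheses (hAB : subquotient I J A B) (tf : torsionfree A B).

Let stA : stable I J A. Proof. by case: hAB. Qed.
Let stB : stable I J B. Proof. by case: hAB. Qed.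
Let BA : fam_le B A. Proof. by case: hAB. Qed.
Let AR : fam_le A Rees. Proof. by case: hAB. Qed.

Definition ann r s w : fam R :=
  fun p q => idealI (Rees p q) (colon (B (p + r)%N (q + s)%N) w).

Lemma annP r s w p q c : c \in ann r s w p q <-> c \in Rees p q /\ c * w \in B (p + r)%N (q + s)%N.
Proof. by rewrite idealIP colonP mulrC. Qed.

Lemma ann_stable r s w : stable I J (ann r s w).
Proof.
have [RI RJ] := rees_fam_stable I J.
split=> p q x c hx /annP[hc hcw]; apply/annP; split; rewrite -?mulrA.
- exact: RI.
- by rewrite addSn; exact: stB.1.
- exact: RJ.
- by rewrite addSn; exact: stB.2.
Qed.

Lemma ann_le r s w : fam_le (ann r s w) Rees.
Proof. by move=> p q c /annP[]. Qed.

Definition maximal_ann r s w :=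
  [/\ w \in A r s, w \notin B r s &
      forall r' s' w', w' \in A r' s' -> w' \notin B r' s' ->
        fam_le (ann r s w) (ann r' s' w') -> fam_le (ann r' s' w') (ann r s w)].

Lemma maximal_ann_ex r s w : w \in A r s -> w \notin B r s ->
  exists r' s' w', maximal_ann r' s' w' /\ fam_le (ann r s w) (ann r' s' w').
Proof.
move=> wA wB.
pose P N := fam_le (ann r s w) N /\
  exists r' s' w', [/\ w' \in A r' s', w' \notin B r' s' & N = ann r' s' w'].
have [||N [le [r' [s' [w' [wA' wB' eN]]]]] hmax] := @fam_max R noeth I J P.
- by move=> _ [_ [r' [s' [w' [_ _ ->]]]]]; split; [exact: ann_stable | exact: ann_le].
- exists (ann r s w); split; first by move=> ? ? ?.
  by exists r, s, w.
rewrite {}eN in le hmax; exists r', s', w'; split=> //; split=> // r2 s2 w2 wA2 wB2 le2.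
apply: hmax => //; split; first by move=> p q c /le/le2.
by exists r2, s2, w2.
Qed.

(** If [d] does not kill [w], the annihilator of [d w] contains that of [w], hence equals it by
    maximality, and it contains [c]. *)
Lemma maximal_ann_prime r s w p q p' q' c d : maximal_ann r s w ->
  c \in Rees p q -> d \in Rees p' q' -> c * d \in ann r s w (p + p')%N (q + q')%N ->
  c \in ann r s w p q \/ d \in ann r s w p' q'.
Proof.
move=> [wA wB hmax] hc hd /annP[_]; rewrite -!addnA -mulrA => cdw.
case: (boolP (d * w \in B (p' + r)%N (q' + s)%N)) => dwB; [right|left].
  exact/annP.
have le : fam_le (ann (p' + r)%N (q' + s)%N (d * w)) (ann r s w); last first.
  by apply: le; apply/annP.
apply: (hmax _ _ (d * w)) => //.
- exact: stable_mul stA hd wA.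
- move=> i j e /annP[he hew]; apply/annP; split=> //.
  by rewrite mulrCA !(addnCA _ p') !(addnCA _ q'); exact: stable_mul stB hd hew.
Qed.

(** A generator contributes only in bidegrees above its own; the test keeps truncated subtraction
    from adding it elsewhere. *)
Definition span_step (t : nat * nat * R) (N : fam R) : fam R := fun r s =>
  if (t.1.1 <= r)%N && (t.1.2 <= s)%N
  then idealD (scale t.2 (Rees (r - t.1.1)%N (s - t.1.2)%N)) (N r s) else N r s.
Definition span (l : seq (nat * nat * R)) : fam R := foldr span_step B l.

Lemma span_stable l : stable I J (span l).
Proof.
have [RI RJ] := rees_fam_stable I J.
elim: l => [|[[r0 s0] w0] l [IHI IHJ]] //=; rewrite /span_step /=; split=> r s x w hx.
  case: (leqP s0 s) => hs; rewrite ?andbF ?andbT; last exact: IHI.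
  case: (leqP r0 r) => hr; last first.
    case: leqP => hr1 /(IHI _ _ _ _ hx) //; exact: idealD_r.
  rewrite leqW // => /idealDP[_ [v [/scaleP[u hu ->] hv ->]]].
  rewrite mulrDr mulrCA subSn //; apply: idealD_mem; last exact: IHI.
  by apply: mem_scale; exact: RI.
case: (leqP r0 r) => hr /=; last exact: IHJ.
case: (leqP s0 s) => hs; last first.
  case: leqP => hr1 /(IHJ _ _ _ _ hx) //; exact: idealD_r.
rewrite leqW // => /idealDP[_ [v [/scaleP[u hu ->] hv ->]]].
rewrite mulrDr mulrCA subSn //; apply: idealD_mem; last exact: IHJ.
by apply: mem_scale; exact: RJ.
Qed.

Lemma span_sub l : (forall t, t \in l -> t.2 \in A t.1.1 t.1.2) -> fam_le (span l) A.
Proof.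
elim: l => [_|[[r0 s0] w0] l IH hl] //= r s w; rewrite /span_step /=.
have {}IH := IH (fun t tl => hl t (@mem_behead _ (_ :: l) _ tl)).
have := hl _ (mem_head _ _) => /= hw0.
case: ifP => [/andP[hr hs]|_]; last exact: IH.
move=> /idealDP[_ [v [/scaleP[u hu ->] /IH hv ->]]]; apply: idealDm => //.
by have := stable_mul stA hu hw0; rewrite !subnK // mulrC.
Qed.

Lemma span_kill l p q c r s w : c \in Rees p q ->
  (forall t, t \in l -> c * t.2 \in B (p + t.1.1)%N (q + t.1.2)%N) ->
  w \in span l r s -> c * w \in B (p + r)%N (q + s)%N.
Proof.
move=> hc; elim: l r s w => [|[[r0 s0] w0] l IH] r s w hl /=.
  exact: stable_mul stB hc.
have {}IH := IH r s _ (fun t tl => hl t (@mem_behead _ (_ :: l) _ tl)).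
rewrite /span_step /=; case: ifP => [/andP[hr hs]|_]; last exact: IH.
move=> /idealDP[_ [v [/scaleP[u hu ->] /IH hv ->]]]; rewrite mulrDr.
apply: idealDm => //; rewrite mulrA mulrC.
have := stable_mul stB hu (hl _ (mem_head _ _)) => /=.
by rewrite !(addnCA (_ - _)%N) !subnK.
Qed.

(* Kaplansky: finitely many maximal annihilators cover the zero divisors. *)
Theorem torsionfree_generic : generic I (fun a => forall r s w,
  w \in A r s -> a * w \in B r.+1 s -> w \in B r s).
Proof.
pose good (l : seq (nat * nat * R)) := forall t, t \in l -> maximal_ann t.1.1 t.1.2 t.2.
have goodA l : good l -> fam_le (span l) A.
  by move=> hl; apply: span_sub => t /hl[].
have [||_ [l hl ->] hmax] := @fam_max R noeth I J (fun N => exists2 l, good l & N = span l).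
- move=> _ [l hl ->]; split; first exact: span_stable.
  by move=> r s w /(goodA _ hl)/AR.
- by exists B, [::].
have hspan r s w : maximal_ann r s w -> w \in span l r s.
  move=> hw; have gl : good ((r, s, w) :: l).
    by move=> t; rewrite inE => /orP[/eqP->|/hl].
  apply: (hmax (span ((r, s, w) :: l))); first by exists ((r, s, w) :: l).
    move=> r' s' z hz /=; rewrite /span_step; case: ifP => // _; exact: idealD_r.
  have -> : span ((r, s, w) :: l) r s = idealD (scale w (Rees 0 0)) (span l r s).
    by rewrite /= /span_step /= !leqnn /= !subnn.
  apply: idealD_l; apply/scaleP; exists 1; last by rewrite mulr1.
  by rewrite /rees_fam idealM1.
pose t i := nth (0%N, 0%N, 0) l i.
(* The ideals to avoid are the annihilating conditions of the [t i] in bidegree [(1, 0)]. None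
   contains [I], since otherwise [IJ] would kill [t i] and torsion-freeness would put it in [B]. *)
exists (size l), (fun i => colon (B (t i).1.1.+1 (t i).1.2) (t i).2); split=> [i lt hI|a aI ha r s w wA awB].
  have [tA /negP tB _] := hl _ (mem_nth (0%N, 0%N, 0) lt); rewrite -/(t i) in tA tB.
  apply: tB; apply: (tf tA); exists 1%N => c; rewrite /rees_fam !idealX1 idealMC => hc.
  suff : {subset idealM J I <= colon (B (1 + (t i).1.1)%N (1 + (t i).1.2)%N) (t i).2}.
    by move=> /(_ _ hc)/colonP; rewrite mulrC.
  apply: idealM_sub => x y xJ /hI/colonP hy; apply/colonP.
  by rewrite mulrCA; exact: stB.2.
apply: contrapT => /negP wB.
have [r' [s' [w' [hw' le]]]] := maximal_ann_ex wA wB.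
have aR : a \in Rees 1 0 by rewrite rees_fam0 idealX1.
have aw' : a \in ann r' s' w' 1 0 by apply: le; apply/annP.
case: (pselect (exists i, (i < size l)%N /\
    fam_le (ann (t i).1.1 (t i).1.2 (t i).2) (ann r' s' w'))) => [[i [lt lei]]|hno].
  have [_ _ hm] := hl _ (mem_nth (0%N, 0%N, 0) lt); rewrite -/(t i) in hm.
  have [wA' wB' _] := hw'.
  have /annP[_] := hm _ _ _ wA' wB' lei _ _ _ aw'.
  by rewrite mulrC => /colonP hc; have /negP := ha _ lt.
(* Each [u] in [l] now has an annihilator outside [ann r' s' w']. By primality the product [c] stays
   outside, yet [c] kills the whole span, which contains [w']. *)
have : exists p q c, [/\ c \in Rees p q,
    forall u, u \in l -> c * u.2 \in B (p + u.1.1)%N (q + u.1.2)%N & c \notin ann r' s' w' p q].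
  have : forall u, u \in l -> ~ fam_le (ann u.1.1 u.1.2 u.2) (ann r' s' w').
    move=> u ul h; apply: hno; exists (index u l); rewrite index_mem; split=> //.
    by rewrite /t nth_index.
  elim: (l) => [_|u l' IH hl'].
    exists 0%N, 0%N, 1; split=> //; first by rewrite /rees_fam idealM1.
    by apply/negP => /annP[_]; rewrite mul1r; case: hw' => _ /negP.
  have [p [q [c [hc cl cw]]]] := IH (fun v vl => hl' v (@mem_behead _ (_ :: l') _ vl)).
  have [p' [q' [d [du dw]]]] : exists p' q' d, d \in ann u.1.1 u.1.2 u.2 p' q' /\
      d \notin ann r' s' w' p' q'.
    apply: contrapT => h; apply: (hl' u (mem_head _ _)) => p' q' d hd.
    by apply: contrapT => /negP hd'; apply: h; exists p', q', d.
  have [hd hdu] := (annP _ _ _ _ _ _).1 du.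
  exists (p + p')%N, (q + q')%N, (c * d); split.
  - exact: stable_mul (rees_fam_stable I J) hc hd.
  - move=> v; rewrite inE => /orP[/eqP->|/cl hv].
      by rewrite -!addnA -mulrA; exact: stable_mul stB hc hdu.
    by rewrite (addnC p) (addnC q) -!addnA (mulrC c) -mulrA; exact: stable_mul stB hd hv.
  - by apply/negP => /(maximal_ann_prime hw' hc hd)[]; apply/negP.
move=> [p [q [c [hc cl /negP[]]]]]; apply/annP; split=> //.
exact: span_kill hc cl (hspan _ _ _ hw').
Qed.

End MaximalAnnihilators.

End Avoidance.

(** * Torsion in high bidegrees and filter-regular elements *)

Section Torsion.
Variables (R : comNzRingType) (I J : ideal R).
Hypothesis noeth : noetherian_ring R.
Local Notation Rees := (rees_fam I J).
Variables A B : fam R.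
Hypothesis hAB : subquotient I J A B.

Let stA : stable I J A. Proof. by case: hAB. Qed.
Let stB : stable I J B. Proof. by case: hAB. Qed.
Let BA : fam_le B A. Proof. by case: hAB. Qed.
Let AR : fam_le A Rees. Proof. by case: hAB. Qed.

Let kills n r s w := forall c, c \in Rees n n -> c * w \in B (n + r)%N (n + s)%N.

Let kills_le n p r s w : (n <= p)%N -> kills n r s w -> kills p r s w.
Proof.
move=> /subnK <- h c; rewrite /rees_fam !idealXD -idealMACA => hc.
suff : {subset idealM (Rees (p - n)%N (p - n)%N) (Rees n n) <=
        colon (B (p - n + n + r)%N (p - n + n + s)%N) w}.
  by move=> /(_ _ hc)/colonP; rewrite mulrC.
apply: idealM_sub => x y hx /h hy; apply/colonP.
by rewrite mulrC -mulrA -!addnA; exact: stable_mul stB hx hy.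
Qed.

Fact torsion_axiom r s : ideal_axiom (fun w => w \in A r s /\ exists n, kills n r s w).
Proof.
split=> [|x y [xA [n hn]] [yA [p hp]]|c x [xA [n hn]]].
- by split; [exact: ideal0 | exists 0%N => c _; rewrite mulr0 ideal0].
- split; first exact: idealDm.
  exists (maxn n p) => c hc; rewrite mulrDr; apply: idealDm.
    exact: (kills_le (leq_maxl n p) hn).
  exact: (kills_le (leq_maxr n p) hp).
- split; first exact: ideal_mull.
  by exists n => d hd; rewrite mulrCA; apply: ideal_mull; exact: hn.
Qed.
Definition torsion : fam R := fun r s => mkid (torsion_axiom r s).

Lemma torsionP r s w : w \in torsion r s <-> w \in A r s /\ exists n, kills n r s w.
Proof. exact: mkidP. Qed.

Lemma torsion_subquotient : subquotient I J A torsion.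
Proof.
split=> //; last 1 first.
- by move=> r s w /torsionP[].
split=> r s x w hx /torsionP[wA [n hn]]; apply/torsionP; split.
- exact: stA.1.
- by exists n => c hc; rewrite mulrCA addnS; apply: stB.1 => //; exact: hn.
- exact: stA.2.
- by exists n => c hc; rewrite mulrCA addnS; apply: stB.2 => //; exact: hn.
Qed.

Lemma torsion_uniform r s (K : ideal R) : {subset K <= torsion r s} ->
  exists n, forall w, w \in K -> kills n r s w.
Proof.
have [l ->] := noeth_fg noeth K => hK.
have [n hn] : exists n, forall w, w \in l -> kills n r s w.
  have : forall w, w \in l -> exists n, kills n r s w.
    by move=> w /mem_idgen/hK/torsionP[].
  elim: l {hK} => [_|a l IH h]; first by exists 0%N.
  have [n hn] := IH (fun x xs => h x (@mem_behead _ (a :: l) _ xs)).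
  have [p hp] := h a (mem_head _ _).
  exists (maxn n p) => x; rewrite inE => /orP[/eqP->|/hn hx].
    exact: (kills_le (leq_maxr n p) hp).
  exact: (kills_le (leq_maxl n p) hx).
exists n => w hw c hc.
suff : {subset idgen l <= colon (B (n + r)%N (n + s)%N) c} by move=> /(_ _ hw)/colonP.
by apply: idgen_sub => x /hn h; apply/colonP; exact: h.
Qed.

(** If [I^n J^n w] is torsion, finite generation yields one exponent [p] that kills all of it, and
    then [p + n] kills [w]. *)
Lemma torsion_tf : torsionfree I J A torsion.
Proof.
move=> r s w wA [n hn]; apply/torsionP; split=> //.
have [|p hp] := @torsion_uniform (n + r)%N (n + s)%N (scale w (Rees n n)).
  by move=> _ /scaleP[c hc ->]; rewrite mulrC; exact: hn.
exists (p + n)%N => c; rewrite /rees_fam !idealXD -idealMACA => hc.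
suff : {subset idealM (Rees p p) (Rees n n) <= colon (B (p + n + r)%N (p + n + s)%N) w}.
  by move=> /(_ _ hc)/colonP; rewrite mulrC.
apply: idealM_sub => x y hx hy; apply/colonP.
rewrite mulrCA -!addnA; apply: hp => //; exact: mem_scale.
Qed.

(** High torsion components are multiples of the one at [(n0, n0)], which a single [I^n J^n] kills;
    when both degrees are at least [n + n0], the multiplier contains that factor. *)
Lemma torsion_eventually : exists n0, forall r s, (n0 <= r)%N -> (n0 <= s)%N ->
  {subset torsion r s <= B r s}.
Proof.
have [_ stT TA _] := torsion_subquotient.
have [n0 [hI hJ]] := fam_fg noeth stT (fun r s w hw => AR (TA r s w hw)).
have [n hn] := @torsion_uniform n0 n0 _ (fun _ h => h).
have gen r s : {subset torsion (r + n0)%N (s + n0)%N <= idealM (Rees r s) (torsion n0 n0)}.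
  elim: r => [|r IH]; last first.
    move=> w; rewrite addSn => /(hI _ _ (leq_addl _ _)).
    move=> /(idealMS (fun _ h => h) IH).
    by rewrite /rees_fam idealXS !idealMA.
  elim: s => [|s IH] w; first by rewrite /rees_fam !idealM1.
  rewrite addSn => /(hJ _ _ (leq_addl _ _)) /(idealMS (fun _ h => h) IH).
  by rewrite /rees_fam idealXS !idealM1 idealMA.
exists (n + n0)%N => r s hr hs w.
have er : r = (r - n0 + n0)%N by lia.
have es : s = (s - n0 + n0)%N by lia.
rewrite er es => /gen; move: w; apply: idealM_sub => x y hx hy.
have : x \in idealM (Rees (r - n0 - n)%N (s - n0 - n)%N) (Rees n n).
  by rewrite /rees_fam idealMACA -!idealXD !subnK //; lia.
move=> hx'; suff : {subset idealM (Rees (r - n0 - n)%N (s - n0 - n)%N) (Rees n n) <=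
  colon (B (r - n0 + n0)%N (s - n0 + n0)%N) y} by move=> /(_ _ hx')/colonP; rewrite mulrC.
apply: idealM_sub => u v hu hv; apply/colonP; rewrite mulrC -mulrA.
have := stable_mul stB hu (hn _ hy _ hv).
by rewrite !addnA !subnK //; lia.
Qed.

Theorem eventually_generic : exists n0, generic I (fun a => forall r s w,
  (n0 <= r)%N -> (n0 <= s)%N -> w \in A r s -> a * w \in B r.+1 s -> w \in B r s).
Proof.
have [n0 h0] := torsion_eventually; exists n0.
have [_ _ TA _] := torsion_subquotient.
have [n [V [hV h]]] := torsionfree_generic noeth torsion_subquotient torsion_tf.
exists n, V; split=> // a aI ha r s w hr hs wA hw; apply: h0 => //.
apply: (h a aI ha) => //; apply/torsionP; split; first exact: stA.1.
exists 0%N => c _; exact: ideal_mull.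
Qed.

End Torsion.

Lemma stable_swap (R : comNzRingType) (I J : ideal R) N :
  stable I J N -> stable J I (fun r s => N s r).
Proof. by move=> [h k]; split=> r s; [exact: k | exact: h]. Qed.

Lemma subquotient_swap (R : comNzRingType) (I J : ideal R) (A B : fam R) :
  subquotient I J A B -> subquotient J I (fun r s => A s r) (fun r s => B s r).
Proof.
move=> [/stable_swap stA /stable_swap stB BA AR].
split=> // r s w.
by move=> hw; rewrite rees_famC; exact: (AR s r w hw).
Qed.

Lemma rees_famD (R : comNzRingType) (I J : ideal R) p q r s :
  idealM (rees_fam I J p q) (rees_fam I J r s) = rees_fam I J (p + r)%N (q + s)%N.
Proof. by rewrite /rees_fam idealMACA -!idealXD. Qed.

(** * Existence of joint reductions *)

Section JointReductionExistence.
Variables (R : comNzRingType) (m I J : ideal R).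
Hypotheses (noeth : noetherian_ring R) (loc : local_ring m).
Hypotheses (Im : {subset I <= m}) (Iopen : open_ideal m I) (Jopen : open_ideal m J).
Hypothesis inf : infinite_set [set: quot_ring m].
Variable C : nat.
Hypothesis growth : forall r s, (hilb I J r s <= C * (r + s) ^ 2)%N.

(* With [F = ⨁ I^r J^s / m I^r J^s], the Hilbert function of [F/(a, b)] is the
   mixed difference of that of [F]; were it positive everywhere, the Hilbert
   function of [R] would grow cubically. *)
Theorem generic_joint_reduction P Q : generic I P -> generic J Q ->
  exists a b, [/\ P a, Q b & joint_reduction I J a b].
Proof.
move=> gP gQ; pose A := rees_fam I J; pose B0 : fam R := fun r s => idealM m (A r s).
have [AI AJ] := rees_fam_stable I J.
have h0 : subquotient I J A B0.
  split; [exact: rees_fam_stable| |by move=> r s; exact: idealM_r|by move=> r s w].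
  split=> r s x w hx hw; rewrite /B0 /A.
    by rewrite /rees_fam idealXS -!idealMA idealMCA; exact: idealM_mem.
  by rewrite /rees_fam idealXS (idealMCA _ J) idealMCA; exact: idealM_mem.
have fin0 r s K : finlen (B0 r s) K.
  apply: (@finlenS _ (B0 r s) _ idealT) => //.
  by apply: (open_fin noeth loc); apply: openM; [exists 1%N; rewrite idealX1|exact: open_rees].
have [n1 g1] := eventually_generic noeth h0.
have [a aI [Pa ha]] := generic_ex noeth loc inf (generic_and gP g1).
pose B1 := @coker_fam R a A B0; have h1 : subquotient I J A B1 := coker_subquotient aI h0.
have B01 r s : {subset B0 r s <= B1 r s} by case: r => [|r] w //= h; exact: idealD_r.
have fin1 r s K : finlen (B1 r s) K by exact: finlenS (@B01 r s) (fun _ h => h) (fin0 r s K).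
(* Kernel, cokernel and genericity act on the first index, so the indices are exchanged before
   dividing by [b]. *)
pose A' : fam R := fun s r => A r s; pose B1' : fam R := fun s r => B1 r s.
have h1' : subquotient J I A' B1' by exact: subquotient_swap h1.
have [n2 g2] := eventually_generic noeth h1'.
have [b bJ [Qb hb]] := generic_ex noeth loc inf (generic_and gQ g2).
pose B2 := @coker_fam R b A' B1'.
have [_ _ B2A _] := coker_subquotient bJ h1'.
have B12 s r : {subset B1' s r <= B2 s r} by case: s => [|s] w //= h; exact: idealD_r.
have fin2 r s K : finlen (B2 s r) K by exact: finlenS (@B12 s r) (fun _ h => h) (fin1 r s K).
pose f r s := len (B0 r s) (A r s); pose g r s := len (B1 r s) (A r s).
pose h r s := len (B2 s r) (A r s).
pose n := maxn n1 n2.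
have fE r s : (n <= r)%N -> (n <= s)%N -> f r.+1 s = (f r s + g r.+1 s)%N.
  rewrite !geq_max => /andP[hr _] /andP[hs _].
  have := len_ker_coker r s aI h0 (fun r s => fin0 r s (A r s)).
  have -> : @ker_fam R a A B0 r s = B0 r s.
    apply: ideal_anti => w; first by move=> /idealIP[/colonP hw wA]; exact: ha.
    have [_ _ k _] := ker_subquotient aI h0; exact: k.
  by rewrite (lenn _).2 addn0.
have gE r s : (n <= r)%N -> (n <= s)%N -> g r s.+1 = (g r s + h r s.+1)%N.
  rewrite !geq_max => /andP[_ hr] /andP[_ hs].
  have := len_ker_coker s r bJ h1' (fun s r => fin1 r s (A' s r)).
  have -> : @ker_fam R b A' B1' s r = B1' s r.
    apply: ideal_anti => w; first by move=> /idealIP[/colonP hw wA]; exact: hb.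
    have [_ _ k _] := ker_subquotient bJ h1'; exact: k.
  by rewrite (lenn _).2 addn0.
have fH r s : (f r s + hilb I J r s <= hilb I J r.+1 s)%N.
  have sub : {subset A r.+1 s <= B0 r s}.
    rewrite /A /rees_fam idealXS -idealMA; exact: idealMS.
  have sub' : {subset A r.+1 s <= A r s} by move=> w /sub; exact: idealM_r.
  have finA r' s' K : finlen (A r' s') K.
    apply: (@finlenS _ (A r' s') _ idealT) => //.
    by apply: (open_fin noeth loc); exact: open_rees.
  have [_ e] := lenD sub' (fun _ _ => mem_idealT _) (finA _ _ _) (finA _ _ _).
  rewrite /hilb e leq_add2r; apply: lenS => //; exact: idealM_r.
have [r [s [hr hs h_0]]] : exists r s, [/\ (n < r)%N, (n < s)%N & h r s = 0%N].
  apply: contrapT => hno.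
  have hpos r s : (n < r)%N -> (n < s)%N -> (0 < h r s)%N.
    by move=> hr hs; rewrite lt0n; apply/eqP => e; apply: hno; exists r, s.
  have g_ge r k : (n < r)%N -> (k <= g r (k + n))%N.
    move=> hr; elim: k => [//|k IH]; rewrite addSn (gE _ _ (ltnW hr) (leq_addl k n)).
    have hp : (0 < h r (k + n).+1)%N by apply: hpos => //; rewrite ltnS leq_addl.
    by rewrite -addn1 leq_add.
  have f_ge j k : (j * k <= f (j + n) (k + n))%N.
    elim: j => [//|j IH]; rewrite addSn (fE _ _ (leq_addl j n) (leq_addl k n)).
    by rewrite mulSn addnC leq_add //; apply: g_ge; rewrite ltnS leq_addl.
  have H_ge j k : (j * (j - 1) * k <= 2 * hilb I J (j + n) (k + n))%N.
    elim: j => [//|j IH]; rewrite addSn.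
    have := fH (j + n)%N (k + n)%N; have := f_ge j k; case: j IH => [//|j] IH.
    by rewrite !subn1 /= in IH *; nia.
  (* For [t >= n] the two bounds give [t^2 (t - 1) <= 2 C (2t + 2n)^2 <= 32 C t^2], which fails as
     soon as [t] exceeds [32 C + 1]. *)
  have [t nt Ct] : exists2 t, (n <= t)%N & (32 * C + 2 <= t)%N.
    by exists (n + (32 * C + 2))%N; rewrite ?leq_addr ?leq_addl.
  have t0 : (0 < t * t)%N by rewrite muln_gt0 andbb; lia.
  have h4 : ((t + n + (t + n)) ^ 2 <= 16 * (t * t))%N.
    have -> : (16 * (t * t) = (4 * t) ^ 2)%N by rewrite expnMn.
    by rewrite leq_exp2r //; lia.
  have h5 : ((t - 1) * (t * t) <= 32 * C * (t * t))%N.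
    have -> : ((t - 1) * (t * t) = t * (t - 1) * t)%N by rewrite mulnCA mulnA.
    apply: leq_trans (H_ge t t) _.
    have -> : (32 * C * (t * t) = 2 * (C * (16 * (t * t))))%N by lia.
    rewrite leq_mul2l /=; apply: leq_trans (growth _ _) _.
    by rewrite leq_mul2l h4 orbT.
  by move: h5; rewrite leq_pmul2r //; lia.
exists a, b; split=> //; split=> //.
(* [h r s = 0] says that this component is generated by multiples of [a] and [b] up to [m] times
   itself. Nakayama removes the last term, and multiplication by powers of [I] and [J] reaches all
   larger bidegrees. *)
have nak : {subset A r s <= idealD (scale a (A r.-1 s)) (scale b (A r s.-1))}.
  case: r hr h_0 => [//|r] hr h_0; case: s hs h_0 => [//|s] hs h_0 /=.
  apply: (nakayama noeth loc) => w hw.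
  have := len_eq0 (B2A s.+1 r.+1) (fin2 r.+1 s.+1 _) h_0 hw.
  move: w {hw}; apply: idealD_min.
    by move=> w hw; apply/idealD_r/idealD_r.
  apply: idealD_min; last exact: idealD_l.
  by move=> w hw; apply/idealD_r/idealD_l.
exists (maxn r s) => r' s'; rewrite !geq_max => /andP[hr1 hs1] /andP[hr2 hs2] x.
have r0 : (0 < r)%N := leq_ltn_trans (leq0n n) hr.
have s0 : (0 < s)%N := leq_ltn_trans (leq0n n) hs.
split=> [|[u [v [hu hv ->]]]]; last first.
  by apply: idealDm; [exact: AI | exact: AJ].
have -> : idealM (idealX I r'.+1) (idealX J s'.+1) =
    idealM (rees_fam I J (r'.+1 - r)%N (s'.+1 - s)%N) (A r s).
  by rewrite rees_famD !subnK // ltnW.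
move=> /(idealMS (fun _ k => k) nak); rewrite idealMD !idealM_scale.
rewrite !rees_famD.
have -> : (r'.+1 - r + r.-1 = r')%N by lia.
have -> : (s'.+1 - s + s.-1 = s')%N by lia.
rewrite (subnK (leqW hr1)) (subnK (leqW hs2)).
by move=> /idealDP[_ [_ [/scaleP[u hu ->] /scaleP[v hv ->] ->]]]; exists u, v.
Qed.

End JointReductionExistence.

(** * Positive depth of the associated graded ring *)

Section GradedDepth.
Variables (R : comNzRingType) (m I : ideal R).
Implicit Types (p q : rees I) (c w : R).

Lemma rees_monoP n w : w \in idealX I n -> w *: 'X^n \in rees_pred I.
Proof.
move=> hw; apply/asboolP => i; rewrite coefZ coefXn.
by case: eqP => [->|_]; rewrite ?mulr1 // mulr0 ideal0.
Qed.

Lemma coef_exp_lt (f : {poly R}) k j : f`_0 = 0 -> (j < k)%N -> (f ^+ k)`_j = 0.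
Proof.
move=> f0; elim: k j => [//|k IH] j lt; rewrite exprS coefM big1 // => -[[|i] ilt] _ /=.
  by rewrite f0 mul0r.
by rewrite IH ?mulr0 //; lia.
Qed.

Lemma qring_pi0P (S : comPzRingType) (K : ideal S) x : qring_pi K x = 0 <-> x \in K.
Proof.
have -> : 0 = qring_pi K 0 by rewrite /qring_pi /qmod_pi piE.
by rewrite qring_piP subr0.
Qed.

(* A power of the non-zero-divisor [z] has no component of degree [< k], so it
   annihilates any form [w] killed by [I^k]. *)
Lemma gr_depth_torsionfree : (forall x, x \in m -> exists n, x ^+ n \in I) ->
  gr_depth_ge m I 1 -> forall r w k, w \in idealX I r ->
  (forall c, c \in idealX I k -> c * w \in idealX I (k + r).+1) -> w \in idealX I r.+1.
Proof.
move=> rad [l [sz zm [hreg _]]] r w k wr hw.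
case: l sz zm hreg => [//|z [_|//]] zm hreg.
have znz v : z * v = 0 -> v = 0.
  by move=> e; apply/idgen0P; apply: (hreg 0%N isT v); rewrite /= e; apply/idgen0P.
have /asboolP[p p0 zE] := zm z (mem_head _ _).
have [N pN] := rad _ p0.
have q0 : (rees_val (p ^+ N))`_0 \in I.
  have -> : (rees_val (p ^+ N))`_0 = (rees_val p)`_0 ^+ N; last by [].
  elim: (N) => [|n IH]; first by rewrite coef1.
  by rewrite exprS coef0M IH exprS.
have cP : ((rees_val (p ^+ N))`_0)%:P \in rees_pred I.
  by apply/asboolP => -[|i]; rewrite coefC // ideal0.
(* The constant term of [p^N] lies in [I], so it is zero in [G(I)]: dropping it keeps the class
   [z^N] and makes [q^k] start in degree [k]. *)
pose q : rees I := p ^+ N - Rees cP.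
have qz : qring_pi (reesS I) q = z ^+ N.
  have -> : z ^+ N = qring_pi (reesS I) (p ^+ N).
    rewrite zE; elim: (N) => [//|n IH].
    by rewrite !exprS qring_piM IH.
  apply/qring_piP; have -> : q - p ^+ N = - Rees cP by rewrite /q addrAC subrr sub0r.
  apply: idealNm.
  apply/asboolP => i.
  have -> : (rees_val (Rees cP))`_i = if i == 0%N then (rees_val (p ^+ N))`_0 else 0.
    by rewrite /= coefC.
  by case: i => [|i]; [rewrite idealX1 | exact: ideal0].
have q00 : (rees_val q)`_0 = 0 by rewrite /= coefB coefC subrr.
pose W : rees I := Rees (rees_monoP wr).
suff : qring_pi (reesS I) W = 0.
  move=> /qring_pi0P/asboolP/(_ r).
  have -> : (rees_val W)`_r = w by rewrite /= coefZ coefXn eqxx mulr1.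
  exact.
have znzX n v : z ^+ n * v = 0 -> v = 0.
  by elim: n => [|n IH]; rewrite ?mul1r // exprS -mulrA => /znz.
apply: (znzX (N * k)%N).
have -> : z ^+ (N * k) * qring_pi (reesS I) W = qring_pi (reesS I) (q ^+ k * W).
  rewrite qring_piM exprM -qz; congr (_ * _).
  elim: (k) => [//|n IH]; by rewrite !exprS qring_piM IH.
apply/qring_pi0P/asboolP => n.
have -> : (rees_val (q ^+ k * W))`_n = (rees_val (q ^+ k) * (w *: 'X^r))`_n by [].
rewrite -scalerAr coefZ coefMXn; case: ltnP => [_|rn]; first by rewrite mulr0 ideal0.
have eqk : rees_val (q ^+ k) = rees_val q ^+ k.
  by elim: (k) => [//|n' IH]; rewrite !exprS /= -IH.
case: (ltnP (n - r)%N k) => [lt|kn].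
  by rewrite eqk coef_exp_lt // mulr0 ideal0.
have hq := rees_coef (q ^+ k) (n - r)%N.
have en : n.+1 = (n - r - k + (k + r).+1)%N by lia.
rewrite en idealXD mulrC.
have : {subset idealM (idealX I (n - r - k)) (idealX I k) <=
        colon (idealM (idealX I (n - r - k)) (idealX I (k + r).+1)) w}.
  by apply: idealM_sub => x y hx /hw hy; apply/colonP; rewrite mulrC -mulrA; exact: idealM_mem.
rewrite -idealXD subnK // => /(_ _ hq)/colonP; by rewrite mulrC.
Qed.

(** Taking [J] to be the unit ideal specializes the bigraded theory to one grading. The generic [a]
    then acts injectively from [I^r/I^(r+1)] to the next degree, and [w] climbs one power of [I] at
    a time. *)
Lemma gr_depth_generic : noetherian_ring R ->
  (forall x, x \in m -> exists n, x ^+ n \in I) -> gr_depth_ge m I 1 ->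
  generic I (fun a => forall n w, a * w \in idealX I n.+1 -> w \in idealX I n).
Proof.
move=> noeth rad hdepth.
have E r s : rees_fam I idealT r s = idealX I r by rewrite /rees_fam idealXT idealMT.
pose B : fam R := fun r s => rees_fam I idealT r.+1 s.
have [stI stJ] := rees_fam_stable I idealT.
have h : subquotient I idealT (rees_fam I idealT) B.
  split; [by []| | |by move=> r s w].
  - split=> r s x w hx hw; [exact: stI | exact: stJ].
  - by move=> r s w; rewrite /B !E; exact: idealM_r.
have tf : torsionfree I idealT (rees_fam I idealT) B.
  move=> r s w; rewrite /B !E => wr [k hk].
  apply: (gr_depth_torsionfree rad hdepth (k := k) wr) => c hc.
  by have := hk c; rewrite !E; apply.
have [n [V [hV hgen]]] := torsionfree_generic noeth h tf.
exists n, V; split=> // a aI ha p w hw.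
have {}hgen := hgen a aI ha.
suff H j : (j <= p)%N -> w \in idealX I j by exact: H.
elim: j => [//|j IH] lt; have wj := IH (ltnW lt).
have := hgen j 0%N w; rewrite /B !E; apply=> //.
by apply: idealX_leq hw.
Qed.

End GradedDepth.

(** * Local cohomology in degree (0, 0) *)

Section LocalCohomologyComponent.
Local Notation frac := Defs.frac.
Variables (R : comNzRingType) (I J : ideal R) (a b : R).
Hypotheses (aI : a \in I) (bJ : b \in J).
Local Notation x := (at1 J aI).
Local Notation y := (bt2 I bJ).

Lemma laurent_monoM (c : R) (k : int * int) (g : laurent2 R) (l : int * int) :
  ((<< c *g k >> : laurent2 R) * g)@_(k.1 + l.1, k.2 + l.2) = c * g@_l.
Proof.
rewrite laurM (laur_mulw msuppU_le (fsubset_refl _)) big_seq_fset1 raddf_sum /=.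
under eq_bigr => i _ do rewrite mcoeffUU mcoeffU.
have E (i : int * int) : ((k.1 + i.1, k.2 + i.2) == (k.1 + l.1, k.2 + l.2)) = (i == l).
  by rewrite -!pair_eqE /= !(inj_eq (addrI _)).
case: (boolP (l \in msupp g)) => hl.
  rewrite (big_fsetD1 l) //= E eqxx mulr1n big_seq_cond big1 ?addr0 // => i.
  by rewrite in_fsetD1 E => /andP[/andP[/negPf-> _] _].
rewrite (mcoeff_outdom hl) mulr0 big_seq_cond big1 // => i /andP[hi _].
by rewrite E; case: eqP => // ei; move: hl; rewrite -ei hi.
Qed.

Local Notation mono c r s := (<< c *g (r, s) >> : laurent2 R).

Lemma laurent_rect (c d e : R) (p n : int) :
  mono c p 0 * (mono d 0 p * mono e n n) = mono (c * (d * e)) (p + n) (p + n).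
Proof. by rewrite !laurM !laur_mulUU /= !add0r. Qed.

Lemma laurent_axes (c d u v : R) (n : int) :
  mono c n 0 * mono u 0 n + mono d 0 n * mono v n 0 = mono (c * u + d * v) n n.
Proof. by rewrite !laurM !laur_mulUU /= !add0r !addr0 monalgUD. Qed.

Lemma xrees_valX (f : xrees I J) n : xrees_val (f ^+ n) = xrees_val f ^+ n.
Proof. by elim: n => // n IH; rewrite !exprS -IH. Qed.

Lemma at1X n : xrees_val (x ^+ n) = << a ^+ n *g (n%:Z, 0) >>.
Proof.
rewrite xrees_valX; elim: n => [//|n IH]; rewrite exprS IH.
by rewrite laurM laur_mulUU /= -exprS addr0; congr (<< _ *g (_, _) >>); lia.
Qed.

Lemma bt2X n : xrees_val (y ^+ n) = << b ^+ n *g (0, n%:Z) >>.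
Proof.
rewrite xrees_valX; elim: n => [//|n IH]; rewrite exprS IH.
by rewrite laurM laur_mulUU /= -exprS addr0; congr (<< _ *g (_, _) >>); lia.
Qed.

Lemma idealXX_nat r s : idealXX I J r%:Z s%:Z = rees_fam I J r s.
Proof. by []. Qed.

Lemma xrees_coef (f : xrees I J) r s : (xrees_val f)@_(r, s) \in idealXX I J r s.
Proof. by have /asboolP := xrees_valP f. Qed.

Lemma coef_at1X n (f : xrees I J) (r s : int) :
  (xrees_val (x ^+ n * f))@_(n%:Z + r, s) = a ^+ n * (xrees_val f)@_(r, s).
Proof.
have -> : xrees_val (x ^+ n * f) = xrees_val (x ^+ n) * xrees_val f by [].
by rewrite at1X -[s in LHS]add0r (laurent_monoM _ (n%:Z, 0) _ (r, s)).
Qed.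

Lemma coef_bt2X n (f : xrees I J) (r s : int) :
  (xrees_val (y ^+ n * f))@_(r, n%:Z + s) = b ^+ n * (xrees_val f)@_(r, s).
Proof.
have -> : xrees_val (y ^+ n * f) = xrees_val (y ^+ n) * xrees_val f by [].
by rewrite bt2X -[r in LHS]add0r (laurent_monoM _ (0, n%:Z) _ (r, s)).
Qed.

Lemma qmod_pi0P (A : comPzRingType) (V : lmodType A) (N : submodClosed V) v :
  qmod_pi N v = 0 <-> v \in N.
Proof.
have -> : 0 = qmod_pi N 0 by rewrite /qmod_pi piE.
by rewrite qmod_piP subr0.
Qed.

Lemma loc_map_fracl (S : comPzRingType) (u v : S) s n :
  loc_map u (u * v) (frac v s n) = frac (u * v) (u ^+ n * s) n.
Proof. by apply: loc_mapE; rewrite mulrC. Qed.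

Lemma loc_map_fracr (S : comPzRingType) (u v : S) s n :
  loc_map v (u * v) (frac u s n) = frac (u * v) (v ^+ n * s) n.
Proof. exact: loc_mapE. Qed.

(* In degree (0,0) the Čech boundaries are the fractions
   [(a^N u + b^N v) / (ab)^N] with [u] in [J^N] and [v] in [I^N]. *)
Lemma boundary_coef n (f : xrees I J) : frac (x * y) f n \in cech_B2 x y ->
  exists N c d, [/\ c \in idealX J (N + n), d \in idealX I (N + n) &
    (a * b) ^+ N * (xrees_val f)@_(n%:Z, n%:Z) = a ^+ (N + n) * c + b ^+ (N + n) * d].
Proof.
move=> /asboolP[F [G]]; have [s [p ->]] := loc_surj F; have [t [q ->]] := loc_surj G.
rewrite /cech_d1 loc_map_fracl loc_map_fracr fracN fracD => /fracP[k].
set N := (k + (q + p))%N => e.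
have {}e : x ^+ N * (y ^+ N * f) =
    x ^+ (N + n) * (y ^+ (k + n + p) * t) + y ^+ (N + n) * - (x ^+ (k + n + q) * s).
  transitivity ((x * y) ^+ k * ((x * y) ^+ (q + p) * f)).
    by rewrite [RHS]mulrA -exprD -/N exprMn mulrA.
  by rewrite e /N !exprMn !exprD; ring.
(* In bidegree [(N + n, N + n)], [x^(N + n)] meets the part of its cofactor of bidegree
   [(0, N + n)], with coefficient in [J^(N + n)], and [y^(N + n)] the part of bidegree
   [(N + n, 0)]. *)
exists N, (xrees_val (y ^+ (k + n + p) * t))@_(0, (N + n)%N%:Z),
  (xrees_val (- (x ^+ (k + n + q) * s)))@_((N + n)%N%:Z, 0).
split.
- by have := xrees_coef (y ^+ (k + n + p) * t) 0 (N + n)%N%:Z; rewrite (idealXX_nat 0) rees_fam0l.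
- by have := xrees_coef (- (x ^+ (k + n + q) * s)) (N + n)%N%:Z 0; rewrite (idealXX_nat _ 0) rees_fam0.
have e0 := congr1 (fun g : xrees I J => (xrees_val g)@_((N + n)%N%:Z, (N + n)%N%:Z)) e.
set g := - _ in e0 *.
have e1 := coef_at1X (N + n) (y ^+ (k + n + p) * t) 0 (N + n)%N%:Z; rewrite addr0 in e1.
have e2 := coef_bt2X (N + n) g (N + n)%N%:Z 0; rewrite addr0 in e2.
have eL : (xrees_val (x ^+ N * (y ^+ N * f)))@_((N + n)%N%:Z, (N + n)%N%:Z) =
    (a * b) ^+ N * (xrees_val f)@_(n%:Z, n%:Z).
  by rewrite PoszD coef_at1X coef_bt2X exprMn mulrA.
have eD (u v : xrees I J) K : (xrees_val (u + v))@_K = (xrees_val u)@_K + (xrees_val v)@_K.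
  exact: mcoeffD.
exact: etrans (esym eL) (etrans e0 (etrans (eD _ _ _) (congr2 +%R e1 e2))).
Qed.

Lemma xrees_homogE r s (f : xrees I J) : xrees_homog r s f ->
  xrees_val f = << (xrees_val f)@_(r, s) *g (r, s) >>.
Proof.
move=> h; apply/malgP => k; rewrite mcoeffU; case: eqP => [<-|/eqP ne] //.
by rewrite mulr0n; apply: h; rewrite eq_sym.
Qed.

(** Expanding [f/(xy)^n] by [(xy)^n1] brings the coefficient of the numerator into
    [a^N J^N + b^N I^N] for [N = n1 + n]. The fraction then equals [U/y^N + V/x^N]. *)
Lemma corner_boundary n1 : (forall n, (n1 <= n)%N -> {subset rees_fam I J n n <= corner I J a b n n}) ->
  H2_comp x y 0 0 = [set 0]%classic.
Proof.
move=> hn1; apply/seteqP; split=> [h /= [n [f [hf ->]]]|h /= ->]; last first.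
  exists 0%N, 0; split; first by move=> k _ /=; rewrite mcoeff0.
  apply/esym/qmod_pi0P; have -> : frac (x * y) 0 0 = 0 by [].
  exact: rpred0.
apply/qmod_pi0P; rewrite !add0r in hf.
pose c := (xrees_val f)@_(n%:Z, n%:Z).
have cR : c \in rees_fam I J n n by rewrite -idealXX_nat; exact: xrees_coef.
pose N := (n1 + n)%N.
have : (a * b) ^+ n1 * c \in rees_fam I J N N.
  rewrite exprMn -rees_famD; apply: idealM_mem => //.
  by apply: idealM_mem; exact: mem_idealX.
move=> /(hn1 _ (leq_addr _ _)) hc.
have [u [v [uJ vI e]]] : exists u v : R, [/\ u \in idealX J N, v \in idealX I N
    & (a * b) ^+ n1 * c = a ^+ N * u + b ^+ N * v].
  by have /idealDP[_ [_ [/scaleP[u ? ->] /scaleP[v ? ->] e]]] := hc; exists u, v.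
have uJ' : u \in idealXX I J 0 N%:Z by rewrite (idealXX_nat 0) rees_fam0l.
have vI' : v \in idealXX I J N%:Z 0 by rewrite (idealXX_nat _ 0) rees_fam0.
pose U := xrees_mono uJ'; pose V := xrees_mono vI'.
have eUV : x ^+ n1 * (y ^+ n1 * f) = x ^+ N * U + y ^+ N * V.
  apply: val_inj.
  transitivity (xrees_val (x ^+ n1) * (xrees_val (y ^+ n1) * xrees_val f)); first by [].
  transitivity (xrees_val (x ^+ N) * xrees_val U + xrees_val (y ^+ N) * xrees_val V); last by [].
  rewrite (at1X n1) (bt2X n1) (at1X N) (bt2X N) (xrees_homogE hf) -/c.
  rewrite laurent_rect; apply: etrans (esym (laurent_axes _ _ _ _ _)).
  by rewrite -e exprMn mulrA.
(* The Čech differential is [g - f], hence the sign of [V]. *)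
apply/asboolP; exists (frac x (- V) N), (frac y U N).
rewrite /cech_d1 loc_map_fracl loc_map_fracr fracN fracD; apply/fracP; exists n1.
transitivity ((x * y) ^+ (N + N)%N * (x ^+ n1 * (y ^+ n1 * f))); first by rewrite !exprMn; ring.
have EN (z : xrees I J) : z ^+ (N + N)%N = z ^+ N * (z ^+ n1 * z ^+ n).
  by rewrite exprD {2}/N exprD.
by rewrite eUV !exprMn !EN; ring.
Qed.

(** Vanishing of the class of [c t1 t2/(xy)] means [(ab)^N c = a^(N+1) u + b^(N+1) v]. Regularity
    gives [u = b^N u'] and [v = a^N v'], the colon conditions put [u'] in [J] and [v'] in [I], and
    cancelling [(ab)^N] leaves [c = a u' + b v']. *)
Lemma boundary_corner : regular_pair a b -> regular_pair b a ->
  (forall n w, a * w \in idealX I n.+1 -> w \in idealX I n) ->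
  (forall n w, b * w \in idealX J n.+1 -> w \in idealX J n) ->
  H2_comp x y 0 0 = [set 0]%classic -> eq_pencil (idealM I J) a J b I.
Proof.
move=> hab hba supI supJ hH c; split=> [cIJ|[u [v [uJ vI ->]]]]; last first.
  apply: idealDm; first exact: idealM_mem.
  by rewrite mulrC; exact: idealM_mem.
have cR : c \in idealXX I J 1 1 by rewrite (idealXX_nat 1 1) /rees_fam !idealX1.
pose f := xrees_mono cR.
have : qmod_pi (cech_B2 x y) (frac (x * y) f 1) = 0.
  suff : H2_comp x y 0 0 (qmod_pi (cech_B2 x y) (frac (x * y) f 1)) by rewrite hH.
  exists 1%N, f; split=> // k; rewrite !add0r /= => ne.
  by rewrite mcoeffU eq_sym (negPf ne).
move=> /qmod_pi0P/boundary_coef[N [u [v [uJ vI]]]].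
have -> : (xrees_val f)@_(1%N%:Z, 1%N%:Z) = c by rewrite /= mcoeffUU.
rewrite addn1 in uJ vI * => e.
have supI' n w k : a ^+ k * w \in idealX I (k + n) -> w \in idealX I n.
  by elim: k => [|k IH]; rewrite ?mul1r // exprS -mulrA addSn => /supI/IH.
have supJ' n w k : b ^+ k * w \in idealX J (k + n) -> w \in idealX J n.
  by elim: k => [|k IH]; rewrite ?mul1r // exprS -mulrA addSn => /supJ/IH.
have [v' ev] : exists v', v = a ^+ N * v'.
  apply: ((regular_pairX N N.+1 hab).2 (b ^+ N * c - a * u)).
  by rewrite mulrBr mulrA -exprMn e [a ^+ N.+1]exprSr; ring.
have [u' eu] : exists u', u = b ^+ N * u'.
  apply: ((regular_pairX N N.+1 hba).2 (a ^+ N * c - b * v)).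
  by rewrite mulrBr mulrA -exprMn (mulrC b) e [b ^+ N.+1]exprSr; ring.
exists u', v'; split.
- by rewrite -(idealX1 J); apply: (supJ' 1%N u' N); rewrite -eu addn1.
- by rewrite -(idealX1 I); apply: (supI' 1%N v' N); rewrite -ev addn1.
apply: (@nzdI R (b ^+ N)); first exact: nzdX hba.1.
apply: (@nzdI R (a ^+ N)); first exact: nzdX hab.1.
by rewrite mulrA -exprMn e eu ev [a ^+ N.+1]exprSr [b ^+ N.+1]exprSr; ring.
Qed.

End LocalCohomologyComponent.

Unset Implicit Arguments.
Set Strict Implicit.
Set Printing Implicit Defensive.

Local Open Scope classical_set_scope.

Theorem corollary4p10 (R : comNzRingType) (m I J : ideal R)
    (Rnoeth : noetherian_ring R) (Rlocal : local_ring m)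
    (Rdim : krull_dim R 2) (RCM : cohen_macaulay m)
    (Rres : infinite_set [set: quot_ring m])
    (Iprim : primary_to m I) (Jprim : primary_to m J)
    (depthI : gr_depth_ge m I 1) (depthJ : gr_depth_ge m J 1) :
  [<-> (* (a) *)
       joint_reduction_number0 I J;
       (* (b) *)
       [/\ bihilbert_coef I J 1 0 = hilbert_coef I 1,
           bihilbert_coef I J 0 1 = hilbert_coef J 1
         & hilbert_coef (idealM I J) 2 = hilbert_coef I 2 + hilbert_coef J 2];
       (* (c) *)
       forall (a b : R) (aI : a \in I) (bJ : b \in J),
         joint_reduction I J a b ->
         H2_comp (at1 J aI) (bt2 I bJ) 0 0 = [set 0]].
Proof.
have [Im Iopen] := primary_open Rnoeth Rlocal Iprim.
have [Jm Jopen] := primary_open Rnoeth Rlocal Jprim.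
have [x [y [xm ym xy_reg]]] := cohen_macaulay2 Rdim RCM.
have xy_open := dim2_parameters Rnoeth Rlocal Rdim xm ym xy_reg.
have sop := system_of_parameters Rnoeth Rlocal xm ym xy_reg xy_open.
have [n0 [e [f [c [d [d' [z [he hf h hcond]]]]]]]] :=
  hilbert_conditionsP Rnoeth Rlocal Im Jm Iopen Jopen xm ym xy_reg xy_open.
have defE a b (aI : a \in I) (bJ : b \in J) (ab_open : open_ideal m (pair_ideal a b)) :=
  @defectE _ _ _ _ Rnoeth Rlocal Im Jm Iopen Jopen x y xm ym xy_reg a b aI bJ ab_open.
tfae.
(* With all defects zero, [defectE] is a second polynomial expression for the colength of [I^r J^s];
   uniqueness in two variables gives the three conditions. *)
- move=> [a [b [hjr h0]]]; apply/hcond; have [aI bJ _] := hjr.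
  have ab_open := joint_reduction_open Iopen Jopen hjr.
  pose lambda := len (pair_ideal a b) idealT.
  have hE r s : (hilb I J r s = r * s * lambda + hilb I J r 0 + hilb I J 0 s)%N.
    rewrite -(defE a b aI bJ ab_open r s) /defect.
    by rewrite (ideal_anti (corner_sub aI bJ (s := s)) (rees_corner aI bJ h0 (s := s))) (lenn _).2.
  pose E i j : int := match i, j with
    | 2, 0 => e 0 | 0, 2 => f 0 | 1, 1 => c | 1, 0 => d | 0, 1 => d' | _, _ => z end.
  pose F i j : int := match i, j with
    | 2, 0 => e 0 | 0, 2 => f 0 | 1, 1 => lambda%:Z | 1, 0 => e 1 | 0, 1 => f 1
    | _, _ => e 2 + f 2 end.
  have [|] := @biquadratic_unique n0 E F.
    move=> r s hr hs.
    suff key : e 0 * 'C(r.+1, 2)%:Z + f 0 * 'C(s.+1, 2)%:Z + c * r%:Z * s%:Z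
          - d * r%:Z - d' * s%:Z + z =
        e 0 * 'C(r.+1, 2)%:Z + f 0 * 'C(s.+1, 2)%:Z + lambda%:Z * r%:Z * s%:Z
          - e 1 * r%:Z - f 1 * s%:Z + (e 2 + f 2) by exact: key.
    have eH : (hilb I J r s)%:Z = r%:Z * s%:Z * lambda%:Z + (hilb I J r 0)%:Z + (hilb I J 0 s)%:Z.
      by rewrite hE !PoszD !PoszM.
    by rewrite -h // eH he // hf //; ring.
  by rewrite /E /F.
- move=> /hcond[dE d'E zE] a b aI bJ hjr.
  have ab_open := joint_reduction_open Iopen Jopen hjr.
  pose lambda := len (pair_ideal a b) idealT.
  have [n1 [C hC]] := defect_linear Rnoeth Rlocal Im Jm Iopen Jopen xm ym xy_reg aI bJ ab_open hjr.
  have defn n : (n0 <= n)%N -> (defect I J a b n n)%:Z = (lambda%:Z - c) * n%:Z * n%:Z.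
    move=> le; have eD : (defect I J a b n n)%:Z =
        n%:Z * n%:Z * lambda%:Z + (hilb I J n 0)%:Z + (hilb I J 0 n)%:Z - (hilb I J n n)%:Z.
      by rewrite -!PoszM -!PoszD -(defE a b aI bJ ab_open n n) PoszD addrK.
    by rewrite eD (h n n le le) (he n le) (hf n le) dE d'E zE; ring.
  have S1 n : n.+1%:Z = n%:Z + 1 by lia.
  (* The factor 2 is the second difference of [n^2]. The defect [(lambda - c) n^2] lies between 0
     and a linear function, so this difference vanishes. *)
  have lamE : 2 * (lambda%:Z - c) = 0.
    apply: (@iter_dif_squeeze 2 (fun n => (defect I J a b n n)%:Z)
      (fun n => C%:Z * n%:Z + C%:Z) (fun=> 0) _ (maxn n0 n1)).
    + move=> n; rewrite geq_max => /andP[le0 _].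
      rewrite /= /dif (defn _ (leqW (leqW le0))) (defn _ (leqW le0)) (defn _ le0) !S1; ring.
    + by move=> n _; rewrite /= /dif !S1; ring.
    + by move=> n _ /=; rewrite /dif.
    + move=> n; rewrite geq_max => /andP[_ le1].
      by apply/andP; split=> //; have := hC n le1; lia.
  apply: (@corner_boundary _ _ _ _ _ _ _ n0) => n le.
  apply: len_eq0; first exact: corner_sub.
    apply: (@finlenS _ (corner I J a b n n) _ idealT) => //.
    exact: (@fin_corner _ _ _ _ Rnoeth Rlocal Im Jm Iopen Jopen x y xm ym xy_reg).
  have := defn n le; have -> : lambda%:Z - c = 0 by lia.
  by rewrite !mul0r => -[].
- move=> hc; have [C hC] := hilb_growth sop Iopen Jopen.
  have rad (K : ideal R) : primary_to m K -> forall x, x \in m -> exists n, x ^+ n \in K.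
    by move=> [_ _ hK] w /hK.
  have gI := gr_depth_generic Rnoeth (rad I Iprim) depthI.
  have gJ := gr_depth_generic Rnoeth (rad J Jprim) depthJ.
  (* The colon conditions enter as the generic properties [P] and [Q], so one pair is a joint
     reduction and has both; (c) is applied to that pair. *)
  have [a [b [supI supJ hjr]]] :=
    generic_joint_reduction Rnoeth Rlocal Im Iopen Jopen Rres hC gI gJ.
  have [aI bJ _] := hjr; exists a, b; split=> //.
  have ab_open := joint_reduction_open Iopen Jopen hjr.
  have [hab hba] := open_regular Rnoeth Rlocal Im Jm xm ym xy_reg aI bJ ab_open.
  exact: (boundary_corner hab hba supI supJ (hc a b aI bJ hjr)).
Qed.
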